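(* Let $p\in\left(1-\frac{\sqrt{2}}{2},1\right)$. Then the closed convex hull of the class $Co(p)$ is a proper subset of the class of all functions $f$ of the form $$f(z)=\frac{z-\frac{p}{1+p^2}\left(1+\omega(z)\right)z^2}{\left(1-\frac{z}{p}\right)(1-zp)},\qquad z\in\mathbb{D},$$ where $\omega:\mathbb{D}\to\overline{\mathbb{D}}$ is holomorphic in $\mathbb{D}$.
   Context: $\mathbb{D}=\{z\in\mathbb{C}:|z|<1\}$ is the open unit disc, $\overline{\mathbb{D}}$ its closure, and $\overline{\mathbb{C}}$ is the Riemann sphere. For $p\in(0,1)$, $Co(p)$ denotes the family of functions $f:\mathbb{D}\to\overline{\mathbb{C}}$ such that: (i) $f$ is meromorphic in $\mathbb{D}$ and has a simple pole at the point $p$; (ii) $f(0)=f'(0)-1=0$; (iii) $f$ maps $\mathbb{D}$ conformally (in particular injectively) onto a set whose complement with respect to $\overline{\mathbb{C}}$ is convex. The closed convex hull is taken in the topology of uniform convergence on compact subsets of $\mathbb{D}$; since the functions considered are holomorphic in $\mathbb{D}\setminus\{p\}$ with at most a simple pole at $p$, this is understood as uniform convergence on compact subsets of $\mathbb{D}\setminus\{p\}$ (equivalently, for such functions, uniform convergence of $(z-p)f(z)$ on compact subsets of $\mathbb{D}$). *)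

(* Defs.v *)
(* Stdlib reals and Coquelicot.  A function on the unit disc is represented by
   a total function on C whose values outside the disc are never inspected. *)
From Stdlib Require Import Reals List.
From Coquelicot Require Import Coquelicot.

Open Scope R_scope.

Definition disc (z : C) : Prop := Cmod z < 1.

Definition C_differentiable (g : C -> C) (z : C) : Prop :=
  @ex_derive C_AbsRing C_NormedModule g z.

(* The Riemann sphere; [None] is the point at infinity. *)
Definition sphere : Type := option C.

Definition finite_part (w : sphere) : C :=
  match w with Some c => c | None => RtoC 0 end.

(* Quotient in the sphere, with a / 0 = infinity; it is only meant to be used
   when a and b do not vanish simultaneously. *)
Definition sphere_div (a b : C) : sphere :=
  if Ceq_dec b 0 then None else Some (a / b)%C.

Definition sphere_is_derive (f : C -> sphere) (z l : C) : Prop :=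
  exists g : C -> C,
    locally (T := C_UniformSpace) z (fun w => f w = Some (g w)) /\
    @is_derive C_AbsRing C_NormedModule g z l.

Definition holomorphic_at (f : C -> sphere) (z : C) : Prop :=
  exists g : C -> C,
    locally (T := C_UniformSpace) z
      (fun w => f w = Some (g w) /\ C_differentiable g w).

(* A pole of order n >= 1: f = h / (. - z)^n near z, with h holomorphic near z
   and h z <> 0. *)
Definition pole (f : C -> sphere) (z : C) (n : nat) : Prop :=
  (1 <= n)%nat /\ f z = None /\
  exists h : C -> C,
    h z <> RtoC 0 /\
    locally (T := C_UniformSpace) z (fun w => C_differentiable h w) /\
    locally (T := C_UniformSpace) z
      (fun w => w <> z -> f w = Some (h w / (w - z) ^ n)%C).

Definition meromorphic_in_disc (f : C -> sphere) : Prop :=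
  forall z : C, disc z -> holomorphic_at f z \/ exists n : nat, pole f z n.

(* A subset of the sphere is convex if it is a convex subset of the plane. *)
Definition sphere_convex (E : sphere -> Prop) : Prop :=
  ~ E None /\
  forall (a b : C) (t : R), 0 <= t <= 1 ->
    E (Some a) -> E (Some b) -> E (Some (RtoC t * a + RtoC (1 - t) * b)%C).

Definition Co (p : R) (f : C -> sphere) : Prop :=
  meromorphic_in_disc f /\
  pole f (RtoC p) 1 /\
  f (RtoC 0) = Some (RtoC 0) /\
  sphere_is_derive f (RtoC 0) (RtoC 1) /\
  (forall z w : C, disc z -> disc w -> f z = f w -> z = w) /\
  sphere_convex (fun w => ~ exists z : C, disc z /\ f z = w).

(* The ambient space of the closed convex hull.  Its elements are finite-valued
   on the punctured disc and determined on the disc by these values, so linear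
   operations and convergence are defined through [finite_part] there. *)
Definition at_most_simple_pole (p : R) (f : C -> sphere) : Prop :=
  (forall z : C, disc z -> z <> RtoC p -> holomorphic_at f z) /\
  (holomorphic_at f (RtoC p) \/ pole f (RtoC p) 1).

Definition convex_hull (p : R) (S : (C -> sphere) -> Prop) (f : C -> sphere)
  : Prop :=
  at_most_simple_pole p f /\
  exists (n : nat) (t : nat -> R) (F : nat -> C -> sphere),
    (forall i : nat, (i <= n)%nat -> 0 <= t i /\ S (F i)) /\
    sum_n t n = 1 /\
    forall z : C, disc z -> z <> RtoC p ->
      f z = Some (@sum_n C_AbelianMonoid
                    (fun i => (RtoC (t i) * finite_part (F i z))%C) n).

Definition compact_set {T : UniformSpace} (K : T -> Prop) : Prop :=
  forall (I : Type) (U : I -> T -> Prop),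
    (forall i : I, open (U i)) ->
    (forall x : T, K x -> exists i : I, U i x) ->
    exists l : list I, forall x : T, K x -> exists i : I, In i l /\ U i x.

(* Closure for uniform convergence on compact subsets of the punctured disc. *)
Definition compact_closure (p : R) (S : (C -> sphere) -> Prop)
  (f : C -> sphere) : Prop :=
  at_most_simple_pole p f /\
  forall (K : C -> Prop) (eps : R),
    compact_set (T := C_UniformSpace) K ->
    (forall z : C, K z -> disc z /\ z <> RtoC p) ->
    0 < eps ->
    exists g : C -> sphere, S g /\
      forall z : C, K z ->
        Cmod (finite_part (f z) - finite_part (g z))%C < eps.

Definition closed_convex_hull (p : R) (S : (C -> sphere) -> Prop)
  : (C -> sphere) -> Prop :=
  compact_closure p (convex_hull p S).

(* In the disc the denominator vanishes only at z = p, where the numerator is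
   p (1 - p^2 omega(p)) / (1 + p^2) <> 0: the value there is infinity. *)
Definition representable (p : R) (f : C -> sphere) : Prop :=
  exists omega : C -> C,
    (forall z : C, disc z -> C_differentiable omega z) /\
    (forall z : C, disc z -> Cmod (omega z) <= 1) /\
    forall z : C, disc z ->
      f z = sphere_div
              (z - RtoC (p / (1 + p ^ 2)) * (1 + omega z) * z ^ 2)
              ((1 - z / RtoC p) * (1 - z * RtoC p)).

(* Main.v *)
Require Import Defs.
From Stdlib Require Import Reals Lra Lia List Classical ClassicalEpsilon.
From Coquelicot Require Import Coquelicot.
Import Defs.

(** Let M z = (p - z) / (1 - p z), the involution of the disc that exchanges 0
    and p.  For f in Co(p) the function F = f o M has the form F z = k z / z
    with k holomorphic; it is univalent, has its pole at the centre and omits a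
    convex set K.  Everything rests on one inequality for such functions.  Put
      J2 a z     = (z k(a) - a k(z)) / (z - a),
      dquot2 a z = (k(z) - k(a) - k'(a) (z - a)) / (z - a)^2;
    both are holomorphic in a and in z, and the function
      schur a z  = dquot2 / (J2 + a z dquot2)
    is bounded by 1 in the bidisc ([schur_bound]).

    Why: if u lies in K and 0 < t < 1, then (F - t u) / (1 - t) takes no value
    in K, because K is convex.  Its composition with the inverse of F is a
    self-map of the disc that fixes the centre, and Schwarz's lemma for t -> 0
    yields Re ((F(z) - u) / (- z F'(z))) >= 0 ([starlike]).  For |l| < 1 the
    function s -> (F(l s) - F(s)) / (- l s F'(l s)) is holomorphic in the whole
    disc; near the boundary F(s) is close to K ([near_boundary]), so its real
    part is nonnegative too ([level_curve_half_plane_lt]).  On |a| = |z| this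
    says that a z dquot2 / J2 has real part at least -1/2; the maximum principle
    extends this to all a and z, and a Cayley transform followed by division by
    a z bounds schur.

    Two choices of a give the two halves of the theorem.

    For a = p the normalisation f(0) = 0, f'(0) = 1 determines k(p) and k'(p),
    and omega o M = (p^2 - schur) / (1 - p^2 schur) is bounded by 1.  Cleared of
    denominators, |omega z| <= 1 bounds an affine function of f(z), so it passes
    to convex combinations and to limits; removable singularities then produce
    a holomorphic omega for every function of the hull ([hull_representable]).

    For a = 0 the bound says that the remainder R in F = c / z + c' + z R is at
    most |c|, and |c| <= p^2 / (1 - p^2)^2 by the first half.  Summing F(z) / z
    over the four points z = r i^j leaves the sum of the values R, so that
    4 p^2 / (1 - p^2)^2 bounds a linear functional on Co(p) and hence on its
    hull ([Co_quad]).  For a function given by omega this functional tends, as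
    r -> 0, to a multiple of p^2 - W0 + 2 p W1 - p^2 W2, where the Wj are the
    Taylor coefficients of W = omega o M.  The constant W = -1 attains the bound.
    Replacing it by the Blaschke factor -(b - z) / (1 - b z) with b slightly
    less than 1 gives a larger value as soon as 1 - 4 p + 2 p^2 < 0, that is,
    for p > 1 - sqrt 2 / 2 ([blaschke_not_in_hull]).

    The function theory is developed from complex differentiability alone.
    Goursat's theorem for rectangles, applied to w -> g (c + exp w), gives the
    mean value property; from it follow the maximum principle, Cauchy's formula
    and the removability of isolated singularities. *)

Open Scope R_scope.

(** * Complex differentiation *)

(** Continuity measured by Cmod, the form in which all estimates are made. *)
Definition cont_at (g : C -> C) (z : C) : Prop :=
  forall eps, 0 < eps -> exists delta, 0 < delta /\
    forall w, Cmod (w - z) < delta -> Cmod (g w - g z) < eps.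

(** Caratheodory form of the complex derivative: the rules of calculus become
    identities between the difference quotients A. *)
Definition cder (g : C -> C) (z l : C) : Prop :=
  exists A : C -> C, cont_at A z /\ A z = l /\
    forall w, g w = (g z + (w - z) * A w)%C.

Lemma Cminus_0_r (z : C) : (z - 0)%C = z.
Proof. ring. Qed.

Lemma Cmod_sub_sym (z w : C) : Cmod (z - w) = Cmod (w - z).
Proof. rewrite <- (Cmod_opp (z - w)). f_equal. ring. Qed.

Lemma Cmod_sub_ge (z w : C) : Cmod z - Cmod w <= Cmod (z - w).
Proof.
  pose proof (Cmod_triangle (z - w) w) as H.
  replace (z - w + w)%C with z in H by ring. lra.
Qed.

Lemma Cmod_sub_le (z w : C) : Cmod (z - w) <= Cmod z + Cmod w.
Proof.
  pose proof (Cmod_triangle z (- w)) as H. rewrite Cmod_opp in H. exact H.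
Qed.

Lemma Cmod_sub_triangle (x y z : C) :
  Cmod (x - z) <= Cmod (x - y) + Cmod (y - z).
Proof.
  replace (x - z)%C with ((x - y) + (y - z))%C by ring. apply Cmod_triangle.
Qed.

Lemma Cmod_sub_0 (z : C) : Cmod (z - z) = 0.
Proof. replace (z - z)%C with (RtoC 0) by ring. apply Cmod_0. Qed.

Lemma Cmod_sub_eq (z w : C) : Cmod (z - w) = 0 -> z = w.
Proof. intros H. apply Cmod_eq_0, Ceq_minus in H. exact H. Qed.

Lemma Cmod_sub_pos (z w : C) : z <> w -> 0 < Cmod (z - w).
Proof. intros H. apply Cmod_gt_0, Cminus_eq_contra, H. Qed.

Lemma locally_C_iff (z : C) (P : C -> Prop) :
  locally (T := C_UniformSpace) z P <->
  exists r, 0 < r /\ forall w, Cmod (w - z) < r -> P w.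
Proof.
  rewrite locally_C. split.
  - intros [d Hd]. exists d. split. apply cond_pos. intros w Hw. apply Hd. exact Hw.
  - intros [r [Hr H]]. exists (mkposreal r Hr). intros w Hw. apply H. exact Hw.
Qed.

Lemma cont_at_continuous (g : C -> C) z :
  cont_at g z <-> continuous (T := C_UniformSpace) (U := C_UniformSpace) g z.
Proof.
  unfold continuous. split.
  - intros H P HP. apply locally_C_iff in HP. destruct HP as [e [He HP]].
    destruct (H e He) as [d [Hd H1]].
    unfold filtermap. apply locally_C_iff. exists d. split; auto.
  - intros H e He.
    assert (HP : locally (T := C_UniformSpace) (g z) (fun w => Cmod (w - g z) < e)).
    { apply locally_C_iff. exists e. auto. }
    specialize (H _ HP). unfold filtermap in H. apply locally_C_iff in H.
    destruct H as [d [Hd H]]. exists d; auto.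
Qed.

Lemma is_derive_iff (g : C -> C) (z l : C) :
  @is_derive C_AbsRing C_NormedModule g z l <->
  forall eps, 0 < eps -> exists delta, 0 < delta /\
    forall w, Cmod (w - z) < delta ->
      Cmod (g w - g z - (w - z) * l) <= eps * Cmod (w - z).
Proof.
  split.
  - intros [_ H] e He.
    specialize (H z (fun P HP => HP) (mkposreal e He)).
    apply locally_C in H. apply locally_C_iff in H. destruct H as [d [Hd H]].
    exists d. split; auto.
  - intros H. split.
    + apply is_linear_scal_l.
    + intros x Hx. apply (is_filter_lim_locally_unique (V := AbsRing_NormedModule C_AbsRing)) in Hx. subst x.
      intros e. destruct (H e (cond_pos e)) as [d [Hd H1]].
      apply locally_C. apply locally_C_iff. exists d. split; auto.
Qed.

Lemma cder_iff (g : C -> C) (z l : C) :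
  @is_derive C_AbsRing C_NormedModule g z l <-> cder g z l.
Proof.
  rewrite is_derive_iff. split.
  - intros H.
    exists (fun w => if Ceq_dec w z then l else (g w - g z) / (w - z))%C.
    split; [|split].
    + intros e He. destruct (H (e/2)) as [d [Hd H1]]; [lra|].
      exists d. split; auto. intros w Hw.
      destruct (Ceq_dec z z) as [_|n]; [|congruence].
      destruct (Ceq_dec w z) as [->|n]. rewrite Cmod_sub_0; lra.
      specialize (H1 w Hw). pose proof (Cmod_sub_pos _ _ n) as Hp.
      replace ((g w - g z) / (w - z) - l)%C
        with ((g w - g z - (w - z) * l) / (w - z))%C.
      2:{ field. apply Cminus_eq_contra, n. }
      rewrite Cmod_div by (apply Cminus_eq_contra, n).
      apply Rle_lt_trans with (e/2); [|lra].
      apply Rmult_le_reg_r with (1 := Hp). unfold Rdiv at 1.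
      rewrite Rmult_assoc, Rinv_l; lra.
    + destruct (Ceq_dec z z); congruence.
    + intros w. destruct (Ceq_dec w z) as [->|n]. ring.
      field. apply Cminus_eq_contra, n.
  - intros [A [HA [Hl Hg]]] e He. destruct (HA e He) as [d [Hd H]].
    exists d. split; auto. intros w Hw. rewrite (Hg w).
    replace (g z + (w - z) * A w - g z - (w - z) * l)%C
      with ((w - z) * (A w - A z))%C by (rewrite Hl; ring).
    rewrite Cmod_mult, Rmult_comm.
    apply Rmult_le_compat_r. apply Cmod_ge_0. left. auto.
Qed.

Lemma cdiff_iff g z : C_differentiable g z <-> exists l, cder g z l.
Proof.
  unfold C_differentiable, ex_derive. split; intros [l H]; exists l; apply cder_iff; auto.
Qed.

Lemma cont_at_const c z : cont_at (fun _ => c) z.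
Proof. intros e He. exists 1. split. lra. intros. rewrite Cmod_sub_0; auto. Qed.

Lemma cont_at_id z : cont_at (fun w => w) z.
Proof. intros e He. exists e. auto. Qed.

Lemma cont_at_plus f g z : cont_at f z -> cont_at g z -> cont_at (fun w => f w + g w)%C z.
Proof.
  intros Hf Hg e He. destruct (Hf (e/2)) as [d1 [Hd1 H1]]; [lra|].
  destruct (Hg (e/2)) as [d2 [Hd2 H2]]; [lra|].
  exists (Rmin d1 d2). split. apply Rmin_glb_lt; auto.
  intros w Hw. specialize (H1 w (Rlt_le_trans _ _ _ Hw (Rmin_l _ _))).
  specialize (H2 w (Rlt_le_trans _ _ _ Hw (Rmin_r _ _))).
  replace (f w + g w - (f z + g z))%C with ((f w - f z) + (g w - g z))%C by ring.
  eapply Rle_lt_trans. apply Cmod_triangle. lra.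
Qed.

Lemma cont_at_comp f g z : cont_at g z -> cont_at f (g z) -> cont_at (fun w => f (g w)) z.
Proof.
  intros Hg Hf e He. destruct (Hf e He) as [d [Hd H]].
  destruct (Hg d Hd) as [d' [Hd' H']]. exists d'; auto.
Qed.

Lemma cont_at_mult f g z : cont_at f z -> cont_at g z -> cont_at (fun w => f w * g w)%C z.
Proof.
  intros Hf Hg e He.
  pose (M := Cmod (f z) + Cmod (g z) + 1).
  assert (HM : 0 < M) by (unfold M; pose proof (Cmod_ge_0 (f z)); pose proof (Cmod_ge_0 (g z)); lra).
  pose (k := Rmin 1 (e / (2 * M))).
  assert (Hk : 0 < k). { apply Rmin_glb_lt. lra. apply Rdiv_lt_0_compat; lra. }
  assert (HkM : k * (2 * M) <= e).
  { replace e with (e / (2*M) * (2 * M)) by (field; lra).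
    apply Rmult_le_compat_r. lra. apply Rmin_r. }
  assert (Hk1 : k <= 1) by apply Rmin_l.
  destruct (Hf k Hk) as [d1 [Hd1 H1]].
  destruct (Hg k Hk) as [d2 [Hd2 H2]].
  exists (Rmin d1 d2). split. apply Rmin_glb_lt; auto.
  intros w Hw. specialize (H1 w (Rlt_le_trans _ _ _ Hw (Rmin_l _ _))).
  specialize (H2 w (Rlt_le_trans _ _ _ Hw (Rmin_r _ _))).
  replace (f w * g w - f z * g z)%C
    with ((f w - f z) * (g w - g z) + (f z * (g w - g z) + g z * (f w - f z)))%C by ring.
  eapply Rle_lt_trans. apply Cmod_triangle.
  pose proof (Cmod_triangle (f z * (g w - g z)) (g z * (f w - f z))) as H3.
  rewrite !Cmod_mult in *.
  pose proof (Cmod_ge_0 (f z)); pose proof (Cmod_ge_0 (g z)).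
  pose proof (Cmod_ge_0 (f w - f z)); pose proof (Cmod_ge_0 (g w - g z)).
  unfold M in *. nra.
Qed.

Lemma cont_at_opp f z : cont_at f z -> cont_at (fun w => - f w)%C z.
Proof.
  intros Hf e He. destruct (Hf e He) as [d [Hd H]]. exists d; split; auto.
  intros w Hw. replace (- f w - - f z)%C with (- (f w - f z))%C by ring.
  rewrite Cmod_opp. auto.
Qed.

Lemma cont_at_minus f g z : cont_at f z -> cont_at g z -> cont_at (fun w => f w - g w)%C z.
Proof. intros. apply cont_at_plus; auto. apply cont_at_opp; auto. Qed.

Lemma cont_at_inv f z : f z <> RtoC 0 -> cont_at f z -> cont_at (fun w => / f w)%C z.
Proof.
  intros H0 Hf e He. pose proof (proj1 (Cmod_gt_0 _) H0) as Hp.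
  pose (m := Cmod (f z)). fold m in Hp.
  destruct (Hf (Rmin (m/2) (e * (m * m / 2)))) as [d [Hd H]].
  { apply Rmin_glb_lt. lra. apply Rmult_lt_0_compat; nra. }
  exists d. split; auto. intros w Hw. specialize (H w Hw).
  pose proof (Rlt_le_trans _ _ _ H (Rmin_l _ _)) as Ha.
  pose proof (Rlt_le_trans _ _ _ H (Rmin_r _ _)) as Hb.
  pose proof (Cmod_sub_ge (f z) (f w)) as Hc. rewrite Cmod_sub_sym in Hc. fold m in Hc.
  assert (Hw0 : f w <> RtoC 0). { apply Cmod_gt_0. lra. }
  replace (/ f w - / f z)%C with (- ((f w - f z) / (f w * f z)))%C by (field; auto).
  rewrite Cmod_opp, Cmod_div, Cmod_mult by (apply Cmult_neq_0; auto). fold m.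
  apply Rmult_lt_reg_r with (Cmod (f w) * m). nra.
  unfold Rdiv. rewrite Rmult_assoc, Rinv_l by nra.
  rewrite Rmult_1_r. eapply Rlt_le_trans. apply Hb.
  apply Rmult_le_compat_l. lra. nra.
Qed.

Lemma cont_at_div f g z : g z <> RtoC 0 -> cont_at f z -> cont_at g z -> cont_at (fun w => f w / g w)%C z.
Proof. intros. apply cont_at_mult; auto. apply cont_at_inv; auto. Qed.

Lemma cont_at_ext_loc f g z r : 0 < r -> (forall w, Cmod (w - z) < r -> f w = g w) ->
  cont_at f z -> cont_at g z.
Proof.
  intros Hr He H e Hep. destruct (H e Hep) as [d [Hd H1]].
  exists (Rmin d r). split. apply Rmin_glb_lt; auto.
  intros w Hw. rewrite <- !He. apply H1. eapply Rlt_le_trans. apply Hw. apply Rmin_l.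
  rewrite Cmod_sub_0; auto. eapply Rlt_le_trans. apply Hw. apply Rmin_r.
Qed.

Lemma cder_cont_at g z l : cder g z l -> cont_at g z.
Proof.
  intros [A [HA [_ Hg]]].
  assert (H : cont_at (fun w => g z + (w - z) * A w)%C z).
  { apply cont_at_plus. apply cont_at_const. apply cont_at_mult; auto.
    apply cont_at_minus. apply cont_at_id. apply cont_at_const. }
  eapply cont_at_ext_loc with (r := 1); [lra| |apply H].
  intros w _. rewrite (Hg w). reflexivity.
Qed.

Lemma cder_ext_loc f g z l r : 0 < r -> (forall w, Cmod (w - z) < r -> f w = g w) ->
  cder f z l -> cder g z l.
Proof.
  intros Hr He H. apply cder_iff in H. apply cder_iff.
  rewrite is_derive_iff in *. intros e Hep. destruct (H e Hep) as [d [Hd H1]].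
  exists (Rmin d r). split. apply Rmin_glb_lt; auto.
  intros w Hw. rewrite <- !He. apply H1. eapply Rlt_le_trans. apply Hw. apply Rmin_l.
  rewrite Cmod_sub_0; auto. eapply Rlt_le_trans. apply Hw. apply Rmin_r.
Qed.

Lemma cder_const c z : cder (fun _ => c) z 0.
Proof.
  exists (fun _ => RtoC 0). split; [|split]. apply cont_at_const. auto. intros; ring.
Qed.

Lemma cder_id z : cder (fun w => w) z 1.
Proof.
  exists (fun _ => RtoC 1). split; [|split]. apply cont_at_const. auto. intros; ring.
Qed.

Lemma cder_plus f g z a b : cder f z a -> cder g z b -> cder (fun w => f w + g w)%C z (a + b).
Proof.
  intros [A [HA [HAz Hf]]] [B [HB [HBz Hg]]].
  exists (fun w => A w + B w)%C. split; [|split].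
  - apply cont_at_plus; auto.
  - congruence.
  - intros w. rewrite (Hf w), (Hg w). ring.
Qed.

Lemma cder_mult f g z a b : cder f z a -> cder g z b ->
  cder (fun w => f w * g w)%C z (a * g z + f z * b).
Proof.
  intros HF HG. pose proof (cder_cont_at _ _ _ HG) as Cg.
  destruct HF as [A [HA [HAz Hf]]]. destruct HG as [B [HB [HBz Hg]]].
  exists (fun w => A w * g w + f z * B w)%C. split; [|split].
  - apply cont_at_plus; apply cont_at_mult; auto. apply cont_at_const.
  - congruence.
  - intros w. rewrite (Hf w), (Hg w). ring.
Qed.

Lemma cder_opp f z a : cder f z a -> cder (fun w => - f w)%C z (- a).
Proof.
  intros [A [HA [HAz Hf]]].
  exists (fun w => - A w)%C. split; [|split].
  - apply cont_at_opp; auto.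
  - congruence.
  - intros w. rewrite (Hf w). ring.
Qed.

Lemma cder_minus f g z a b : cder f z a -> cder g z b -> cder (fun w => f w - g w)%C z (a - b).
Proof. intros. apply cder_plus; auto. apply cder_opp; auto. Qed.

Lemma cder_inv f z a : f z <> RtoC 0 -> cder f z a -> cder (fun w => / f w)%C z (- a / (f z * f z)).
Proof.
  intros H0 HF. pose proof (cder_cont_at _ _ _ HF) as Cf.
  destruct (Cf (Cmod (f z))) as [d [Hd Hd']]. apply Cmod_gt_0; auto.
  assert (Hn : forall w, Cmod (w - z) < d -> f w <> RtoC 0).
  { intros w Hw E. specialize (Hd' w Hw). rewrite E in Hd'.
    replace (0 - f z)%C with (- f z)%C in Hd' by ring. rewrite Cmod_opp in Hd'. lra. }
  destruct HF as [A [HA [HAz Hf]]].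
  apply (cder_ext_loc (fun w => / f z + (w - z) * (- A w / (f w * f z)))%C _ _ _ d); auto.
  { intros w Hw. specialize (Hn w Hw).
    replace ((w - z) * (- A w / (f w * f z)))%C with (- ((f z + (w - z) * A w) - f z) / (f w * f z))%C
      by (field; auto). rewrite <- Hf. field; auto. }
  exists (fun w => - A w / (f w * f z))%C. split; [|split].
  - apply cont_at_div. apply Cmult_neq_0; auto. apply cont_at_opp; auto.
    apply cont_at_mult; auto. apply cont_at_const.
  - congruence.
  - intros w. ring.
Qed.

Lemma cder_comp f g z a b : cder g z a -> cder f (g z) b -> cder (fun w => f (g w)) z (b * a).
Proof.
  intros HG HF. pose proof (cder_cont_at _ _ _ HG) as Cg.
  destruct HG as [A [HA [HAz Hg]]]. destruct HF as [B [HB [HBz Hf]]].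
  exists (fun w => B (g w) * A w)%C. split; [|split].
  - apply cont_at_mult; auto. apply cont_at_comp; auto.
  - congruence.
  - intros w. rewrite (Hf (g w)).
    replace (g w - g z)%C with ((w - z) * A w)%C by (rewrite (Hg w); ring). ring.
Qed.

Lemma cder_eq f z a b : cder f z a -> a = b -> cder f z b.
Proof. congruence. Qed.

Lemma cdiff_cont_at f z : C_differentiable f z -> cont_at f z.
Proof. rewrite cdiff_iff. intros [l H]. eapply cder_cont_at; eauto. Qed.
Lemma cdiff_const c z : C_differentiable (fun _ => c) z.
Proof. apply cdiff_iff. eexists. apply cder_const. Qed.
Lemma cdiff_id z : C_differentiable (fun w => w) z.
Proof. apply cdiff_iff. eexists. apply cder_id. Qed.
Lemma cdiff_plus f g z : C_differentiable f z -> C_differentiable g z ->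
  C_differentiable (fun w => f w + g w)%C z.
Proof. rewrite !cdiff_iff. intros [a Ha] [b Hb]. eexists. apply cder_plus; eauto. Qed.
Lemma cdiff_minus f g z : C_differentiable f z -> C_differentiable g z ->
  C_differentiable (fun w => f w - g w)%C z.
Proof. rewrite !cdiff_iff. intros [a Ha] [b Hb]. eexists. apply cder_minus; eauto. Qed.
Lemma cdiff_opp f z : C_differentiable f z -> C_differentiable (fun w => - f w)%C z.
Proof. rewrite !cdiff_iff. intros [a Ha]. eexists. apply cder_opp; eauto. Qed.
Lemma cdiff_mult f g z : C_differentiable f z -> C_differentiable g z ->
  C_differentiable (fun w => f w * g w)%C z.
Proof. rewrite !cdiff_iff. intros [a Ha] [b Hb]. eexists. apply cder_mult; eauto. Qed.
Lemma cdiff_inv f z : f z <> RtoC 0 -> C_differentiable f z -> C_differentiable (fun w => / f w)%C z.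
Proof. intros H0. rewrite !cdiff_iff. intros [a Ha]. eexists. apply cder_inv; eauto. Qed.
Lemma cdiff_div f g z : g z <> RtoC 0 -> C_differentiable f z -> C_differentiable g z ->
  C_differentiable (fun w => f w / g w)%C z.
Proof. intros. apply cdiff_mult; auto. apply cdiff_inv; auto. Qed.
Lemma cdiff_comp f g z : C_differentiable g z -> C_differentiable f (g z) ->
  C_differentiable (fun w => f (g w)) z.
Proof. rewrite !cdiff_iff. intros [a Ha] [b Hb]. eexists. eapply cder_comp; eauto. Qed.
Lemma cdiff_ext_loc f g z r : 0 < r -> (forall w, Cmod (w - z) < r -> f w = g w) ->
  C_differentiable f z -> C_differentiable g z.
Proof. rewrite !cdiff_iff. intros Hr He [a Ha]. eexists. eapply cder_ext_loc; eauto. Qed.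
Lemma cdiff_cder f z : C_differentiable f z -> cder f z (C_derive f z).
Proof.
  intros H. apply cder_iff. apply C_derive_correct; auto.
Qed.

(** * The complex exponential *)

Definition cexp (w : C) : C := (exp (Re w) * cos (Im w), exp (Re w) * sin (Im w)).

Lemma cexp_plus (a b : C) : cexp (a + b) = (cexp a * cexp b)%C.
Proof.
  unfold cexp. rewrite re_plus, im_plus, exp_plus, cos_plus, sin_plus.
  unfold Cmult; simpl. f_equal; ring.
Qed.

Lemma cexp_0 : cexp 0 = 1.
Proof. unfold cexp; simpl. rewrite exp_0, cos_0, sin_0. unfold RtoC. f_equal; ring. Qed.

Lemma Cmod_cexp w : Cmod (cexp w) = exp (Re w).
Proof.
  unfold cexp, Cmod; simpl.
  replace (exp (Re w) * cos (Im w) * (exp (Re w) * cos (Im w) * 1) +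
     exp (Re w) * sin (Im w) * (exp (Re w) * sin (Im w) * 1))
   with (exp (Re w) * exp (Re w) * (Rsqr (sin (Im w)) + Rsqr (cos (Im w)))) by (unfold Rsqr; ring).
  rewrite sin2_cos2, Rmult_1_r. apply sqrt_square. left. apply exp_pos.
Qed.

Lemma derivable_pt_lim_eps f l : derivable_pt_lim f 0 l -> forall e, 0 < e ->
  exists d, 0 < d /\ forall x, Rabs x < d -> Rabs (f x - f 0 - x * l) <= e * Rabs x.
Proof.
  intros H e He. destruct (H e He) as [d Hd]. exists d. split. apply cond_pos.
  intros x Hx. destruct (Req_dec x 0) as [->|n].
  - rewrite Rmult_0_l, !Rminus_0_r, Rminus_diag, Rabs_R0. lra.
  - specialize (Hd x n Hx). rewrite Rplus_0_l in Hd.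
    replace (f x - f 0 - x * l) with (((f x - f 0) / x - l) * x) by (field; auto).
    rewrite Rabs_mult. apply Rmult_le_compat_r. apply Rabs_pos. lra.
Qed.

Lemma Cmod_le_abs (z : C) : Cmod z <= Rabs (Re z) + Rabs (Im z).
Proof.
  replace z with (RtoC (Re z) + Ci * RtoC (Im z))%C at 1.
  - eapply Rle_trans. apply Cmod_triangle. rewrite Cmod_mult, !Cmod_R, Cmod_Ci. lra.
  - destruct z; unfold RtoC, Ci, Cplus, Cmult; simpl. f_equal; ring.
Qed.

Lemma im_le_Cmod (z : C) : Rabs (Im z) <= Cmod z.
Proof. eapply Rle_trans; [|apply Rmax_Cmod]. apply Rmax_r. Qed.

Lemma cder_cexp_0 : cder cexp 0 1.
Proof.
  apply cder_iff, is_derive_iff. intros e He.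
  pose (k := Rmin (1/4) (e / 8)).
  assert (Hk : 0 < k) by (apply Rmin_glb_lt; lra).
  assert (Hk1 : k <= 1/4) by apply Rmin_l.
  assert (Hk2 : k <= e/8) by apply Rmin_r.
  clearbody k.
  pose proof (derivable_pt_lim_exp 0) as D1. rewrite exp_0 in D1.
  pose proof (derivable_pt_lim_sin 0) as D2. rewrite cos_0 in D2.
  pose proof (derivable_pt_lim_cos 0) as D3. rewrite sin_0 in D3.
  destruct (derivable_pt_lim_eps _ _ D1 k Hk) as [d1 [P1 E1]].
  destruct (derivable_pt_lim_eps _ _ D2 k Hk) as [d2 [P2 E2]].
  destruct (derivable_pt_lim_eps _ _ D3 k Hk) as [d3 [P3 E3]].
  exists (Rmin k (Rmin d1 (Rmin d2 d3))).
  split. { repeat apply Rmin_glb_lt; auto. }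
  intros w Hw. replace (w - 0)%C with w in * by ring.
  assert (Hwk : Cmod w < k) by (eapply Rlt_le_trans; [apply Hw|apply Rmin_l]).
  assert (Hw1 : Cmod w < d1) by (eapply Rlt_le_trans; [apply Hw|eapply Rle_trans; [apply Rmin_r|apply Rmin_l]]).
  assert (Hw2 : Cmod w < d2) by (eapply Rlt_le_trans; [apply Hw|eapply Rle_trans; [apply Rmin_r|eapply Rle_trans; [apply Rmin_r|apply Rmin_l]]]).
  assert (Hw3 : Cmod w < d3) by (eapply Rlt_le_trans; [apply Hw|eapply Rle_trans; [apply Rmin_r|eapply Rle_trans; [apply Rmin_r|apply Rmin_r]]]).
  pose proof (re_le_Cmod w) as Hre. pose proof (im_le_Cmod w) as Him.
  destruct w as [x y]. simpl in Hre, Him.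
  set (m := Cmod (x, y)) in *.
  specialize (E1 x ltac:(lra)). specialize (E2 y ltac:(lra)). specialize (E3 y ltac:(lra)).
  rewrite exp_0 in E1. rewrite sin_0 in E2. rewrite cos_0 in E3.
  rewrite Rmult_1_r in E1, E2. rewrite Rminus_0_r in E2.
  replace (cos y - 1 - y * - 0) with (cos y - 1) in E3 by ring.
  eapply Rle_trans. apply Cmod_le_abs.
  rewrite cexp_0. unfold cexp; simpl.
  pose proof (COS_bound y).
  assert (Hm : 0 <= m) by apply Cmod_ge_0.
  assert (A1 : Rabs (exp x * cos y + -(1) + - (x * 1 - y * 0)) <= 3 * k * m).
  { replace (exp x * cos y + -(1) + - (x * 1 - y * 0))
    with ((exp x - 1 - x) * cos y + (1 + x) * (cos y - 1)) by ring.
    eapply Rle_trans. apply Rabs_triang. rewrite !Rabs_mult.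
    assert (Rabs (cos y) <= 1) by (apply Rabs_le; lra).
    assert (Rabs (1 + x) <= 2). { eapply Rle_trans. apply Rabs_triang. rewrite Rabs_R1. lra. }
    pose proof (Rabs_pos (exp x - 1 - x)). pose proof (Rabs_pos (cos y)).
    pose proof (Rabs_pos (cos y - 1)). pose proof (Rabs_pos (1 + x)).
    assert (Rabs (exp x - 1 - x) <= k * m) by (eapply Rle_trans; [apply E1|]; apply Rmult_le_compat_l; lra).
    assert (Rabs (cos y - 1) <= k * m) by (eapply Rle_trans; [apply E3|]; apply Rmult_le_compat_l; lra).
    nra. }
  assert (Hx : Rabs (exp x - 1) <= 2 * k).
  { replace (exp x - 1) with ((exp x - 1 - x) + x) by ring.
    eapply Rle_trans. apply Rabs_triang. nra. }
  assert (A2 : Rabs (exp x * sin y + - 0 + - (x * 0 + y * 1)) <= 4 * k * m).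
  { replace (exp x * sin y + - 0 + - (x * 0 + y * 1))
    with (exp x * (sin y - y) + (exp x - 1) * y) by ring.
    eapply Rle_trans. apply Rabs_triang. rewrite !Rabs_mult.
    assert (Rabs (exp x) <= 2). { replace (exp x) with ((exp x - 1) + 1) by ring.
      eapply Rle_trans. apply Rabs_triang. rewrite Rabs_R1. lra. }
    pose proof (Rabs_pos (exp x)). pose proof (Rabs_pos (exp x - 1)). pose proof (Rabs_pos (sin y - y)).
    pose proof (Rabs_pos y).
    assert (Rabs (sin y - y) <= k * m) by (eapply Rle_trans; [apply E2|]; apply Rmult_le_compat_l; lra).
    assert (Rabs (exp x) * Rabs (sin y - y) <= 2 * (k * m)) by (apply Rmult_le_compat; lra).
    assert (Rabs (exp x - 1) * Rabs y <= (2 * k) * m) by (apply Rmult_le_compat; lra).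
    lra. }
  nra.
Qed.

Lemma cder_cexp w : cder cexp w (cexp w).
Proof.
  apply (cder_ext_loc (fun v => cexp w * cexp (v - w))%C _ _ _ 1); [lra| |].
  - intros v _. rewrite <- cexp_plus. f_equal. ring.
  - eapply cder_eq. apply cder_mult. apply cder_const.
    apply (cder_comp cexp (fun v => v - w)%C).
    apply cder_minus. apply cder_id. apply cder_const.
    replace (w - w)%C with (RtoC 0) by ring. apply cder_cexp_0.
    cbv beta. replace (w - w)%C with (RtoC 0) by ring. rewrite cexp_0. ring.
Qed.

Lemma cdiff_cexp w : C_differentiable cexp w.
Proof. apply cdiff_iff. eexists. apply cder_cexp. Qed.

(** * Compactness in the plane *)

Definition cclosed (S : C -> Prop) := forall w, ~ S w ->
  exists d, 0 < d /\ forall v, Cmod (v - w) < d -> ~ S v.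

Lemma Cmod_box (z w : C) d : Rabs (Re z - Re w) < d -> Rabs (Im z - Im w) < d -> Cmod (z - w) < 2 * d.
Proof.
  intros. eapply Rle_lt_trans. apply Cmod_le_abs. unfold Cminus. rewrite re_plus, im_plus, re_opp, im_opp. unfold Rminus in *. lra.
Qed.

(** The Lebesgue number of a cover: P v d stands for a property that the ball of
    radius d around v inherits from some member of the cover. *)
Lemma lebesgue_number (B : R) (P : C -> R -> Prop) :
  (forall w, exists d, 0 < d /\ forall v, Cmod (v - w) < d -> P v d) ->
  (forall v d d', 0 < d' <= d -> P v d -> P v d') ->
  exists d, 0 < d /\ forall v, Cmod v <= B -> P v d.
Proof.
  intros H1 Hm.
  assert (H : forall w, exists d : posreal, forall v, Cmod (v - w) < d -> P v d).
  { intros w. destruct (H1 w) as [d [Hd H]]. exists (mkposreal d Hd). auto. }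
  destruct (ClassicalEpsilon.constructive_indefinite_description
    (fun D : C -> posreal => forall w v, Cmod (v - w) < D w -> P v (D w))) as [D HD].
  { exists (fun w => proj1_sig (ClassicalEpsilon.constructive_indefinite_description _ (H w))).
    intros w. exact (proj2_sig (ClassicalEpsilon.constructive_indefinite_description _ (H w))). }
  destruct (compactness_value_2d (-B) B (-B) B (fun x y => mkposreal (D (x, y) / 2)
     (Rdiv_lt_0_compat _ _ (cond_pos _) Rlt_0_2))) as [d Hd].
  exists d. split. apply cond_pos. intros v Hv. apply NNPP. intros Hn.
  pose proof (re_le_Cmod v). pose proof (im_le_Cmod v).
  apply (Hd (Re v) (Im v)); try (apply Rabs_le_between; lra).
  intros [x [y [_ [_ [Hx [Hy Hd']]]]]]. simpl in *. apply Hn.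
  apply Hm with (D (x,y)). { pose proof (cond_pos d). pose proof (cond_pos (D (x,y))). lra. }
  apply HD. replace (pos (D (x,y))) with (2 * (D (x,y) / 2)) by field.
  apply Cmod_box; auto.
Qed.

Definition rcont_at_at (g : C -> R) (z : C) : Prop :=
  forall eps, 0 < eps -> exists delta, 0 < delta /\
    forall w, Cmod (w - z) < delta -> Rabs (g w - g z) < eps.

(** Near a point of S the bound is continuity, near any other point it is void
    because S is closed; a single Lebesgue number serves as the lower bound. *)
Lemma pos_lower_bound (S : C -> Prop) (B : R) (g : C -> R) :
  cclosed S -> (forall z, S z -> Cmod z <= B) -> (forall z, S z -> rcont_at_at g z) ->
  (forall z, S z -> 0 < g z) -> exists d, 0 < d /\ forall z, S z -> d <= g z.
Proof.
  intros HS HB Hc Hp.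
  assert (H : forall w, exists d, 0 < d /\ forall v, Cmod (v - w) < d -> S v -> d <= g v).
  { intros w. destruct (classic (S w)) as [h|h].
    - pose proof (Hp w h) as Hw. destruct (Hc w h (g w / 2)) as [d [Hd H]]. lra.
      exists (Rmin d (g w / 2)). split. apply Rmin_glb_lt; lra.
      intros v Hv _. specialize (H v (Rlt_le_trans _ _ _ Hv (Rmin_l _ _))).
      apply Rabs_lt_between in H. eapply Rle_trans. apply Rmin_r. lra.
    - destruct (HS w h) as [d [Hd H]]. exists d. split; auto. intros v Hv Sv.
      destruct (H v Hv Sv). }
  destruct (lebesgue_number B (fun v d => S v -> d <= g v)) as [d [Hd H']].
  - exact H.
  - intros v d d' Hd H1 Sv. specialize (H1 Sv). lra.
  - exists d. split; auto.
Qed.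

(** The positive function 1 / (1 + |g|) is bounded below, hence g is bounded; if
    the supremum s were not attained, s - g would be bounded below as well. *)
Lemma attains_max (S : C -> Prop) (B : R) (g : C -> R) :
  cclosed S -> (forall z, S z -> Cmod z <= B) -> (forall z, S z -> rcont_at_at g z) ->
  (exists z, S z) -> exists z0, S z0 /\ forall z, S z -> g z <= g z0.
Proof.
  intros HS HB Hc [z1 Hz1].
  assert (Hbd : exists M, forall z, S z -> g z <= M).
  { destruct (pos_lower_bound S B (fun z => / (1 + Rabs (g z)))) as [d [Hd H]]; auto.
    - intros z Sz e He. destruct (Hc z Sz e He) as [d [Hd H]].
      exists d. split; auto. intros w Hw. specialize (H w Hw).
      pose proof (Rabs_pos (g w)). pose proof (Rabs_pos (g z)).
      replace (/ (1 + Rabs (g w)) - / (1 + Rabs (g z)))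
        with ((Rabs (g z) - Rabs (g w)) / ((1 + Rabs (g w)) * (1 + Rabs (g z)))) by (field; lra).
      unfold Rdiv. rewrite Rabs_mult, (Rabs_pos_eq (/ _)).
      2:{ left. apply Rinv_0_lt_compat. nra. }
      apply Rle_lt_trans with (Rabs (Rabs (g z) - Rabs (g w)) * 1).
      + apply Rmult_le_compat_l. apply Rabs_pos. rewrite <- Rinv_1. apply Rinv_le_contravar; nra.
      + rewrite Rmult_1_r. eapply Rle_lt_trans. apply Rabs_triang_inv2.
        rewrite Rabs_minus_sym. auto.
    - intros z _. apply Rinv_0_lt_compat. pose proof (Rabs_pos (g z)). lra.
    - exists (/ d). intros z Sz. specialize (H z Sz).
      pose proof (Rabs_pos (g z)). pose proof (Rle_abs (g z)).
      apply Rinv_le_contravar in H; auto. rewrite Rinv_inv in H. lra. }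
  destruct Hbd as [M HM].
  destruct (completeness (fun y => exists z, S z /\ y = g z)) as [s [Hs1 Hs2]].
  { exists M. intros y [z [Sz ->]]. auto. }
  { exists (g z1). eauto. }
  apply NNPP. intros Hn.
  destruct (pos_lower_bound S B (fun z => s - g z)) as [d [Hd H]]; auto.
  - intros z Sz e He. destruct (Hc z Sz e He) as [d [Hd H]].
    exists d. split; auto. intros w Hw. specialize (H w Hw).
    replace (s - g w - (s - g z)) with (- (g w - g z)) by ring. rewrite Rabs_Ropp. auto.
  - intros z Sz. destruct (Hs1 (g z)) as [h|h]; [eauto|lra|].
    exfalso. apply Hn. exists z. split; auto. intros z' Sz'. rewrite h. apply Hs1. eauto.
  - assert (s <= s - d). { apply Hs2. intros y [z [Sz ->]]. specialize (H z Sz). lra. } lra.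
Qed.

Lemma rcont_at_Cmod g z : cont_at g z -> rcont_at_at (fun w => Cmod (g w)) z.
Proof.
  intros H e He. destruct (H e He) as [d [Hd H1]]. exists d. split; auto.
  intros w Hw. specialize (H1 w Hw). apply Rabs_lt_between.
  pose proof (Cmod_sub_ge (g w) (g z)). pose proof (Cmod_sub_ge (g z) (g w)).
  rewrite Cmod_sub_sym in H2. rewrite Cmod_sub_sym in H0.
  rewrite (Cmod_sub_sym (g z) (g w)) in *. lra.
Qed.

Lemma rcont_at_Re g z : cont_at g z -> rcont_at_at (fun w => Re (g w)) z.
Proof.
  intros H e He. destruct (H e He) as [d [Hd H1]]. exists d. split; auto.
  intros w Hw. specialize (H1 w Hw). eapply Rle_lt_trans; [|apply H1].
  eapply Rle_trans; [|apply re_le_Cmod]. unfold Cminus. rewrite re_plus, re_opp. apply Rle_refl.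
Qed.

Lemma cclosed_ball c r : cclosed (fun z => Cmod (z - c) <= r).
Proof.
  intros w Hw. exists (Cmod (w - c) - r). split. lra. intros v Hv H.
  pose proof (Cmod_sub_triangle w v c). rewrite (Cmod_sub_sym w v) in H0. lra.
Qed.

Lemma cclosed_circle c r : cclosed (fun z => Cmod (z - c) = r).
Proof.
  intros w Hw. exists (Rabs (Cmod (w - c) - r)). split. apply Rabs_pos_lt. lra.
  intros v Hv H.
  pose proof (Cmod_sub_triangle w v c). rewrite (Cmod_sub_sym w v) in H0.
  pose proof (Cmod_sub_triangle v w c).
  unfold Rabs in Hv. destruct (Rcase_abs _); lra.
Qed.

(** * Integrals of complex-valued paths *)

Definition CInt (f : R -> C) (a b : R) : C := RInt (V := C_R_CompleteNormedModule) f a b.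
Definition ex_CInt (f : R -> C) (a b : R) : Prop := ex_RInt (V := C_R_NormedModule) f a b.
Definition is_CInt (f : R -> C) (a b : R) (l : C) : Prop := is_RInt (V := C_R_NormedModule) f a b l.
Definition path_cont (f : R -> C) (t : R) : Prop := continuous (T := R_UniformSpace) (U := C_UniformSpace) f t.

Lemma ex_CInt_cont f a b : (forall t, Rmin a b <= t <= Rmax a b -> path_cont f t) -> ex_CInt f a b.
Proof. intros H. apply (ex_RInt_continuous (V := C_R_CompleteNormedModule)). exact H. Qed.

Lemma CInt_correct f a b : ex_CInt f a b -> is_CInt f a b (CInt f a b).
Proof. apply (RInt_correct (V := C_R_CompleteNormedModule)). Qed.

Lemma CInt_unique f a b l : is_CInt f a b l -> CInt f a b = l.
Proof. apply (is_RInt_unique (V := C_R_CompleteNormedModule)). Qed.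

Lemma CInt_Chasles f a b c : ex_CInt f a b -> ex_CInt f b c ->
  CInt f a c = (CInt f a b + CInt f b c)%C.
Proof. intros. symmetry. apply (RInt_Chasles (V := C_R_CompleteNormedModule)); auto. Qed.

Lemma is_CInt_plus f g a b l m : is_CInt f a b l -> is_CInt g a b m ->
  is_CInt (fun t => f t + g t)%C a b (l + m).
Proof. apply (is_RInt_plus (V := C_R_NormedModule)). Qed.

Lemma is_CInt_minus f g a b l m : is_CInt f a b l -> is_CInt g a b m ->
  is_CInt (fun t => f t - g t)%C a b (l - m).
Proof. apply (is_RInt_minus (V := C_R_NormedModule)). Qed.

Lemma is_CInt_const c a b : is_CInt (fun _ => c) a b (RtoC (b - a) * c).
Proof.
  pose proof (is_RInt_const (V := C_R_NormedModule) a b c) as H.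
  unfold is_CInt. rewrite <- scal_R_Cmult. exact H.
Qed.

Lemma is_CInt_re f a b l : is_CInt f a b l -> is_RInt (fun t => Re (f t)) a b (Re l).
Proof. apply (is_RInt_fct_extend_fst (U := R_NormedModule) (V := R_NormedModule)). Qed.

Lemma is_CInt_im f a b l : is_CInt f a b l -> is_RInt (fun t => Im (f t)) a b (Im l).
Proof. apply (is_RInt_fct_extend_snd (U := R_NormedModule) (V := R_NormedModule)). Qed.

Lemma is_CInt_pair f a b l : is_RInt (fun t => Re (f t)) a b (Re l) ->
  is_RInt (fun t => Im (f t)) a b (Im l) -> is_CInt f a b l.
Proof. intros H1 H2. destruct l as [x y].
  apply (is_RInt_fct_extend_pair (U := R_NormedModule) (V := R_NormedModule)); auto.
Qed.

Lemma is_CInt_mult c f a b l : is_CInt f a b l -> is_CInt (fun t => c * f t)%C a b (c * l).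
Proof.
  intros H. pose proof (is_CInt_re _ _ _ _ H) as H1. pose proof (is_CInt_im _ _ _ _ H) as H2.
  apply is_CInt_pair.
  - rewrite re_mult.
    eapply is_RInt_ext; [|exact (is_RInt_minus _ _ _ _ _ _ (is_RInt_scal _ _ _ (Re c) _ H1) (is_RInt_scal _ _ _ (Im c) _ H2))].
    intros t _. rewrite re_mult. reflexivity.
  - rewrite im_mult.
    eapply is_RInt_ext; [|exact (is_RInt_plus _ _ _ _ _ _ (is_RInt_scal _ _ _ (Re c) _ H2) (is_RInt_scal _ _ _ (Im c) _ H1))].
    intros t _. rewrite im_mult. reflexivity.
Qed.

Lemma is_CInt_conj f a b l : is_CInt f a b l -> is_CInt (fun t => Cconj (f t)) a b (Cconj l).
Proof.
  intros H. pose proof (is_CInt_re _ _ _ _ H) as H1. pose proof (is_CInt_im _ _ _ _ H) as H2.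
  apply is_CInt_pair.
  - exact H1.
  - exact (is_RInt_opp _ _ _ _ H2).
Qed.

Lemma is_CInt_ext f g a b l : (forall t, Rmin a b < t < Rmax a b -> f t = g t) -> is_CInt f a b l -> is_CInt g a b l.
Proof. apply (is_RInt_ext (V := C_R_NormedModule)). Qed.

Lemma CInt_bound f a b l M : a <= b -> (forall t, a <= t <= b -> Cmod (f t) <= M) ->
  is_CInt f a b l -> Cmod l <= (b - a) * M.
Proof.
  intros Hab H Hi. rewrite Cmod_norm.
  apply (norm_RInt_le_const (V := C_R_NormedModule) f a b l M); auto.
  intros t Ht. specialize (H t Ht). rewrite Cmod_norm in H. exact H.
Qed.

Lemma CInt_near_const f a b l c M : a <= b -> (forall t, a <= t <= b -> Cmod (f t - c) <= M) ->
  is_CInt f a b l -> Cmod (l - RtoC (b - a) * c) <= (b - a) * M.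
Proof.
  intros Hab H Hi. apply CInt_bound with (fun t => f t - c)%C; auto.
  apply is_CInt_minus; auto. apply is_CInt_const.
Qed.

Lemma path_cont_comp (g : C -> C) (u : R -> C) t : path_cont u t -> cont_at g (u t) -> path_cont (fun s => g (u s)) t.
Proof.
  intros Hu Hg. apply cont_at_continuous in Hg.
  apply (continuous_comp (U := R_UniformSpace) (V := C_UniformSpace) (W := C_UniformSpace) u g t Hu Hg).
Qed.

(** * Goursat's theorem *)

Lemma nested_intervals (a b : nat -> R) :
  (forall n, a n <= a (S n) /\ a (S n) <= b (S n) /\ b (S n) <= b n) -> a O <= b O ->
  exists x, forall n, a n <= x <= b n.
Proof.
  intros H H0.
  assert (Hab : forall n, a n <= b n). { intros [|n]; auto. apply H. }
  assert (Ha : forall n k, a n <= a (n + k)%nat).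
  { intros n k. induction k. rewrite Nat.add_0_r; lra. rewrite Nat.add_succ_r. pose proof (H (n+k)%nat). lra. }
  assert (Hb : forall n k, b (n + k)%nat <= b n).
  { intros n k. induction k. rewrite Nat.add_0_r; lra. rewrite Nat.add_succ_r. pose proof (H (n+k)%nat). lra. }
  assert (Hm : forall n m, a n <= b m).
  { intros n m. eapply Rle_trans. apply (Ha n m). eapply Rle_trans. apply Hab.
    rewrite Nat.add_comm. apply Hb. }
  destruct (completeness (fun y => exists n, y = a n)) as [s [H1 H2]].
  { exists (b O). intros y [n ->]. auto. }
  { exists (a O). eauto. }
  exists s. intros n. split. apply H1. eauto. apply H2. intros y [m ->]. auto.
Qed.

Section Goursat.
Variables (G : C -> C) (xa xb : R).
Hypothesis HG : forall w, xa < Re w < xb -> C_differentiable G w.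

(** The contour integral over the boundary of a rectangle, opposite sides being
    grouped: the two contributions of an affine integrand are constants that
    cancel. *)
Definition boundary_int (x1 x2 y1 y2 : R) : C :=
  (CInt (fun x => G (x, y1) - G (x, y2)) x1 x2 +
   Ci * CInt (fun y => G (x2, y) - G (x1, y)) y1 y2)%C.

Lemma path_cont_h y t : xa < t < xb -> path_cont (fun x => G (x, y)) t.
Proof.
  intros Ht. apply (path_cont_comp G (fun x => (x, y))).
  - apply (filterlim_locally (F := locally t)). intros e. exists e. intros s Hs.
    split; simpl; auto. apply ball_center.
  - apply cdiff_cont_at, HG. auto.
Qed.

Lemma path_cont_v x t : xa < x < xb -> path_cont (fun y => G (x, y)) t.
Proof.
  intros Ht. apply (path_cont_comp G (fun y => (x, y))).
  - apply (filterlim_locally (F := locally t)). intros e. exists e. intros s Hs.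
    split; simpl; auto. apply ball_center.
  - apply cdiff_cont_at, HG. auto.
Qed.

Lemma ex_h y1 y2 a b : xa < a < xb -> xa < b < xb -> ex_CInt (fun x => G (x, y1) - G (x, y2))%C a b.
Proof.
  intros Ha Hb.
  assert (forall y, ex_CInt (fun x => G (x, y)) a b).
  { intros y. apply ex_CInt_cont. intros t Ht. apply path_cont_h.
    unfold Rmin, Rmax in Ht. destruct (Rle_dec a b); lra. }
  eexists. apply is_CInt_minus; apply CInt_correct; auto.
Qed.

Lemma ex_v a b y1 y2 : xa < a < xb -> xa < b < xb -> ex_CInt (fun y => G (b, y) - G (a, y))%C y1 y2.
Proof.
  intros Ha Hb.
  assert (forall x, xa < x < xb -> ex_CInt (fun y => G (x, y)) y1 y2).
  { intros x Hx. apply ex_CInt_cont. intros t Ht. apply path_cont_v; auto. }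
  eexists. apply is_CInt_minus; apply CInt_correct; auto.
Qed.

Lemma boundary_int_split_x x1 m x2 y1 y2 : xa < x1 < xb -> xa < m < xb -> xa < x2 < xb ->
  boundary_int x1 x2 y1 y2 = (boundary_int x1 m y1 y2 + boundary_int m x2 y1 y2)%C.
Proof.
  intros H1 Hm H2. unfold boundary_int.
  rewrite (CInt_Chasles _ x1 m x2) by (apply ex_h; auto).
  assert (E : CInt (fun y => G (x2, y) - G (x1, y))%C y1 y2 =
    (CInt (fun y => G (m, y) - G (x1, y))%C y1 y2 + CInt (fun y => G (x2, y) - G (m, y))%C y1 y2)%C).
  { apply CInt_unique. eapply is_CInt_ext.
    2:{ apply is_CInt_plus; apply CInt_correct, ex_v; auto. }
    intros t _. cbv beta. ring. }
  rewrite E. ring.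
Qed.

Lemma boundary_int_split_y x1 x2 y1 m y2 : xa < x1 < xb -> xa < x2 < xb ->
  boundary_int x1 x2 y1 y2 = (boundary_int x1 x2 y1 m + boundary_int x1 x2 m y2)%C.
Proof.
  intros H1 H2. unfold boundary_int.
  rewrite (CInt_Chasles _ y1 m y2) by (apply ex_v; auto).
  assert (E : CInt (fun x => G (x, y1) - G (x, y2))%C x1 x2 =
    (CInt (fun x => G (x, y1) - G (x, m))%C x1 x2 + CInt (fun x => G (x, m) - G (x, y2))%C x1 x2)%C).
  { apply CInt_unique. eapply is_CInt_ext.
    2:{ apply is_CInt_plus; apply CInt_correct, ex_h; auto. }
    intros t _. cbv beta. ring. }
  rewrite E. ring.
Qed.

(** Halving first in x, then in y, each time keeping the half with the larger
    share of the integral. *)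
Definition quarter (q : (R * R) * (R * R)) : (R * R) * (R * R) :=
  let '((x1, x2), (y1, y2)) := q in
  let m := (x1 + x2) / 2 in let n := (y1 + y2) / 2 in
  let xs := if Rle_dec (Cmod (boundary_int x1 x2 y1 y2)) (2 * Cmod (boundary_int x1 m y1 y2))
            then (x1, m) else (m, x2) in
  let ys := if Rle_dec (Cmod (boundary_int (fst xs) (snd xs) y1 y2))
                       (2 * Cmod (boundary_int (fst xs) (snd xs) y1 n))
            then (y1, n) else (n, y2) in
  (xs, ys).

Lemma quarter_spec x1 x2 y1 y2 : xa < x1 -> x1 <= x2 -> x2 < xb -> y1 <= y2 ->
  let '((x1', x2'), (y1', y2')) := quarter ((x1, x2), (y1, y2)) in
  x1 <= x1' /\ x1' <= x2' /\ x2' <= x2 /\ y1 <= y1' /\ y1' <= y2' /\ y2' <= y2 /\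
  x2' - x1' = (x2 - x1) / 2 /\ y2' - y1' = (y2 - y1) / 2 /\
  Cmod (boundary_int x1 x2 y1 y2) <= 4 * Cmod (boundary_int x1' x2' y1' y2').
Proof.
  intros H1 H2 H3 H4. unfold quarter.
  set (m := (x1 + x2) / 2). set (n := (y1 + y2) / 2).
  set (xs := if Rle_dec _ _ then (x1, m) else (m, x2)).
  assert (Hxs : x1 <= fst xs /\ fst xs <= snd xs /\ snd xs <= x2 /\ snd xs - fst xs = (x2 - x1) / 2 /\
     Cmod (boundary_int x1 x2 y1 y2) <= 2 * Cmod (boundary_int (fst xs) (snd xs) y1 y2)).
  { unfold xs. destruct (Rle_dec _ _) as [h|h]; simpl; unfold m; repeat split; try lra; auto.
    rewrite (boundary_int_split_x x1 m x2) in * by (unfold m; lra).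
    pose proof (Cmod_triangle (boundary_int x1 m y1 y2) (boundary_int m x2 y1 y2)). fold m. lra. }
  clearbody xs. destruct xs as [x1' x2']. simpl in *.
  destruct Hxs as [Ha [Hb [Hc [Hd He]]]].
  assert (Hn : n - y1 = (y2 - y1) / 2 /\ y2 - n = (y2 - y1) / 2) by (unfold n; lra).
  clearbody n.
  destruct (Rle_dec _ _) as [h|h]; simpl; repeat split; try lra.
  rewrite (boundary_int_split_y x1' x2' y1 n y2) in * by lra.
  pose proof (Cmod_triangle (boundary_int x1' x2' y1 n) (boundary_int x1' x2' n y2)). lra.
Qed.

(** The affine part of G integrates to zero, so that only its error e meets the
    perimeter. *)
Lemma boundary_int_affine e w l x1 x2 y1 y2 : xa < x1 -> x2 < xb ->
  x1 <= Re w <= x2 -> y1 <= Im w <= y2 ->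
  (forall v, Cmod (v - w) <= (x2 - x1) + (y2 - y1) -> Cmod (G v - G w - (v - w) * l) <= e) ->
  Cmod (boundary_int x1 x2 y1 y2) <= 2 * ((x2 - x1) + (y2 - y1)) * e.
Proof.
  intros Ha Hb Hx Hy H.
  assert (Hr : forall x y, x1 <= x <= x2 -> y1 <= y <= y2 -> Cmod (G (x, y) - G w - ((x, y) - w) * l) <= e).
  { intros x y hx hy. apply H. eapply Rle_trans. apply Cmod_le_abs.
    destruct w as [u v]. simpl in *. apply Rplus_le_compat; apply Rabs_le; lra. }
  unfold boundary_int.
  pose proof (CInt_correct _ _ _ (ex_h y1 y2 x1 x2 ltac:(lra) ltac:(lra))) as I1.
  pose proof (CInt_correct _ _ _ (ex_v x1 x2 y1 y2 ltac:(lra) ltac:(lra))) as I2.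
  set (J1 := CInt _ x1 x2) in *. set (J2 := CInt _ y1 y2) in *.
  assert (E1 : Cmod (J1 - RtoC (x2 - x1) * (- Ci * RtoC (y2 - y1) * l)) <= (x2 - x1) * (2 * e)).
  { refine (CInt_near_const _ _ _ _ _ _ _ _ I1); [lra|]. intros t Ht.
    replace (G (t, y1) - G (t, y2) - - Ci * RtoC (y2 - y1) * l)%C with
      ((G (t, y1) - G w - ((t, y1) - w) * l) - (G (t, y2) - G w - ((t, y2) - w) * l))%C.
    - eapply Rle_trans. apply Cmod_sub_le.
      pose proof (Hr t y1 ltac:(lra) ltac:(lra)). pose proof (Hr t y2 ltac:(lra) ltac:(lra)). lra.
    - replace (t, y1) with (RtoC t + Ci * RtoC y1)%C by (unfold RtoC, Ci, Cplus, Cmult; simpl; f_equal; ring).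
      replace (t, y2) with (RtoC t + Ci * RtoC y2)%C by (unfold RtoC, Ci, Cplus, Cmult; simpl; f_equal; ring).
      rewrite RtoC_minus. ring. }
  assert (E2 : Cmod (J2 - RtoC (y2 - y1) * (RtoC (x2 - x1) * l)) <= (y2 - y1) * (2 * e)).
  { refine (CInt_near_const _ _ _ _ _ _ _ _ I2); [lra|]. intros t Ht.
    replace (G (x2, t) - G (x1, t) - RtoC (x2 - x1) * l)%C with
      ((G (x2, t) - G w - ((x2, t) - w) * l) - (G (x1, t) - G w - ((x1, t) - w) * l))%C.
    - eapply Rle_trans. apply Cmod_sub_le.
      pose proof (Hr x1 t ltac:(lra) ltac:(lra)). pose proof (Hr x2 t ltac:(lra) ltac:(lra)). lra.
    - replace (x2, t) with (RtoC x2 + Ci * RtoC t)%C by (unfold RtoC, Ci, Cplus, Cmult; simpl; f_equal; ring).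
      replace (x1, t) with (RtoC x1 + Ci * RtoC t)%C by (unfold RtoC, Ci, Cplus, Cmult; simpl; f_equal; ring).
      rewrite RtoC_minus. ring. }
  replace (J1 + Ci * J2)%C with
    ((J1 - RtoC (x2 - x1) * (- Ci * RtoC (y2 - y1) * l)) + Ci * (J2 - RtoC (y2 - y1) * (RtoC (x2 - x1) * l)))%C by ring.
  eapply Rle_trans. apply Cmod_triangle. rewrite (Cmod_mult Ci), Cmod_Ci. lra.
Qed.

(** The nested quarters shrink to a point, near which the error of the affine
    approximation is small compared with the side; the integral over the n-th
    quarter is therefore o (4 ^ (- n)). *)
Theorem Goursat x1 x2 y1 y2 : xa < x1 -> x1 <= x2 -> x2 < xb -> y1 <= y2 ->
  boundary_int x1 x2 y1 y2 = 0.
Proof.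
  intros H1 H2 H3 H4.
  pose (q := fun n => Nat.iter n quarter ((x1, x2), (y1, y2))).
  pose (X1 := fun n => fst (fst (q n))). pose (X2 := fun n => snd (fst (q n))).
  pose (Y1 := fun n => fst (snd (q n))). pose (Y2 := fun n => snd (snd (q n))).
  assert (Hq : forall n, q n = ((X1 n, X2 n), (Y1 n, Y2 n))).
  { intros n. unfold X1, X2, Y1, Y2. destruct (q n) as [[? ?] [? ?]]; reflexivity. }
  assert (Hs : forall n, xa < X1 n /\ X1 n <= X2 n /\ X2 n < xb /\ Y1 n <= Y2 n /\
     X2 n - X1 n = (x2 - x1) / 2 ^ n /\ Y2 n - Y1 n = (y2 - y1) / 2 ^ n /\
     Cmod (boundary_int x1 x2 y1 y2) <= 4 ^ n * Cmod (boundary_int (X1 n) (X2 n) (Y1 n) (Y2 n)) /\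
     X1 n <= X1 (S n) /\ X1 (S n) <= X2 (S n) /\ X2 (S n) <= X2 n /\
     Y1 n <= Y1 (S n) /\ Y1 (S n) <= Y2 (S n) /\ Y2 (S n) <= Y2 n).
  { induction n as [|n IH].
    - assert (E0 : X1 O = x1 /\ X2 O = x2 /\ Y1 O = y1 /\ Y2 O = y2) by (repeat split).
      destruct E0 as [-> [-> [-> ->]]].
      pose proof (quarter_spec x1 x2 y1 y2 H1 H2 H3 H4) as Q.
      change (quarter (x1, x2, (y1, y2))) with (q 1%nat) in Q. rewrite Hq in Q.
      simpl pow. repeat split; try lra; try tauto.
    - destruct IH as [I1 [I2 [I3 [I4 [I5 [I6 [I7 [I8 [I9 [I10 [I11 [I12 I13]]]]]]]]]]]].
      pose proof (quarter_spec (X1 n) (X2 n) (Y1 n) (Y2 n) I1 I2 I3 I4) as Q.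
      rewrite <- Hq in Q. change (quarter (q n)) with (q (S n)) in Q. rewrite Hq in Q.
      destruct Q as [_ [_ [_ [_ [_ [_ [Q1 [Q2 Q3]]]]]]]].
      assert (J1 : xa < X1 (S n)) by lra. assert (J3 : X2 (S n) < xb) by lra.
      pose proof (quarter_spec _ _ _ _ J1 I9 J3 I12) as Q'.
      rewrite <- Hq in Q'. change (quarter (q (S n))) with (q (S (S n))) in Q'. rewrite Hq in Q'.
      rewrite I5 in Q1. rewrite I6 in Q2.
      assert (P2 : 2 ^ n <> 0) by (apply pow_nonzero; lra).
      simpl pow. repeat split; try lra; try tauto.
      + rewrite Q1. field; auto.
      + rewrite Q2. field; auto.
      + assert (P4 : 0 < 4 ^ n) by (apply pow_lt; lra). nra. }
  destruct (nested_intervals X1 X2) as [x Hx].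
  { intros n. pose proof (Hs n). tauto. } { exact H2. }
  destruct (nested_intervals Y1 Y2) as [y Hy].
  { intros n. pose proof (Hs n). tauto. } { exact H4. }
  pose (w := (x, y) : C). pose (s := (x2 - x1) + (y2 - y1)).
  assert (Hs0 : 0 <= s) by (unfold s; lra).
  assert (Hw : xa < Re w < xb). { simpl. pose proof (Hs O). specialize (Hx O). lra. }
  apply Cmod_eq_0. apply Rle_antisym; [|apply Cmod_ge_0].
  apply le_epsilon. intros e He. rewrite Rplus_0_l.
  destruct (proj1 (is_derive_iff G w _) (proj2 (cder_iff _ _ _) (cdiff_cder _ _ (HG w Hw)))
     (e / (2 * s * s + 1))) as [d [Hd H]].
  { apply Rdiv_lt_0_compat; nra. }
  assert (Hn : exists n, s / 2 ^ n < d).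
  { destruct (pow_lt_1_zero (/2)) with (y := d / (s + 1)) as [n Hn].
    - rewrite Rabs_pos_eq; lra.
    - apply Rdiv_lt_0_compat; lra.
    - exists n. specialize (Hn n (le_n n)). rewrite Rabs_pos_eq in Hn by (apply pow_le; lra).
      rewrite pow_inv in Hn. unfold Rdiv at 1.
      apply Rle_lt_trans with ((s + 1) * / 2 ^ n).
      + apply Rmult_le_compat_r. left. apply Rinv_0_lt_compat, pow_lt; lra. lra.
      + apply Rlt_le_trans with ((s + 1) * (d / (s + 1))). apply Rmult_lt_compat_l; lra. right. field. lra. }
  destruct Hn as [n Hn].
  destruct (Hs n) as [I1 [I2 [I3 [I4 [I5 [I6 [I7 _]]]]]]].
  eapply Rle_trans. apply I7.
  assert (P2 : 0 < 2 ^ n) by (apply pow_lt; lra).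
  assert (P4 : 4 ^ n = 2 ^ n * 2 ^ n) by (rewrite <- Rpow_mult_distr; f_equal; ring).
  assert (Hd' : (X2 n - X1 n) + (Y2 n - Y1 n) = s / 2 ^ n).
  { rewrite I5, I6. unfold s. field. lra. }
  assert (B : Cmod (boundary_int (X1 n) (X2 n) (Y1 n) (Y2 n)) <=
     2 * (s / 2 ^ n) * (e / (2 * s * s + 1) * (s / 2 ^ n))).
  { rewrite <- Hd'. apply boundary_int_affine with (w := w) (l := C_derive G w); auto.
    intros v Hv. eapply Rle_trans. apply H. rewrite Hd' in Hv. lra.
      apply Rmult_le_compat_l; auto. left. apply Rdiv_lt_0_compat; nra. }
  rewrite P4.
  apply Rle_trans with (2 ^ n * 2 ^ n * (2 * (s / 2 ^ n) * (e / (2 * s * s + 1) * (s / 2 ^ n)))).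
  - apply Rmult_le_compat_l; nra.
  - replace (2 ^ n * 2 ^ n * (2 * (s / 2 ^ n) * (e / (2 * s * s + 1) * (s / 2 ^ n))))
      with (e * ((2 * s * s) / (2 * s * s + 1))) by (field; split; nra).
    rewrite <- (Rmult_1_r e) at 2. apply Rmult_le_compat_l. lra.
    apply Rmult_le_reg_r with (2 * s * s + 1). nra.
    unfold Rdiv. rewrite Rmult_assoc, Rinv_l; nra.
Qed.
End Goursat.

(** * Circular means *)

Definition expi (t : R) : C := (cos t, sin t).
Definition circ (c : C) (r t : R) : C := (c + RtoC r * expi t)%C.

Lemma Cmod_expi t : Cmod (expi t) = 1.
Proof.
  unfold expi, Cmod; simpl. transitivity (sqrt 1); [f_equal|apply sqrt_1].
  pose proof (sin2_cos2 t). unfold Rsqr in H. lra.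
Qed.

Lemma circ_dist c r t : 0 <= r -> Cmod (circ c r t - c) = r.
Proof.
  intros. unfold circ. replace (c + RtoC r * expi t - c)%C with (RtoC r * expi t)%C by ring.
  rewrite Cmod_mult, Cmod_expi, Cmod_R, Rabs_pos_eq; lra.
Qed.

Lemma circ_exp c x t : circ c (exp x) t = (c + cexp (x, t))%C.
Proof. unfold circ, expi, cexp, RtoC, Cmult, Cplus; simpl. f_equal; ring. Qed.

Lemma path_cont_expi t : path_cont expi t.
Proof.
  unfold path_cont, continuous. apply (filterlim_locally (F := locally t)). intros e.
  pose proof (continuous_cos t) as Hc. pose proof (continuous_sin t) as Hs.
  pose proof (proj1 (filterlim_locally cos _) Hc e) as Hc'.
  pose proof (proj1 (filterlim_locally sin _) Hs e) as Hs'.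
  eapply filter_imp; [|exact (filter_and _ _ Hc' Hs')]. intros s [H1 H2]. split; auto.
Qed.

Lemma path_cont_circ c r t : path_cont (circ c r) t.
Proof.
  apply (path_cont_comp (fun u => c + RtoC r * u)%C expi).
  apply path_cont_expi. apply cont_at_plus. apply cont_at_const. apply cont_at_mult. apply cont_at_const. apply cont_at_id.
Qed.

Lemma ex_circ g c r a b : (forall t, cont_at g (circ c r t)) -> ex_CInt (fun t => g (circ c r t)) a b.
Proof.
  intros H. apply ex_CInt_cont. intros t _. apply path_cont_comp; auto. apply path_cont_circ.
Qed.

Definition cmean (g : C -> C) (c : C) (r : R) : C := CInt (fun t => g (circ c r t)) 0 (2 * PI).

(** This is [Goursat] for w |-> g (c + cexp w) on a rectangle of height 2 pi: the
    horizontal sides cancel by periodicity and the vertical sides are the two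
    means. *)
Lemma cmean_annulus g c r1 r2 r r' :
  0 < r1 -> (forall z, r1 < Cmod (z - c) < r2 -> C_differentiable g z) ->
  r1 < r -> r <= r' -> r' < r2 -> cmean g c r = cmean g c r'.
Proof.
  intros H0 Hd H1 H2 H3.
  assert (Hl : forall u v, 0 < u -> u < v -> ln u < ln v) by (intros; apply ln_increasing; auto).
  pose proof (Goursat (fun w => g (c + cexp w)%C) (ln r1) (ln r2)) as H.
  specialize (fun h => H h (ln r) (ln r') 0 (2 * PI)).
  assert (E : boundary_int (fun w => g (c + cexp w)%C) (ln r) (ln r') 0 (2 * PI) = 0).
  { apply H.
    - intros w Hw. apply (cdiff_comp g (fun w => c + cexp w)%C).
      + apply cdiff_plus. apply cdiff_const. apply cdiff_cexp.
      + apply Hd. replace (c + cexp w - c)%C with (cexp w) by ring. rewrite Cmod_cexp.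
        rewrite <- (exp_ln r1), <- (exp_ln r2) by lra. split; apply exp_increasing; tauto.
    - apply Hl; lra.
    - destruct H2 as [H2| ->]; [left; apply Hl; lra|lra].
    - apply Hl; lra.
    - pose proof PI_RGT_0. lra. }
  clear H. unfold boundary_int in E.
  assert (Z1 : CInt (fun x => g (c + cexp (x, 0%R)) - g (c + cexp (x, 2 * PI)%R))%C (ln r) (ln r') = 0).
  { apply CInt_unique. replace (RtoC 0) with (RtoC (ln r' - ln r) * 0)%C by ring.
    eapply is_CInt_ext; [|apply is_CInt_const]. intros x _. simpl.
    unfold cexp; simpl. rewrite cos_0, sin_0, cos_2PI, sin_2PI. ring. }
  rewrite Z1 in E.
  assert (Hc : forall s, r1 < s < r2 -> forall t, cont_at g (circ c s t)).
  { intros s Hs t. apply cdiff_cont_at, Hd. rewrite circ_dist by lra. auto. }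
  assert (Z2 : CInt (fun y => g (c + cexp (ln r', y)) - g (c + cexp (ln r, y)))%C 0 (2 * PI) = (cmean g c r' - cmean g c r)%C).
  { apply CInt_unique. eapply is_CInt_ext; [|apply is_CInt_minus; apply CInt_correct].
    - intros t _. cbv beta. rewrite <- !circ_exp, !exp_ln by lra. reflexivity.
    - apply ex_circ. apply Hc. lra.
    - apply ex_circ. apply Hc. lra. }
  rewrite Z2 in E. clear Z1 Z2 Hl.
  assert (E' : (cmean g c r' - cmean g c r)%C = 0).
  { replace (cmean g c r' - cmean g c r)%C with (- Ci * (0 + Ci * (cmean g c r' - cmean g c r)))%C.
    rewrite E. ring.
    replace (- Ci * (0 + Ci * (cmean g c r' - cmean g c r)))%C with (- (Ci * Ci) * (cmean g c r' - cmean g c r))%C by ring.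
    replace (Ci * Ci)%C with (- (1))%C by (unfold Ci, Cmult, Copp, RtoC; simpl; f_equal; ring). ring. }
  symmetry. apply Ceq_minus. exact E'.
Qed.

Lemma uniform_cont (S : C -> Prop) (B : R) (g : C -> C) :
  cclosed S -> (forall z, S z -> Cmod z <= B) -> (forall z, S z -> cont_at g z) ->
  forall e, 0 < e -> exists d, 0 < d /\ forall z, S z -> forall w, Cmod (w - z) < d -> Cmod (g w - g z) < e.
Proof.
  intros HS HB Hc e He.
  assert (H : forall w, exists d, 0 < d /\ forall v, Cmod (v - w) < d -> S v -> forall u, Cmod (u - v) < d -> Cmod (g u - g v) < e).
  { intros w. destruct (classic (S w)) as [h|h].
    - destruct (Hc w h (e/2)) as [d [Hd H]]. lra.
      exists (d/2). split. lra. intros v Hv _ u Hu.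
      eapply Rle_lt_trans. apply (Cmod_sub_triangle _ (g w)).
      rewrite (Cmod_sub_sym (g w)).
      pose proof (Cmod_sub_triangle u v w).
      pose proof (H v ltac:(lra)). pose proof (H u ltac:(lra)). lra.
    - destruct (HS w h) as [d [Hd H]]. exists d. split; auto. intros v Hv Sv.
      destruct (H v Hv Sv). }
  destruct (lebesgue_number B (fun v d => S v -> forall u, Cmod (u - v) < d -> Cmod (g u - g v) < e)) as [d [Hd H']].
  - exact H.
  - intros v d d' Hd H1 Sv u Hu. apply H1; auto. lra.
  - exists d. split; auto.
Qed.

Lemma cmean_cont g c r : 0 <= r -> (forall z, Cmod (z - c) = r -> cont_at g z) ->
  (exists d, 0 < d /\ forall z, Rabs (Cmod (z - c) - r) < d -> cont_at g z) ->
  forall e, 0 < e -> exists d, 0 < d /\ forall s, 0 <= s -> Rabs (s - r) < d -> Cmod (cmean g c s - cmean g c r) < e.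
Proof.
  intros Hr Hc [d0 [Hd0 Hc']] e He. pose proof PI_RGT_0 as Hpi.
  destruct (uniform_cont (fun z => Cmod (z - c) = r) (Cmod c + r) g (cclosed_circle c r)) with (e := e / (4 * PI)) as [d [Hd H]]; auto.
  - intros z Hz. pose proof (Cmod_sub_ge z c). lra.
  - apply Rdiv_lt_0_compat; lra.
  - exists (Rmin d d0). split. apply Rmin_glb_lt; auto. intros s Hs Hsr.
    apply Rle_lt_trans with ((2 * PI - 0) * (e / (4 * PI))).
    + apply CInt_bound with (fun t => g (circ c s t) - g (circ c r t))%C. lra.
      2:{ apply is_CInt_minus; apply CInt_correct; apply ex_circ; intros t; apply Hc'; rewrite circ_dist by lra.
          eapply Rlt_le_trans; [apply Hsr|apply Rmin_r]. rewrite Rminus_diag, Rabs_R0; auto. }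
      intros t _. left. apply H. apply circ_dist; auto.
      unfold circ. replace (c + RtoC s * expi t - (c + RtoC r * expi t))%C with (RtoC (s - r) * expi t)%C by (rewrite RtoC_minus; ring).
      rewrite Cmod_mult, Cmod_expi, Cmod_R, Rmult_1_r. eapply Rlt_le_trans; [apply Hsr|apply Rmin_l].
    + replace ((2 * PI - 0) * (e / (4 * PI))) with (e / 2) by (field; lra). lra.
Qed.

Lemma Ceq_eps (a b : C) : (forall e, 0 < e -> Cmod (a - b) < e) -> a = b.
Proof.
  intros H. apply Cmod_sub_eq. apply Rle_antisym; [|apply Cmod_ge_0].
  apply le_epsilon. intros e He. rewrite Rplus_0_l. left. auto.
Qed.

(** The mean does not depend on the radius on either side of r1, and it is a
    continuous function of the radius, also at r1 and at 0. *)
Lemma mean_value g c R0 r1 :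
  (forall z, Cmod (z - c) < R0 -> cont_at g z) ->
  (forall z, 0 < Cmod (z - c) < R0 -> Cmod (z - c) <> r1 -> C_differentiable g z) ->
  forall r, 0 <= r < R0 -> cmean g c r = (RtoC (2 * PI) * g c)%C.
Proof.
  intros Hc Hd.
  assert (HM : forall r, 0 <= r < R0 -> forall e, 0 < e -> exists d, 0 < d /\ forall s, 0 <= s -> Rabs (s - r) < d -> Cmod (cmean g c s - cmean g c r) < e).
  { intros r Hr. apply cmean_cont. lra. intros z Hz. apply Hc. lra.
    exists (R0 - r). split. lra. intros z Hz. apply Hc. apply Rabs_lt_between in Hz. lra. }
  assert (HE : forall s r, 0 < s -> s <= r -> r < R0 -> ~ (s <= r1 <= r) -> cmean g c s = cmean g c r).
  { intros s r Hs Hsr Hr Hn.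
    destruct (Rlt_dec r1 s) as [h|h].
    - apply cmean_annulus with (r1 := (Rmax 0 r1 + s) / 2) (r2 := R0).
      + pose proof (Rmax_l 0 r1). lra.
      + intros z Hz. pose proof (Rmax_l 0 r1). pose proof (Rmax_r 0 r1). apply Hd; [lra|].
        assert (Rmax 0 r1 < s) by (apply Rmax_lub_lt; auto). lra.
      + assert (Rmax 0 r1 < s) by (apply Rmax_lub_lt; auto). lra.
      + auto.
      + auto.
    - apply cmean_annulus with (r1 := s / 2) (r2 := Rmin R0 r1); try lra.
      + intros z Hz. pose proof (Rmin_l R0 r1). pose proof (Rmin_r R0 r1). apply Hd; lra.
      + apply Rmin_glb_lt; lra. }
  assert (H0 : cmean g c 0 = (RtoC (2 * PI) * g c)%C).
  { apply CInt_unique. replace (RtoC (2 * PI)) with (RtoC (2 * PI - 0)) by (f_equal; ring).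
    eapply is_CInt_ext; [|apply is_CInt_const]. intros t _. cbv beta. f_equal. unfold circ. ring. }
  assert (H1 : forall r, 0 <= r < R0 -> ~ (0 < r1 <= r) -> cmean g c r = cmean g c 0).
  { intros r Hr Hn. destruct (Req_dec r 0) as [->|n]; auto.
    apply Ceq_eps. intros e He. destruct (HM 0 ltac:(lra) e He) as [d [Hd' H]].
    rewrite <- (HE (Rmin (d/2) r) r); try lra.
    - apply H. apply Rmin_glb; lra. rewrite Rminus_0_r, Rabs_pos_eq.
      eapply Rle_lt_trans. apply Rmin_l. lra. apply Rmin_glb; lra.
    - apply Rmin_glb_lt; lra.
    - apply Rmin_r.
    - intros [h1 h2]. apply Hn. split; auto. eapply Rlt_le_trans; [|apply h1]. apply Rmin_glb_lt; lra. }
  assert (H2 : 0 < r1 < R0 -> cmean g c r1 = cmean g c 0).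
  { intros Hr. apply Ceq_eps. intros e He. destruct (HM r1 ltac:(lra) e He) as [d [Hd' H]].
    rewrite <- (H1 (r1 - Rmin (d/2) (r1/2))).
    - rewrite Cmod_sub_sym. apply H. pose proof (Rmin_r (d/2) (r1/2)). lra.
      replace (r1 - Rmin (d/2) (r1/2) - r1) with (- Rmin (d/2) (r1/2)) by ring.
      rewrite Rabs_Ropp, Rabs_pos_eq. pose proof (Rmin_l (d/2) (r1/2)). lra. apply Rmin_glb; lra.
    - assert (0 < Rmin (d/2) (r1/2)) by (apply Rmin_glb_lt; lra). pose proof (Rmin_r (d/2) (r1/2)). lra.
    - assert (0 < Rmin (d/2) (r1/2)) by (apply Rmin_glb_lt; lra). lra. }
  intros r Hr. rewrite <- H0.
  destruct (classic (0 < r1 <= r)) as [h|h]; auto.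
  rewrite <- H2 by lra.
  destruct (Req_dec r r1) as [->|n]; auto.
  apply Ceq_eps. intros e He. destruct (HM r1 ltac:(lra) e He) as [d [Hd' H]].
  rewrite <- (HE (r1 + Rmin (d/2) (r - r1)) r); try lra.
  - apply H. pose proof (Rmin_l (d/2) (r - r1)). assert (0 < Rmin (d/2) (r - r1)) by (apply Rmin_glb_lt; lra). lra.
    replace (r1 + Rmin (d/2) (r - r1) - r1) with (Rmin (d/2) (r - r1)) by ring.
    rewrite Rabs_pos_eq. pose proof (Rmin_l (d/2) (r - r1)). lra. apply Rmin_glb; lra.
  - assert (0 < Rmin (d/2) (r - r1)) by (apply Rmin_glb_lt; lra). lra.
  - pose proof (Rmin_r (d/2) (r - r1)). lra.
  - assert (0 < Rmin (d/2) (r - r1)) by (apply Rmin_glb_lt; lra). lra.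
Qed.

Lemma mean_value_holo g c R0 :
  (forall z, Cmod (z - c) < R0 -> C_differentiable g z) ->
  forall r, 0 <= r < R0 -> cmean g c r = (RtoC (2 * PI) * g c)%C.
Proof.
  intros H. apply (mean_value g c R0 0). intros. apply cdiff_cont_at; auto. intros; apply H; lra.
Qed.

(** * The maximum principle *)

Lemma Cmod2_expand (z w : C) : Cmod (z + w) ^ 2 = Cmod z ^ 2 + Cmod w ^ 2 + 2 * Re (Cconj z * w).
Proof. rewrite !Cmod2_alt. destruct z, w; simpl. ring. Qed.

(** Adding k |z - c|^2 turns Re g into a strictly subharmonic function, whose
    maximum over a closed disc cannot be interior. *)
Lemma max_principle_Re g c R0 M :
  (forall z, Cmod (z - c) < R0 -> C_differentiable g z) ->
  (forall e, 0 < e -> exists r, r < R0 /\ forall z, r < Cmod (z - c) < R0 -> Re (g z) <= M + e) ->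
  forall z, Cmod (z - c) < R0 -> Re (g z) <= M.
Proof.
  intros Hg Hb z0 Hz0. apply le_epsilon. intros e He.
  destruct (Hb (e/2)) as [r0 [Hr0 Hb']]. lra.
  pose (r := (Rmax r0 (Cmod (z0 - c)) + R0) / 2).
  assert (Hm : Rmax r0 (Cmod (z0 - c)) < R0) by (apply Rmax_lub_lt; auto).
  pose proof (Rmax_l r0 (Cmod (z0 - c))) as Hm1. pose proof (Rmax_r r0 (Cmod (z0 - c))) as Hm2.
  assert (Hr : r0 < r < R0 /\ Cmod (z0 - c) < r) by (unfold r; lra).
  clearbody r. destruct Hr as [Hr Hzr].
  assert (Hr1 : 0 < r). { pose proof (Cmod_ge_0 (z0 - c)). lra. }
  (* with this k the perturbation is at most e / 2 on the disc of radius r *)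
  pose (k := e / (2 * r * r)). assert (Hk : 0 < k) by (apply Rdiv_lt_0_compat; nra).
  pose (phi := fun z => Re (g z) + k * Cmod (z - c) ^ 2).
  destruct (attains_max (fun z => Cmod (z - c) <= r) (Cmod c + r) phi) as [zs [Hzs Hmax]].
  - apply cclosed_ball.
  - intros z Hz. pose proof (Cmod_sub_ge z c). lra.
  - intros z Hz.
    assert (Hc : cont_at g z) by (apply cdiff_cont_at, Hg; lra).
    assert (Hc2 : cont_at (fun w => g w + RtoC k * (RtoC (Cmod (w - c)) * RtoC (Cmod (w - c))))%C z).
    { apply cont_at_plus; auto. apply cont_at_mult. apply cont_at_const.
      assert (cont_at (fun w => RtoC (Cmod (w - c))) z).
      { intros e' He'. exists e'. split; auto. intros w Hw. rewrite <- RtoC_minus, Cmod_R.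
        pose proof (Cmod_sub_triangle w z c). pose proof (Cmod_sub_triangle z w c).
        rewrite (Cmod_sub_sym z w) in H0. apply Rabs_lt_between. lra. }
      apply cont_at_mult; auto. }
    apply rcont_at_Re in Hc2. intros e' He'. destruct (Hc2 e' He') as [d [Hd H]].
    exists d. split; auto. intros w Hw. specialize (H w Hw).
    rewrite !re_plus, <- !RtoC_mult, !re_RtoC in H. unfold phi.
    replace (Re (g w) + k * Cmod (w - c) ^ 2) with (Re (g w) + k * (Cmod (w - c) * Cmod (w - c))) by ring.
    replace (Re (g z) + k * Cmod (z - c) ^ 2) with (Re (g z) + k * (Cmod (z - c) * Cmod (z - c))) by ring.
    exact H.
  - exists z0. lra.
  - assert (Hkr : k * r ^ 2 = e / 2) by (unfold k; field; lra).
    assert (Hz0' : Re (g z0) <= phi zs).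
    { apply Rle_trans with (phi z0). 2:{ apply Hmax. lra. } unfold phi. pose proof (pow2_ge_0 (Cmod (z0 - c))). nra. }
    destruct (Rle_lt_dec r (Cmod (zs - c))) as [h|h].
    + assert (E : Cmod (zs - c) = r) by lra.
      unfold phi in Hz0'. rewrite E, Hkr in Hz0'. specialize (Hb' zs ltac:(lra)). lra.
    + exfalso.
      pose (rho := (r - Cmod (zs - c)) / 2). assert (Hrho : 0 < rho) by (unfold rho; lra).
      (* on the circle |z - zs| = rho, Re h1 differs from the perturbed function by
         the constant k |zs - c|^2 + k rho^2 *)
      pose (h1 := fun z => (g z + RtoC (2 * k) * Cconj (zs - c) * (z - zs))%C).
      assert (Hh : forall z, Cmod (z - zs) < 2 * rho -> C_differentiable h1 z).
      { intros z Hz. unfold h1. apply cdiff_plus.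
        - apply Hg. pose proof (Cmod_sub_triangle z zs c). unfold rho in *. lra.
        - apply cdiff_mult. apply cdiff_const. apply cdiff_minus. apply cdiff_id. apply cdiff_const. }
      pose proof (mean_value_holo h1 zs (2 * rho) Hh rho ltac:(lra)) as Hmv.
      assert (HI : is_CInt (fun t => h1 (circ zs rho t)) 0 (2 * PI) (RtoC (2 * PI) * h1 zs)).
      { rewrite <- Hmv. apply CInt_correct. apply ex_circ. intros t. apply cdiff_cont_at, Hh.
        rewrite circ_dist; lra. }
      apply is_CInt_re in HI. rewrite re_scal_l in HI.
      pose proof PI_RGT_0.
      assert (L : 2 * PI * Re (h1 zs) <= 2 * PI * (Re (h1 zs) - k * rho ^ 2)).
      { apply is_RInt_le with (f := fun t => Re (h1 (circ zs rho t))) (g := fun _ => Re (h1 zs) - k * rho ^ 2) (a := 0) (b := 2 * PI); auto.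
        - lra.
        - replace (2 * PI * (Re (h1 zs) - k * rho ^ 2)) with (scal (2 * PI - 0) (Re (h1 zs) - k * rho ^ 2)).
          apply (is_RInt_const (V := R_NormedModule)). unfold scal; simpl. unfold mult; simpl. ring.
        - intros t _.
          assert (Hd : Cmod (circ zs rho t - zs) = rho) by (apply circ_dist; lra).
          assert (Hin : Cmod (circ zs rho t - c) <= r).
          { pose proof (Cmod_sub_triangle (circ zs rho t) zs c). unfold rho in *. lra. }
          specialize (Hmax _ Hin). unfold phi in Hmax.
          replace (circ zs rho t - c)%C with ((zs - c) + (circ zs rho t - zs))%C in Hmax by ring.
          rewrite Cmod2_expand, Hd in Hmax.
          unfold h1. rewrite !re_plus.
          replace (RtoC (2 * k) * Cconj (zs - c) * (circ zs rho t - zs))%C with (RtoC (2 * k) * (Cconj (zs - c) * (circ zs rho t - zs)))%C by ring.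
          replace (RtoC (2 * k) * Cconj (zs - c) * (zs - zs))%C with (RtoC 0) by ring.
          rewrite re_scal_l, re_RtoC. lra. }
      assert (0 < k * rho ^ 2) by (apply Rmult_lt_0_compat; auto; apply pow_lt; auto).
      nra.
Qed.

Lemma Re_rotate (z : C) : exists u : C, Cmod u = 1 /\ (u * z)%C = RtoC (Cmod z).
Proof.
  destruct (Ceq_dec z 0) as [->|n].
  - exists 1. rewrite Cmod_1, Cmod_0. split; auto. ring.
  - exists (RtoC (Cmod z) / z)%C. rewrite Cmod_div, Cmod_R, Rabs_pos_eq by (auto; apply Cmod_ge_0).
    apply Cmod_gt_0 in n. split. field; lra. field. apply Cmod_gt_0; auto.
Qed.

Lemma max_principle g c R0 M :
  (forall z, Cmod (z - c) < R0 -> C_differentiable g z) ->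
  (forall e, 0 < e -> exists r, r < R0 /\ forall z, r < Cmod (z - c) < R0 -> Cmod (g z) <= M + e) ->
  forall z, Cmod (z - c) < R0 -> Cmod (g z) <= M.
Proof.
  intros Hg Hb z Hz. destruct (Re_rotate (g z)) as [u [Hu Hz']].
  pose proof (max_principle_Re (fun w => u * g w)%C c R0 M) as H.
  rewrite <- (re_RtoC (Cmod (g z))), <- Hz'. apply H; auto.
  - intros w Hw. apply cdiff_mult. apply cdiff_const. auto.
  - intros e He. destruct (Hb e He) as [r [Hr Hb']]. exists r. split; auto.
    intros w Hw. eapply Rle_trans; [|apply Hb', Hw].
    eapply Rle_trans. apply Rle_abs. eapply Rle_trans. apply re_le_Cmod. rewrite Cmod_mult, Hu. lra.
Qed.

(** * Cauchy's formula and removable singularities *)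

Lemma circ_sub_ne c r t b : 0 <= r -> Cmod (b - c) < r -> (circ c r t - b)%C <> RtoC 0.
Proof.
  intros Hr Hb E. apply Ceq_minus in E. pose proof (circ_dist c r t Hr) as H. rewrite E in H. lra.
Qed.

Lemma circ_sub_ge c r t b : 0 <= r -> r - Cmod (b - c) <= Cmod (circ c r t - b).
Proof.
  intros Hr. pose proof (circ_dist c r t Hr). pose proof (Cmod_sub_triangle (circ c r t) b c). lra.
Qed.

(** On the circle, the conjugate of (z - c) / (z - b) agrees with the holomorphic
    function r^2 / (r^2 - (z - c) conj (b - c)), whose mean is its value 1 at c. *)
Lemma kernel_mean c r b : 0 < r -> Cmod (b - c) < r ->
  is_CInt (fun t => (circ c r t - c) / (circ c r t - b))%C 0 (2 * PI) (RtoC (2 * PI)).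
Proof.
  intros Hr Hb.
  pose (k := fun z => (RtoC (r ^ 2) / (RtoC (r ^ 2) - (z - c) * Cconj (b - c)))%C).
  assert (Hr2 : 0 < r ^ 2) by (apply pow_lt; auto).
  pose (R1 := if Req_EM_T (Cmod (b - c)) 0 then 2 * r else r ^ 2 / Cmod (b - c)).
  pose proof (Cmod_ge_0 (b - c)) as Hb0.
  assert (HR1 : r < R1 /\ forall z, Cmod (z - c) < R1 -> Cmod (z - c) * Cmod (b - c) < r ^ 2).
  { unfold R1. destruct (Req_EM_T _ _) as [e|n].
    - rewrite e. split; intros; lra.
    - assert (0 < Cmod (b - c)) by lra. split.
      + apply Rmult_lt_reg_r with (Cmod (b - c)); auto. unfold Rdiv. rewrite Rmult_assoc, Rinv_l by lra. nra.
      + intros z Hz. apply Rmult_lt_compat_r with (r := Cmod (b - c)) in Hz; auto.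
        unfold Rdiv in Hz. rewrite Rmult_assoc, Rinv_l in Hz; lra. }
  destruct HR1 as [HR1 HR2].
  assert (Hne : forall z, Cmod (z - c) < R1 -> (RtoC (r ^ 2) - (z - c) * Cconj (b - c))%C <> RtoC 0).
  { intros z Hz E. apply Ceq_minus in E. apply (f_equal Cmod) in E.
    rewrite Cmod_mult, Cmod_conj, Cmod_R, Rabs_pos_eq in E by lra. specialize (HR2 z Hz). lra. }
  assert (Hk : forall z, Cmod (z - c) < R1 -> C_differentiable k z).
  { intros z Hz. unfold k. apply cdiff_div; auto. apply cdiff_const.
    apply cdiff_minus. apply cdiff_const. apply cdiff_mult. apply cdiff_minus. apply cdiff_id. apply cdiff_const. apply cdiff_const. }
  pose proof (mean_value_holo k c R1 Hk r ltac:(lra)) as Hm.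
  assert (HI : is_CInt (fun t => k (circ c r t)) 0 (2 * PI) (RtoC (2 * PI))).
  { replace (RtoC (2 * PI)) with (RtoC (2 * PI) * k c)%C.
    rewrite <- Hm. apply CInt_correct, ex_circ. intros t. apply cdiff_cont_at, Hk. rewrite circ_dist; lra.
    unfold k. field. specialize (Hne c). rewrite Cmod_sub_0 in Hne. intros E. apply Hne. lra. rewrite E. ring. }
  apply is_CInt_conj in HI.
  replace (Cconj (RtoC (2 * PI))) with (RtoC (2 * PI)) in HI by (unfold Cconj, RtoC; simpl; f_equal; ring).
  eapply is_CInt_ext; [|apply HI]. intros t _. cbv beta. unfold k.
  assert (Hd : Cmod (circ c r t - c) = r) by (apply circ_dist; lra).
  assert (Hn1 : (circ c r t - b)%C <> RtoC 0) by (apply circ_sub_ne; lra).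
  assert (Hn2 : (circ c r t - c)%C <> RtoC 0) by (apply Cmod_gt_0; lra).
  specialize (Hne (circ c r t) ltac:(lra)).
  rewrite Cdiv_conj by auto.
  assert (Hsq : RtoC (r ^ 2) = ((circ c r t - c) * Cconj (circ c r t - c))%C) by (rewrite <- Cmod2_conj, Hd; reflexivity).
  assert (Hcr : Cconj (RtoC (r ^ 2)) = RtoC (r ^ 2)) by (unfold Cconj, RtoC; simpl; f_equal; ring).
  assert (Hn3 : Cconj (circ c r t - c) <> RtoC 0) by (apply Cmod_gt_0; rewrite Cmod_conj; lra).
  rewrite Cminus_conj, Cmult_conj, Cconj_conj, Hcr, Hsq.
  set (u := (circ c r t - c)%C) in *.
  replace (circ c r t - b)%C with (u - (b - c))%C in * by (unfold u; ring).
  field. split; auto.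
  intros E. apply Hn1.
  replace (u - (b - c))%C with ((u * Cconj u - Cconj u * (b - c)) / Cconj u)%C by (field; auto).
  rewrite E. field. auto.
Qed.

(** The difference quotient of g at b, multiplied by z - c, is continuous,
    vanishes at c and is differentiable off c and b; by [mean_value] its circular
    means vanish. *)
Lemma cauchy_formula g c R0 r b :
  (forall z, Cmod (z - c) < R0 -> cont_at g z) ->
  (forall z, 0 < Cmod (z - c) < R0 -> C_differentiable g z) ->
  0 < r < R0 -> Cmod (b - c) < r ->
  is_CInt (fun t => (circ c r t - c) * g (circ c r t) / (circ c r t - b))%C 0 (2 * PI) (RtoC (2 * PI) * g b).
Proof.
  intros Hc Hd Hr Hb.
  assert (HcI : forall f, (forall z, Cmod (z - c) < R0 -> cont_at f z) -> is_CInt (fun t => f (circ c r t)) 0 (2 * PI) (cmean f c r)).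
  { intros f Hf. apply CInt_correct, ex_circ. intros t. apply Hf. rewrite circ_dist; lra. }
  destruct (Ceq_dec b c) as [->|n].
  - replace (RtoC (2 * PI) * g c)%C with (cmean g c r).
    + eapply is_CInt_ext; [|apply HcI; auto]. intros t _. cbv beta. field. apply circ_sub_ne; lra.
    + apply mean_value with R0 0; auto. lra.
  - apply Cmod_sub_pos in n.
    destruct (cdiff_cder _ _ (Hd b ltac:(lra))) as [A [HA [_ Hg]]].
    assert (HAe : forall z, z <> b -> A z = ((g z - g b) / (z - b))%C).
    { intros z Hz. rewrite (Hg z). field. apply Cminus_eq_contra; auto. }
    assert (HAd : forall z, z <> b -> 0 < Cmod (z - c) < R0 -> C_differentiable A z).
    { intros z Hz Hz'. apply (cdiff_ext_loc (fun z => (g z - g b) / (z - b))%C _ _ (Cmod (z - b))).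
      - apply Cmod_sub_pos; auto.
      - intros w Hw. symmetry. apply HAe. intros ->. rewrite Cmod_sub_sym in Hw. lra.
      - apply cdiff_div. apply Cminus_eq_contra; auto. apply cdiff_minus. auto. apply cdiff_const.
        apply cdiff_minus. apply cdiff_id. apply cdiff_const. }
    assert (HAc : forall z, Cmod (z - c) < R0 -> cont_at A z).
    { intros z Hz. destruct (Ceq_dec z b) as [->|m]; auto.
      apply (cont_at_ext_loc (fun z => (g z - g b) / (z - b))%C _ _ (Cmod (z - b))).
      - apply Cmod_sub_pos; auto.
      - intros w Hw. symmetry. apply HAe. intros ->. rewrite Cmod_sub_sym in Hw. lra.
      - apply cont_at_div. apply Cminus_eq_contra; auto. apply cont_at_minus. auto. apply cont_at_const.
        apply cont_at_minus. apply cont_at_id. apply cont_at_const. }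
    pose (h := fun z => ((z - c) * A z)%C).
    assert (Hh : forall z, Cmod (z - c) < R0 -> cont_at h z).
    { intros z Hz. apply cont_at_mult; auto. apply cont_at_minus. apply cont_at_id. apply cont_at_const. }
    assert (Hm : cmean h c r = 0).
    { rewrite (mean_value h c R0 (Cmod (b - c))); auto. unfold h. ring.
      intros z Hz Hz'. apply cdiff_mult. apply cdiff_minus. apply cdiff_id. apply cdiff_const.
      apply HAd; auto. intros ->; auto. lra. }
    pose proof (HcI h Hh) as I1. rewrite Hm in I1.
    pose proof (is_CInt_mult (g b) _ _ _ _ (kernel_mean c r b ltac:(lra) Hb)) as I2.
    pose proof (is_CInt_plus _ _ _ _ _ _ I1 I2) as I3.
    replace (0 + g b * RtoC (2 * PI))%C with (RtoC (2 * PI) * g b)%C in I3 by ring.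
    eapply is_CInt_ext; [|apply I3]. intros t _. cbv beta. unfold h.
    assert (Hn : (circ c r t - b)%C <> RtoC 0) by (apply circ_sub_ne; lra).
    rewrite HAe. field; auto. intros E. apply Hn. rewrite E. ring.
Qed.

Lemma cder_CInt (F : C -> R -> C) (F1 : R -> C) (J : C -> C) b a0 b0 l K d :
  a0 <= b0 -> 0 < d ->
  (forall z, Cmod (z - b) < d -> is_CInt (F z) a0 b0 (J z)) -> is_CInt F1 a0 b0 l ->
  (forall z t, Cmod (z - b) < d -> a0 <= t <= b0 -> Cmod (F z t - F b t - (z - b) * F1 t) <= K * Cmod (z - b) ^ 2) ->
  cder J b l.
Proof.
  intros Hab Hd HJ Hl H. apply cder_iff, is_derive_iff. intros e He.
  assert (HK : 0 < Rabs K * (b0 - a0) + 1). { pose proof (Rabs_pos K). nra. }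
  exists (Rmin d (e / (Rabs K * (b0 - a0) + 1))). split.
  { apply Rmin_glb_lt; auto. apply Rdiv_lt_0_compat; auto. }
  intros z Hz. pose proof (Rlt_le_trans _ _ _ Hz (Rmin_l _ _)) as Hz1.
  pose proof (Rlt_le_trans _ _ _ Hz (Rmin_r _ _)) as Hz2.
  pose proof (Cmod_ge_0 (z - b)) as Hm.
  apply Rle_trans with ((b0 - a0) * (K * Cmod (z - b) ^ 2)).
  - apply CInt_bound with (fun t => F z t - F b t - (z - b) * F1 t)%C; auto.
    apply is_CInt_minus; [apply is_CInt_minus|apply is_CInt_mult]; auto.
    apply HJ. rewrite Cmod_sub_0; auto.
  - set (m := Cmod (z - b)) in *.
    assert (Hx : (Rabs K * (b0 - a0) + 1) * m <= e).
    { apply Rle_trans with ((Rabs K * (b0 - a0) + 1) * (e / (Rabs K * (b0 - a0) + 1))).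
      apply Rmult_le_compat_l; lra. right. field. lra. }
    pose proof (Rle_abs K).
    apply Rle_trans with ((Rabs K * (b0 - a0) + 1) * m * m); [|nra].
    replace ((b0 - a0) * (K * m ^ 2)) with ((K * (b0 - a0)) * m * m) by ring.
    apply Rmult_le_compat_r; auto. apply Rmult_le_compat_r; auto. nra.
Qed.

Lemma two_pi_ne : RtoC (2 * PI) <> RtoC 0.
Proof. intros E. apply RtoC_inj in E. pose proof PI_RGT_0. lra. Qed.

Section CauchyConsequences.
Variables (g : C -> C) (c : C) (R0 : R).
Hypothesis HR0 : 0 < R0.
Hypothesis Hc : forall z, Cmod (z - c) < R0 -> cont_at g z.
Hypothesis Hd : forall z, 0 < Cmod (z - c) < R0 -> C_differentiable g z.

Let r := R0 / 2.
Let phi t := ((circ c r t - c) * g (circ c r t))%C.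

Lemma phi_bound : exists B, 0 < B /\ forall t, Cmod (phi t) <= B.
Proof.
  destruct (attains_max (fun z => Cmod (z - c) = r) (Cmod c + r) (fun z => Cmod (g z))) as [z0 [_ H]].
  - apply cclosed_circle.
  - intros z Hz. pose proof (Cmod_sub_ge z c). lra.
  - intros z Hz. apply rcont_at_Cmod, Hc. rewrite Hz. unfold r. lra.
  - exists (circ c r 0). apply circ_dist. unfold r; lra.
  - exists (r * Cmod (g z0) + 1). pose proof (Cmod_ge_0 (g z0)). split. unfold r. nra.
    intros t. unfold phi. rewrite Cmod_mult, circ_dist by (unfold r; lra).
    specialize (H (circ c r t) (circ_dist c r t ltac:(unfold r; lra))). unfold r in *. nra.
Qed.

Lemma path_cont_phi (k : C -> C) t : cont_at k (circ c r t) -> path_cont (fun t => phi t * k (circ c r t))%C t.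
Proof.
  intros Hk. unfold phi. apply (path_cont_comp (fun z => (z - c) * g z * k z)%C (circ c r)).
  apply path_cont_circ. apply cont_at_mult; auto. apply cont_at_mult. apply cont_at_minus. apply cont_at_id. apply cont_at_const.
  apply Hc. rewrite circ_dist by (unfold r; lra). unfold r; lra.
Qed.

Lemma ex_cauchy_int b n : Cmod (b - c) < r -> ex_CInt (fun t => phi t * (/ (circ c r t - b)) ^ n)%C 0 (2 * PI).
Proof.
  intros Hb. apply ex_CInt_cont. intros t _. apply (path_cont_phi (fun z => (/ (z - b)) ^ n)%C).
  assert (H : cont_at (fun z => / (z - b))%C (circ c r t)).
  { apply cont_at_inv. apply circ_sub_ne; auto. unfold r; lra. apply cont_at_minus. apply cont_at_id. apply cont_at_const. }
  induction n; simpl. apply cont_at_const. apply cont_at_mult; auto.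
Qed.

Lemma cauchy_der1 b : Cmod (b - c) < r ->
  cder g b (/ RtoC (2 * PI) * CInt (fun t => phi t * (/ (circ c r t - b)) ^ 2)%C 0 (2 * PI)).
Proof.
  intros Hb. destruct phi_bound as [B [HB HBt]].
  pose (d := (r - Cmod (b - c)) / 2). assert (Hd0 : 0 < d) by (unfold d; lra).
  assert (H : cder (fun z => RtoC (2 * PI) * g z)%C b (CInt (fun t => phi t * (/ (circ c r t - b)) ^ 2)%C 0 (2 * PI))).
  { apply cder_CInt with (a0 := 0) (b0 := 2 * PI) (F := fun z t => (phi t * (/ (circ c r t - z)))%C) (F1 := fun t => (phi t * (/ (circ c r t - b)) ^ 2)%C) (d := d) (K := B / d ^ 3).
    - pose proof PI_RGT_0. lra.
    - auto.
    - intros z Hz. apply (cauchy_formula g c R0 r z); auto. unfold r; lra.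
      pose proof (Cmod_sub_triangle z b c). unfold d in *. lra.
    - apply CInt_correct, ex_cauchy_int; auto.
    - intros z t Hz _.
      assert (Hzr : Cmod (z - c) < r) by (pose proof (Cmod_sub_triangle z b c); unfold d in *; lra).
      assert (Hr : 0 <= r) by (unfold r; lra).
      pose proof (circ_sub_ne c r t b Hr Hb) as N1. pose proof (circ_sub_ne c r t z Hr Hzr) as N2.
      pose proof (circ_sub_ge c r t b Hr) as G1. pose proof (circ_sub_ge c r t z Hr) as G2.
      assert (G1' : d <= Cmod (circ c r t - b)) by (unfold d in *; lra).
      assert (G2' : d <= Cmod (circ c r t - z)) by (pose proof (Cmod_sub_triangle z b c); unfold d in *; lra).
      replace (phi t * / (circ c r t - z) - phi t * / (circ c r t - b) - (z - b) * (phi t * (/ (circ c r t - b)) ^ 2))%C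
        with (phi t * ((z - b) * (z - b)) * (/ (circ c r t - z) * (/ (circ c r t - b) * / (circ c r t - b))))%C by (field; auto).
      rewrite !Cmod_mult, !Cmod_inv by auto.
      assert (I1 : / Cmod (circ c r t - z) <= / d) by (apply Rinv_le_contravar; auto).
      assert (I2 : / Cmod (circ c r t - b) <= / d) by (apply Rinv_le_contravar; auto).
      assert (I3 : 0 <= / Cmod (circ c r t - z)) by (left; apply Rinv_0_lt_compat; lra).
      assert (I4 : 0 <= / Cmod (circ c r t - b)) by (left; apply Rinv_0_lt_compat; lra).
      replace (B / d ^ 3 * Cmod (z - b) ^ 2) with (B * (Cmod (z - b) * Cmod (z - b)) * (/ d * (/ d * / d))) by (field; lra).
      pose proof (Cmod_ge_0 (z - b)). pose proof (Cmod_ge_0 (phi t)).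
      apply Rmult_le_compat. apply Rmult_le_pos; nra. apply Rmult_le_pos; nra.
      apply Rmult_le_compat_r. nra. auto.
      apply Rmult_le_compat; auto. nra. apply Rmult_le_compat; auto. }
  apply (cder_ext_loc (fun z => / RtoC (2 * PI) * (RtoC (2 * PI) * g z))%C _ _ _ 1). lra.
  intros w _. field. apply two_pi_ne.
  eapply cder_eq. apply cder_mult. apply cder_const. apply H. cbv beta. ring.
Qed.

(** Cauchy's formula holds at the centre as well, and its right-hand side is
    differentiable there. *)
Lemma removable_singularity : C_differentiable g c.
Proof.
  apply cdiff_iff. eexists. apply cauchy_der1. rewrite Cmod_sub_0. unfold r; lra.
Qed.

(** The derivative is again a Cauchy integral, now with kernel (z - b)^(-2), and
    can be differentiated once more. *)
Lemma cdiff_C_derive_centre : C_differentiable (C_derive g) c.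
Proof.
  destruct phi_bound as [B [HB HBt]].
  assert (Hr : 0 < r) by (unfold r; lra).
  pose (d := r / 2). assert (Hd0 : 0 < d) by (unfold d; lra).
  apply (cdiff_ext_loc (fun b => / RtoC (2 * PI) * CInt (fun t => phi t * (/ (circ c r t - b)) ^ 2)%C 0 (2 * PI))%C _ _ d); auto.
  { intros w Hw. symmetry. apply is_C_derive_unique, cder_iff. apply cauchy_der1. unfold d in *; lra. }
  apply cdiff_mult. apply cdiff_const.
  apply cdiff_iff. exists (2 * CInt (fun t => phi t * (/ (circ c r t - c)) ^ 3)%C 0 (2 * PI))%C.
  apply cder_CInt with (a0 := 0) (b0 := 2 * PI) (F := fun z t => (phi t * (/ (circ c r t - z)) ^ 2)%C) (F1 := fun t => (2 * (phi t * (/ (circ c r t - c)) ^ 3))%C) (d := d) (K := B * (5 / (d ^ 4))).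
  - pose proof PI_RGT_0. lra.
  - auto.
  - intros z Hz. apply CInt_correct, ex_cauchy_int. unfold d in *; lra.
  - apply is_CInt_mult, CInt_correct, ex_cauchy_int. rewrite Cmod_sub_0; auto.
  - intros z t Hz _.
    assert (Hzr : Cmod (z - c) < r) by (unfold d in *; lra).
    assert (Hbr : Cmod (c - c) < r) by (rewrite Cmod_sub_0; lra).
    pose proof (circ_sub_ne c r t c ltac:(lra) Hbr) as N1. pose proof (circ_sub_ne c r t z ltac:(lra) Hzr) as N2.
    pose proof (circ_sub_ge c r t z ltac:(lra)) as G2. pose proof (circ_dist c r t ltac:(lra)) as G1.
    assert (G1' : d <= Cmod (circ c r t - c)) by (unfold d in *; lra).
    assert (G2' : d <= Cmod (circ c r t - z)) by (unfold d in *; lra).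
    set (x := (circ c r t - c)%C) in *. set (h := (z - c)%C) in *.
    replace (circ c r t - z)%C with (x - h)%C in * by (unfold x, h; ring).
    (* 1/(x - h)^2 - 1/x^2 - 2h/x^3 = h^2 (3 - 2h/x) / (x^2 (x - h)^2) *)
    replace (phi t * (/ (x - h)) ^ 2 - phi t * (/ x) ^ 2 - h * (2 * (phi t * (/ x) ^ 3)))%C
      with (phi t * ((h * h) * ((3 - 2 * (h * / x)) * (/ (x * x) * / ((x - h) * (x - h))))))%C by (field; auto).
    rewrite (Cmod_mult (phi t)), !(Cmod_mult (_ * _)%C), (Cmod_mult h), (Cmod_mult (3 - _)).
    rewrite (Cmod_mult (/ (x * x))), !Cmod_inv by (apply Cmult_neq_0; auto). rewrite (Cmod_mult x), (Cmod_mult (x - h)).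
    assert (Q : Cmod (3 - 2 * (h * / x)) <= 5).
    { eapply Rle_trans. apply Cmod_sub_le. rewrite !Cmod_mult, Cmod_inv by auto. rewrite !Cmod_R, !Rabs_pos_eq by lra.
      assert (Cmod h * / Cmod x <= 1). { rewrite <- (Rinv_r (Cmod x)) by lra. apply Rmult_le_compat_r. left. apply Rinv_0_lt_compat; lra. rewrite G1. lra. }
      lra. }
    assert (I1 : / (Cmod x * Cmod x) <= / (d * d)) by (apply Rinv_le_contravar; nra).
    assert (I2 : / (Cmod (x - h) * Cmod (x - h)) <= / (d * d)) by (apply Rinv_le_contravar; nra).
    assert (I3 : 0 <= / (Cmod x * Cmod x)) by (left; apply Rinv_0_lt_compat; nra).
    assert (I4 : 0 <= / (Cmod (x - h) * Cmod (x - h))) by (left; apply Rinv_0_lt_compat; nra).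
    replace (B * (5 / d ^ 4) * Cmod h ^ 2) with (B * ((Cmod h * Cmod h) * (5 * (/ (d * d) * / (d * d))))) by (field; lra).
    pose proof (Cmod_ge_0 h). pose proof (Cmod_ge_0 (phi t)). pose proof (Cmod_ge_0 (3 - 2 * (h * / x))).
    apply Rmult_le_compat; auto. repeat apply Rmult_le_pos; auto.
    apply Rmult_le_compat_l. nra. apply Rmult_le_compat; auto. nra. apply Rmult_le_compat; auto.
Qed.
End CauchyConsequences.

Lemma cdiff_C_derive g c R0 : 0 < R0 -> (forall z, Cmod (z - c) < R0 -> C_differentiable g z) ->
  C_differentiable (C_derive g) c.
Proof.
  intros HR H. apply cdiff_C_derive_centre with R0; auto.
  - intros. apply cdiff_cont_at; auto. - intros; apply H; lra.
Qed.

Definition dquot (g : C -> C) (a z : C) : C :=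
  if Ceq_dec z a then C_derive g a else ((g z - g a) / (z - a))%C.

Lemma dquot_eq g a z : g z = (g a + (z - a) * dquot g a z)%C.
Proof.
  unfold dquot. destruct (Ceq_dec z a) as [->|n]. ring. field. apply Cminus_eq_contra; auto.
Qed.

Lemma dquot_diag g a : dquot g a a = C_derive g a.
Proof. unfold dquot. destruct (Ceq_dec a a); congruence. Qed.

Lemma dquot_ne g a z : z <> a -> dquot g a z = ((g z - g a) / (z - a))%C.
Proof. intros. unfold dquot. destruct (Ceq_dec z a); congruence. Qed.

Lemma dquot_cont g a : C_differentiable g a -> cont_at (dquot g a) a.
Proof.
  intros H. destruct (cdiff_cder _ _ H) as [A [HA [HAa Hg]]].
  apply (cont_at_ext_loc A _ _ 1); auto. lra. intros w _. unfold dquot.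
  destruct (Ceq_dec w a) as [->|n]; auto. rewrite (Hg w). field. apply Cminus_eq_contra; auto.
Qed.

Definition open_set (U : C -> Prop) : Prop := forall z, U z -> exists d, 0 < d /\ forall w, Cmod (w - z) < d -> U w.
Definition holo (U : C -> Prop) (g : C -> C) : Prop := forall z, U z -> C_differentiable g z.

Lemma holo_dquot U g a : open_set U -> holo U g -> U a -> holo U (dquot g a).
Proof.
  intros HU Hg Ha.
  assert (Hoff : forall z, U z -> z <> a -> C_differentiable (dquot g a) z).
  { intros z Hz Hn. apply (cdiff_ext_loc (fun z => (g z - g a) / (z - a))%C _ _ (Cmod (z - a))).
    - apply Cmod_sub_pos; auto.
    - intros w Hw. symmetry. apply dquot_ne. intros ->. rewrite Cmod_sub_sym in Hw. lra.
    - apply cdiff_div. apply Cminus_eq_contra; auto. apply cdiff_minus. auto. apply cdiff_const.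
      apply cdiff_minus. apply cdiff_id. apply cdiff_const. }
  intros z Hz. destruct (Ceq_dec z a) as [->|n]; auto.
  destruct (HU a Ha) as [d [Hd H]].
  apply removable_singularity with d; auto.
  - intros w Hw. destruct (Ceq_dec w a) as [->|n]. apply dquot_cont; auto. apply cdiff_cont_at, Hoff; auto.
  - intros w Hw. apply Hoff. apply H; lra. intros ->. rewrite Cmod_sub_0 in Hw. lra.
Qed.

Lemma holo_C_derive U g : open_set U -> holo U g -> holo U (C_derive g).
Proof.
  intros HU Hg z Hz. destruct (HU z Hz) as [d [Hd H]]. apply cdiff_C_derive with d; auto.
Qed.

Lemma open_disc : open_set disc.
Proof.
  intros z Hz. exists (1 - Cmod z). unfold disc in *. split. lra. intros w Hw.
  pose proof (Cmod_sub_ge w z). lra.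
Qed.

(** * Boundary values, minimum principle and Schwarz lemma *)

Ltac dsc := unfold disc in *.

(** Points near the circle are moved only slightly by radial projection onto it. *)
Lemma boundary_uniform g c R0 r (e : R) : 0 < r < R0 ->
  (forall z, Cmod (z - c) < R0 -> C_differentiable g z) -> 0 < e ->
  exists r', r' < r /\ forall z, r' < Cmod (z - c) < r -> exists w, Cmod (w - c) = r /\ Cmod (g z - g w) < e.
Proof.
  intros Hr Hg He.
  destruct (uniform_cont (fun z => Cmod (z - c) = r) (Cmod c + r) g (cclosed_circle c r)) with (e := e) as [d [Hd H]]; auto.
  - intros z Hz. pose proof (Cmod_sub_ge z c). lra.
  - intros z Hz. apply cdiff_cont_at, Hg. lra.
  - exists (Rmax 0 (r - d)). split. apply Rmax_lub_lt; lra.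
    intros z Hz. pose proof (Rmax_l 0 (r - d)). pose proof (Rmax_r 0 (r - d)).
    pose (m := Cmod (z - c)). fold m in Hz.
    exists (c + RtoC (r / m) * (z - c))%C.
    assert (Hw : Cmod (c + RtoC (r / m) * (z - c) - c) = r).
    { replace (c + RtoC (r / m) * (z - c) - c)%C with (RtoC (r / m) * (z - c))%C by ring.
      rewrite Cmod_mult, Cmod_R, Rabs_pos_eq. fold m. field. lra. left. apply Rdiv_lt_0_compat; lra. }
    split; auto. apply H; auto.
    replace (z - (c + RtoC (r / m) * (z - c)))%C with (RtoC (1 - r / m) * (z - c))%C by (rewrite RtoC_minus; ring).
    rewrite Cmod_mult, Cmod_R. fold m.
    replace (1 - r / m) with (- ((r - m) / m)) by (field; lra).
    rewrite Rabs_Ropp, Rabs_pos_eq. replace ((r - m) / m * m) with (r - m) by (field; lra). lra.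
    left. apply Rdiv_lt_0_compat; lra.
Qed.

Lemma max_closed_Re g c R0 r M : 0 < r < R0 ->
  (forall z, Cmod (z - c) < R0 -> C_differentiable g z) ->
  (forall z, Cmod (z - c) = r -> Re (g z) <= M) ->
  forall z, Cmod (z - c) <= r -> Re (g z) <= M.
Proof.
  intros Hr Hg Hb z [Hz|Hz]; auto.
  apply (max_principle_Re g c r M); auto.
  - intros w Hw. apply Hg. lra.
  - intros e He. destruct (boundary_uniform g c R0 r e Hr Hg He) as [r' [Hr' H]].
    exists r'. split; auto. intros w Hw. destruct (H w Hw) as [v [Hv Hvw]].
    specialize (Hb v Hv). pose proof (re_le_Cmod (g w - g v)) as Hre.
    unfold Cminus in Hre at 1. rewrite re_plus, re_opp in Hre.
    pose proof (Rle_abs (Re (g w) + - Re (g v))). lra.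
Qed.

Lemma min_closed g c r m : 0 < r -> 0 < m ->
  (exists R0, r < R0 /\ forall z, Cmod (z - c) < R0 -> C_differentiable g z) ->
  (forall z, Cmod (z - c) = r -> m <= Cmod (g z)) ->
  (forall z, Cmod (z - c) < r -> g z <> RtoC 0) ->
  forall z, Cmod (z - c) < r -> m <= Cmod (g z).
Proof.
  intros Hr Hm [R0 [HR0 Hg]] Hb Hn z Hz.
  assert (Hz0 := Hn z Hz). apply Cmod_gt_0 in Hz0.
  rewrite <- (Rinv_inv m), <- (Rinv_inv (Cmod (g z))).
  apply Rinv_le_contravar. apply Rinv_0_lt_compat; auto.
  rewrite <- Cmod_inv by auto.
  apply (max_principle (fun w => / g w)%C c r (/ m)); auto.
  - intros w Hw. apply cdiff_inv; auto. apply Hg. lra.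
  - intros e He.
    pose (e' := m - / (/ m + e)).
    assert (Hi : 0 < / m) by (apply Rinv_0_lt_compat; auto).
    assert (He' : 0 < e').
    { unfold e'. assert (/ (/ m + e) < / (/ m)) by (apply Rinv_lt_contravar; nra). rewrite Rinv_inv in H. lra. }
    destruct (boundary_uniform g c R0 r e' (conj Hr HR0) Hg He') as [r' [Hr' H]].
    exists r'. split; auto. intros w Hw. destruct (H w Hw) as [v [Hv Hvw]].
    specialize (Hb v Hv). pose proof (Cmod_sub_ge (g v) (g w)) as Hs. rewrite Cmod_sub_sym in Hs.
    rewrite Cmod_inv by (apply Hn; lra).
    assert (Hl : / (/ m + e) <= Cmod (g w)) by (unfold e' in *; lra).
    rewrite <- (Rinv_inv (/ m + e)). apply Rinv_le_contravar; auto.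
    apply Rinv_0_lt_compat. lra.
Qed.

Lemma disc_0 : disc 0.
Proof. dsc. rewrite Cmod_0. lra. Qed.

(** Division by z costs a factor that tends to 1 at the boundary, which is where
    the maximum principle looks. *)
Lemma bound_divided_by_id g : holo disc g -> (forall z, disc z -> Cmod (z * g z) <= 1) ->
  forall z, disc z -> Cmod (g z) <= 1.
Proof.
  intros Hg H z Hz. apply (max_principle g 0 1 1).
  - intros w Hw. rewrite Cminus_0_r in Hw. auto.
  - intros e He. exists (/ (1 + e)). split. rewrite <- Rinv_1 at 2. apply Rinv_lt_contravar; lra.
    intros w Hw. rewrite Cminus_0_r in Hw.
    assert (Hp : 0 < / (1 + e)) by (apply Rinv_0_lt_compat; lra).
    specialize (H w ltac:(dsc; lra)). rewrite Cmod_mult in H.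
    pose proof (Cmod_ge_0 (g w)).
    apply Rle_trans with ((1 + e) * (/ (1 + e) * Cmod (g w))). right; field; lra.
    apply Rle_trans with ((1 + e) * 1); [|lra]. apply Rmult_le_compat_l. lra. nra.
  - rewrite Cminus_0_r. auto.
Qed.

Lemma schwarz g : holo disc g -> (forall z, disc z -> Cmod (g z) <= 1) -> g 0 = 0 ->
  forall z, disc z -> Cmod (g z) <= Cmod z.
Proof.
  intros Hg Hb H0.
  assert (Hq : forall z, g z = (z * dquot g 0 z)%C).
  { intros z. rewrite (dquot_eq g 0 z) at 1. rewrite H0. ring. }
  assert (HQ : forall z, disc z -> Cmod (dquot g 0 z) <= 1).
  { apply bound_divided_by_id. apply holo_dquot; auto using open_disc, disc_0.
    intros z Hz. rewrite <- Hq. auto. }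
  intros z Hz. rewrite Hq, Cmod_mult. specialize (HQ z Hz). pose proof (Cmod_ge_0 z). nra.
Qed.

(** * Concave functions with the pole at the centre *)

Section Concave.
Variable k : C -> C.
Hypothesis Hk : holo disc k.
Hypothesis Hk0 : k 0 <> RtoC 0.
(** Univalence of k z / z in homogeneous form, so that the pole at 0 is a value
    like any other. *)
Hypothesis Hinj : forall a b, disc a -> disc b -> (b * k a)%C = (a * k b)%C -> a = b.

Lemma solution_unique c d a b : (c <> RtoC 0 \/ d <> RtoC 0) -> disc a -> disc b ->
  (k a * d)%C = (c * a)%C -> (k b * d)%C = (c * b)%C -> a = b.
Proof.
  intros Hcd Ha Hb Ea Eb.
  destruct (Ceq_dec d 0) as [->|n].
  - destruct Hcd as [Hc|Hc]; [|congruence].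
    assert (forall x, (k x * 0)%C = (c * x)%C -> x = 0).
    { intros x Ex. replace x with (/ c * (c * x))%C by (field; auto). rewrite <- Ex. ring. }
    rewrite (H a Ea), (H b Eb). reflexivity.
  - apply Hinj; auto.
    replace (b * k a)%C with (b * (k a * d) / d)%C by (field; auto).
    replace (a * k b)%C with (a * (k b * d) / d)%C by (field; auto).
    rewrite Ea, Eb. field; auto.
Qed.

Lemma k_bounded c r : (forall z, Cmod (z - c) <= r -> disc z) -> exists B, 0 < B /\ forall z, Cmod (z - c) <= r -> Cmod (k z) <= B.
Proof.
  intros H. destruct (Rlt_dec r 0) as [h|h].
  - exists 1. split. lra. intros z Hz. pose proof (Cmod_ge_0 (z - c)). lra.
  - destruct (attains_max (fun z => Cmod (z - c) <= r) (Cmod c + r) (fun z => Cmod (k z))) as [z0 [_ H1]].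
    + apply cclosed_ball.
    + intros z Hz. pose proof (Cmod_sub_ge z c). lra.
    + intros z Hz. apply rcont_at_Cmod, cdiff_cont_at, Hk, H, Hz.
    + exists c. rewrite Cmod_sub_0. lra.
    + exists (Cmod (k z0) + 1). pose proof (Cmod_ge_0 (k z0)). split. lra. intros z Hz. specialize (H1 z Hz). lra.
Qed.

Lemma ball_disc v r : Cmod v + r < 1 -> forall z, Cmod (z - v) <= r -> disc z.
Proof. intros H z Hz. dsc. pose proof (Cmod_sub_ge z v). lra. Qed.

Lemma ball_holo v r (g : C -> C) : 0 < r -> Cmod v + r < 1 -> holo disc g -> exists R0, r < R0 /\ forall z, Cmod (z - v) < R0 -> C_differentiable g z.
Proof.
  intros Hr H Hg. exists (1 - Cmod v). split. lra. intros z Hz. apply Hg. dsc. pose proof (Cmod_sub_ge z v). lra.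
Qed.

(** The equation k v * d = c * v says that k v / v = c / d, with d = 0 standing
    for infinity.  On a small circle around v0 the difference of its two sides is
    bounded below, while at v0 it becomes small; by the minimum principle it must
    vanish inside.  This replaces the open mapping theorem, the continuity of the
    inverse function and its behaviour at infinity. *)
Lemma solve_stable c0 d0 v0 : (c0 <> RtoC 0 \/ d0 <> RtoC 0) -> disc v0 -> (k v0 * d0)%C = (c0 * v0)%C ->
  forall rho, 0 < rho -> exists delta, 0 < delta /\ forall c d, Cmod (c - c0) < delta -> Cmod (d - d0) < delta ->
    exists v, disc v /\ Cmod (v - v0) < rho /\ (k v * d)%C = (c * v)%C.
Proof.
  intros Hcd Hv0 E0 rho Hrho.
  pose (r := Rmin rho (1 - Cmod v0) / 2).
  assert (Hr : 0 < r /\ r < rho /\ Cmod v0 + r < 1).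
  { dsc. unfold r. pose proof (Rmin_l rho (1 - Cmod v0)). pose proof (Rmin_r rho (1 - Cmod v0)).
    assert (0 < Rmin rho (1 - Cmod v0)) by (apply Rmin_glb_lt; lra). lra. }
  clearbody r. destruct Hr as [Hr1 [Hr2 Hr3]].
  pose proof (ball_disc v0 r Hr3) as Hball.
  destruct (k_bounded v0 r Hball) as [B [HB HkB]].
  assert (Hg : forall c d, holo disc (fun v => k v * d - c * v)%C).
  { intros c d z Hz. apply cdiff_minus; apply cdiff_mult; auto using cdiff_const, cdiff_id. }
  destruct (pos_lower_bound (fun z => Cmod (z - v0) = r) (Cmod v0 + r) (fun z => Cmod (k z * d0 - c0 * z)%C)) as [m [Hm Hlow]].
  - apply cclosed_circle.
  - intros z Hz. pose proof (Cmod_sub_ge z v0). lra.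
  - intros z Hz. apply (rcont_at_Cmod (fun z => k z * d0 - c0 * z)%C). apply cdiff_cont_at, Hg, Hball. lra.
  - intros z Hz. apply Cmod_gt_0. intros E. apply Ceq_minus in E.
    assert (z = v0) as ->. { apply (solution_unique c0 d0); auto. apply Hball. lra. }
    rewrite Cmod_sub_0 in Hz. lra.
  - exists (m / (3 * (B + 1))). split. apply Rdiv_lt_0_compat; lra.
    intros c d Hc Hd.
    assert (Hdiff : forall z, Cmod (z - v0) <= r -> Cmod ((k z * d - c * z) - (k z * d0 - c0 * z)) <= m / 3).
    { intros z Hz. replace ((k z * d - c * z) - (k z * d0 - c0 * z))%C with (k z * (d - d0) - (c - c0) * z)%C by ring.
      eapply Rle_trans. apply Cmod_sub_le. rewrite !Cmod_mult.
      pose proof (HkB z Hz). pose proof (Hball z Hz). dsc.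
      pose proof (Cmod_ge_0 (d - d0)). pose proof (Cmod_ge_0 (c - c0)). pose proof (Cmod_ge_0 z). pose proof (Cmod_ge_0 (k z)).
      set (q := m / (3 * (B + 1))) in *.
      replace (m / 3) with (B * q + q * 1) by (unfold q; field; lra).
      apply Rplus_le_compat; apply Rmult_le_compat; lra. }
    apply NNPP. intros Hno.
    assert (Hge : m * 2 / 3 <= Cmod (k v0 * d - c * v0)).
    { apply (min_closed (fun v => k v * d - c * v)%C v0 r); auto. lra.
      - apply ball_holo; auto.
      - intros z Hz. specialize (Hlow z Hz). specialize (Hdiff z ltac:(lra)).
        pose proof (Cmod_sub_ge (k z * d0 - c0 * z) (k z * d - c * z)) as Hs. rewrite (Cmod_sub_sym (k z * d0 - c0 * z)) in Hs. lra.
      - intros z Hz E. apply Hno. exists z. split. apply Hball; lra. split. lra. apply Ceq_minus. auto.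
      - rewrite Cmod_sub_0. lra. }
    specialize (Hdiff v0). rewrite Cmod_sub_0 in Hdiff. specialize (Hdiff ltac:(lra)).
    rewrite E0 in Hdiff. replace (k v0 * d - c * v0 - (c0 * v0 - c0 * v0))%C with (k v0 * d - c * v0)%C in Hdiff by ring.
    lra.
Qed.

(** With F z = k z / z this is - z^2 F'(z). *)
Definition J (z : C) : C := (k z - z * C_derive k z)%C.

Lemma holo_J : holo disc J.
Proof.
  intros z Hz. unfold J. apply cdiff_minus. auto. apply cdiff_mult. apply cdiff_id.
  apply (holo_C_derive disc); auto. apply open_disc.
Qed.

(** A univalent function has no critical point.  At a zero w0 of J of least
    modulus, let h w z = w * k z - z * k w, which vanishes for z = w only.  It is
    bounded below on a circle around w0, uniformly for w near w0.  If J w <> 0,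
    division by z - w leaves a function without zeros whose value at w is - J w,
    and the minimum principle keeps J w away from 0.  For w tending to w0 along
    the radius this contradicts J w0 = 0. *)
Lemma J_ne z : disc z -> J z <> RtoC 0.
Proof.
  intros Hz1 HJ.
  destruct (attains_max (fun w => Cmod w <= Cmod z /\ J w = 0) 1 (fun w => Re (- RtoC (Cmod w)))) as [w0 [[Hw0 HJ0] Hmin]].
  - intros w Hw. destruct (Rle_lt_dec (Cmod w) (Cmod z)) as [h|h].
    + assert (Hwd : disc w) by (dsc; lra).
      assert (HJw : J w <> RtoC 0) by tauto. apply Cmod_gt_0 in HJw.
      destruct (cdiff_cont_at _ _ (holo_J w Hwd) (Cmod (J w)) HJw) as [d [Hd H]].
      exists d. split; auto. intros v Hv [_ E]. specialize (H v Hv). rewrite E in H.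
      replace (0 - J w)%C with (- J w)%C in H by ring. rewrite Cmod_opp in H. lra.
    + exists (Cmod w - Cmod z). split. lra. intros v Hv [E _].
      pose proof (Cmod_sub_ge w v). rewrite Cmod_sub_sym in H. lra.
  - intros w [H _]. dsc. lra.
  - intros w _. apply (rcont_at_Re (fun w => - RtoC (Cmod w))%C). apply cont_at_opp.
    intros e He. destruct (rcont_at_Cmod (fun w => w) w (cont_at_id w) e He) as [d [Hd H]].
    exists d. split; auto. intros v Hv. rewrite <- RtoC_minus, Cmod_R. auto.
  - exists z. split; auto. lra.
  - assert (Hd0 : disc w0) by (dsc; lra).
    assert (Hmin' : forall w, Cmod w < Cmod w0 -> J w <> RtoC 0).
    { intros w Hw E. specialize (Hmin w ltac:(split; auto; lra)). rewrite !re_opp, !re_RtoC in Hmin. lra. }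
    assert (Hn0 : w0 <> 0).
    { intros ->. apply Hk0. transitivity (J 0); auto. unfold J. ring. }
    pose proof (proj1 (Cmod_gt_0 _) Hn0) as Hp0.
    pose (r := (1 - Cmod w0) / 2). assert (Hr : 0 < r /\ Cmod w0 + r < 1) by (dsc; unfold r; lra).
    destruct Hr as [Hr1 Hr3].
    pose proof (ball_disc w0 r Hr3) as Hball.
    destruct (k_bounded w0 r Hball) as [B [HB HkB]].
    pose (h := fun w z => (w * k z - z * k w)%C).
    assert (Hh : forall w, holo disc (h w)).
    { intros w v Hv. unfold h. apply cdiff_minus; apply cdiff_mult; auto using cdiff_const, cdiff_id. }
    destruct (pos_lower_bound (fun z => Cmod (z - w0) = r) (Cmod w0 + r) (fun z => Cmod (h w0 z))) as [m [Hm Hlow]].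
    + apply cclosed_circle.
    + intros v Hv. pose proof (Cmod_sub_ge v w0). lra.
    + intros v Hv. apply rcont_at_Cmod. apply cdiff_cont_at, Hh, Hball. lra.
    + intros v Hv. apply Cmod_gt_0. intros E. apply Ceq_minus in E.
      assert (v = w0) as ->. { apply Hinj; auto. apply Hball. lra. }
      rewrite Cmod_sub_0 in Hv. lra.
    + destruct (cdiff_cont_at _ _ (Hk w0 Hd0) (m / 4) ltac:(lra)) as [d1 [Hd1 Hc1]].
      destruct (cdiff_cont_at _ _ (holo_J w0 Hd0) (m / (4 * r))) as [d2 [Hd2 Hc2]]. apply Rdiv_lt_0_compat; lra.
      pose (d := Rmin (Rmin d1 d2) (Rmin (Rmin r (Cmod w0)) (m / (4 * B)))).
      assert (Hd : 0 < d). { unfold d. repeat apply Rmin_glb_lt; auto. apply Rdiv_lt_0_compat; lra. }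
      assert (Hd' : d <= d1 /\ d <= d2 /\ d <= r /\ d <= Cmod w0 /\ d <= m / (4 * B)).
      { unfold d. pose proof (Rmin_l (Rmin d1 d2) (Rmin (Rmin r (Cmod w0)) (m / (4 * B)))).
        pose proof (Rmin_r (Rmin d1 d2) (Rmin (Rmin r (Cmod w0)) (m / (4 * B)))).
        pose proof (Rmin_l d1 d2). pose proof (Rmin_r d1 d2).
        pose proof (Rmin_l (Rmin r (Cmod w0)) (m / (4 * B))). pose proof (Rmin_r (Rmin r (Cmod w0)) (m / (4 * B))).
        pose proof (Rmin_l r (Cmod w0)). pose proof (Rmin_r r (Cmod w0)). lra. }
      clearbody d. destruct Hd' as [e1 [e2 [e3 [e4 e5]]]].
      (* w lies on the radius just inside w0, where J w <> 0 by minimality *)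
      pose (t := 1 - d / (2 * Cmod w0)).
      assert (Ht : 0 < t < 1).
      { unfold t. assert (0 < d / (2 * Cmod w0)) by (apply Rdiv_lt_0_compat; lra).
        assert (d / (2 * Cmod w0) <= 1/2). { apply Rmult_le_reg_r with (2 * Cmod w0). lra. unfold Rdiv at 1. rewrite Rmult_assoc, Rinv_l; lra. } lra. }
      pose (w := (RtoC t * w0)%C).
      assert (Hwm : Cmod w = t * Cmod w0) by (unfold w; rewrite Cmod_mult, Cmod_R, Rabs_pos_eq; lra).
      assert (Hww : Cmod (w - w0) = d / 2).
      { unfold w. replace (RtoC t * w0 - w0)%C with (RtoC (t - 1) * w0)%C by (rewrite RtoC_minus; ring).
        rewrite Cmod_mult, Cmod_R. unfold t. replace (1 - d / (2 * Cmod w0) - 1) with (- (d / (2 * Cmod w0))) by ring.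
        rewrite Rabs_Ropp, Rabs_pos_eq. field; lra. left; apply Rdiv_lt_0_compat; lra. }
      assert (Hwd : disc w) by (dsc; nra).
      assert (HJw : J w <> RtoC 0) by (apply Hmin'; nra).
      assert (Hdq : holo disc (dquot (h w) w)) by (apply holo_dquot; auto; apply open_disc).
      assert (Hhw : h w w = 0) by (unfold h; ring).
      assert (Heq : forall z, h w z = ((z - w) * dquot (h w) w z)%C).
      { intros v. rewrite (dquot_eq (h w) w v) at 1. rewrite Hhw. ring. }
      assert (Hdiag : dquot (h w) w w = (- J w)%C).
      { rewrite dquot_diag. apply is_C_derive_unique, cder_iff. unfold h, J.
        eapply cder_eq. apply cder_minus; apply cder_mult; try apply cder_const; try apply cder_id.
        apply cdiff_cder, Hk, Hwd. cbv beta. ring. }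
      assert (Hge : m / (4 * r) <= Cmod (dquot (h w) w w)).
      { apply (min_closed (dquot (h w) w) w0 r); auto.
        - apply Rdiv_lt_0_compat; lra.
        - apply ball_holo; auto.
        - intros v Hv.
          assert (Hvd : disc v) by (apply Hball; lra).
          assert (Hlv := Hlow v Hv).
          assert (Hdf : Cmod (h w0 v - h w v) <= m / 2).
          { unfold h. replace (w0 * k v - v * k w0 - (w * k v - v * k w))%C with (v * (k w - k w0) - (w - w0) * k v)%C by ring.
            eapply Rle_trans. apply Cmod_sub_le. rewrite !Cmod_mult, Hww.
            specialize (Hc1 w ltac:(lra)). specialize (HkB v ltac:(lra)).
            pose proof (Cmod_ge_0 v). pose proof (Cmod_ge_0 (k w - k w0)). pose proof (Cmod_ge_0 (k v)).
            assert (d / 2 * Cmod (k v) <= m / (4 * B) * B) by (apply Rmult_le_compat; lra).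
            replace (m / (4 * B) * B) with (m / 4) in * by (field; lra).
            dsc. nra. }
          pose proof (Cmod_sub_ge (h w0 v) (h w v)) as Hs.
          assert (Hhv : m / 2 <= Cmod (h w v)) by lra.
          rewrite Heq, Cmod_mult in Hhv.
          assert (Hvw : Cmod (v - w) <= 2 * r).
          { pose proof (Cmod_sub_triangle v w0 w). rewrite (Cmod_sub_sym w0 w) in *. lra. }
          pose proof (Cmod_ge_0 (dquot (h w) w v)).
          apply Rmult_le_reg_r with (2 * r). lra.
          replace (m / (4 * r) * (2 * r)) with (m / 2) by (field; lra). nra.
        - intros v Hv E. assert (Hvd : disc v) by (apply Hball; lra).
          destruct (Ceq_dec v w) as [->|n].
          + rewrite Hdiag in E. apply HJw. replace (J w) with (- - J w)%C by ring. rewrite E. ring.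
          + apply n. apply Hinj; auto. specialize (Heq v). rewrite E in Heq.
            apply Ceq_minus. unfold h in Heq. rewrite Heq. ring.
        - lra. }
      rewrite Hdiag, Cmod_opp in Hge.
      specialize (Hc2 w ltac:(lra)). rewrite HJ0 in Hc2. replace (J w - 0)%C with (J w) in Hc2 by ring. lra.
Qed.

(** The values omitted by k z / z; the point z = 0 imposes no condition as long
    as k 0 <> 0. *)
Definition omitted (u : C) : Prop := forall z, disc z -> k z <> (u * z)%C.

Lemma not_omitted u : ~ omitted u -> exists z, disc z /\ k z = (u * z)%C.
Proof.
  intros H. apply NNPP. intros Hn. apply H. intros z Hz E. apply Hn. eauto.
Qed.

(** A value at distance at least e from the omitted set is attained well inside
    the disc, uniformly for values in a bounded set; and the values near the
    boundary are bounded, since a neighbourhood of infinity is already covered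
    near the pole. *)
Lemma near_boundary e : 0 < e -> exists r, r < 1 /\ forall s, disc s -> r < Cmod s ->
  exists u, omitted u /\ Cmod (k s / s - u) < e.
Proof.
  intros He.
  destruct (solve_stable 1 0 0) with (rho := 1/2) as [d0 [Hd0 H0]]; try lra.
  { left. apply C1_nz. } { dsc. rewrite Cmod_0; lra. } { ring. }
  assert (Hinf : forall s, disc s -> 1 / 2 <= Cmod s -> Cmod (k s / s) <= / d0).
  { intros s Hs Hs2. apply Rnot_lt_le. intros Hlt.
    assert (Hs0 : s <> 0) by (intros ->; rewrite Cmod_0 in Hs2; lra).
    assert (Hks : k s <> RtoC 0).
    { intros E. rewrite E in Hlt. replace (0 / s)%C with (RtoC 0) in Hlt by (field; auto). rewrite Cmod_0 in Hlt.
      assert (0 < / d0) by (apply Rinv_0_lt_compat; auto). lra. }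
    destruct (H0 1 (s / k s)%C) as [v [Hv [Hv1 Ev]]].
    - rewrite Cmod_sub_0; auto.
    - replace (s / k s - 0)%C with (/ (k s / s))%C by (field; auto).
      rewrite Cmod_inv. rewrite <- (Rinv_inv d0). apply Rinv_lt_contravar; auto.
      apply Rmult_lt_0_compat; [|eapply Rlt_trans; [|apply Hlt]]; apply Rinv_0_lt_compat; auto.
      intros E. apply Hks. replace (k s) with (k s / s * s)%C by (field; auto). rewrite E. ring.
    - rewrite Cminus_0_r in Hv1.
      assert (v = s) as ->; [|lra]. apply Hinj; auto.
      replace (s * k v)%C with (k v * (s / k s) * k s)%C by (field; auto). rewrite Ev. ring. }
  destruct (lebesgue_number (/ d0) (fun w d => (exists u, omitted u /\ Cmod (w - u) < e) \/
     exists v, Cmod v <= 1 - d /\ disc v /\ k v = (w * v)%C)) as [d [Hd H]].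
  - intros w. destruct (classic (omitted w)) as [h|h].
    + exists e. split; auto. intros v Hv. left. exists w. auto.
    + destruct (not_omitted w h) as [z [Hz Ez]].
      destruct (solve_stable w 1 z) with (rho := (1 - Cmod z) / 2) as [d1 [Hd1 H1]]; auto.
      { right. apply C1_nz. } { rewrite Ez. ring. } { dsc. lra. }
      exists (Rmin d1 ((1 - Cmod z) / 2)). split. apply Rmin_glb_lt; dsc; lra.
      intros v Hv. right. destruct (H1 v 1) as [y [Hy [Hy1 Ey]]].
      eapply Rlt_le_trans; [apply Hv|apply Rmin_l]. rewrite Cmod_sub_0; auto.
      exists y. split; [|split]; auto.
      * pose proof (Cmod_sub_ge y z). pose proof (Rmin_r d1 ((1 - Cmod z) / 2)). lra.
      * rewrite <- Ey. ring.
  - intros v d d' Hd [h|[z [Hz1 Hz2]]]; [left; auto|right]. exists z. split; auto. lra.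
  - exists (Rmax (1/2) (1 - d)). split. apply Rmax_lub_lt; lra.
    intros s Hs Hs1. pose proof (Rmax_l (1/2) (1 - d)). pose proof (Rmax_r (1/2) (1 - d)).
    assert (Hs0 : s <> 0) by (intros ->; rewrite Cmod_0 in Hs1; lra).
    destruct (H (k s / s)%C) as [h|[v [Hv1 [Hv2 Hv3]]]]; auto.
    + apply Hinf; auto. lra.
    + exfalso. assert (v = s) as ->; [|lra]. apply Hinj; auto. rewrite Hv3. field; auto.
Qed.

Hypothesis Hconv : forall u v t, 0 <= t <= 1 -> omitted u -> omitted v ->
  omitted (RtoC t * u + RtoC (1 - t) * v)%C.

(** With F z = k z / z, the value (F z - t u) / (1 - t) cannot be omitted:
    otherwise F z would be a convex combination of omitted values. *)
Lemma contraction_solvable u t z : omitted u -> 0 < t < 1 -> disc z ->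
  exists v, disc v /\ (k v * (RtoC (1 - t) * z))%C = ((k z - RtoC t * u * z) * v)%C.
Proof.
  intros Hu Ht Hz. destruct (Ceq_dec z 0) as [->|n].
  - exists 0. split. apply disc_0. ring.
  - assert (Ht1 : RtoC (1 - t) <> RtoC 0) by (intros E; apply RtoC_inj in E; lra).
    pose (w := ((k z - RtoC t * u * z) / (RtoC (1 - t) * z))%C).
    destruct (classic (omitted w)) as [h|h].
    + exfalso. apply (Hconv u w t ltac:(lra) Hu h z Hz). unfold w. field; auto.
    + destruct (not_omitted w h) as [v [Hv E]]. exists v. split; auto.
      rewrite E. unfold w. field; auto.
Qed.

(** The root v of k v * d - c * v is simple because J has no zero. *)
Lemma solution_nondegenerate c d v : (c <> RtoC 0 \/ d <> RtoC 0) -> disc v -> (k v * d)%C = (c * v)%C ->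
  (C_derive k v * d - c)%C <> RtoC 0.
Proof.
  intros Hcd Hv E En. pose proof (J_ne v Hv) as HJ.
  destruct (Ceq_dec v 0) as [->|n].
  - assert (d = 0) as ->.
    { replace d with (/ k 0 * (k 0 * d))%C by (field; auto). rewrite E. ring. }
    destruct Hcd as [h|h]; [|congruence]. apply h.
    replace c with (- (C_derive k 0 * 0 - c))%C by ring. rewrite En. ring.
  - assert (Ec : c = (C_derive k v * d)%C).
    { symmetry. apply Ceq_minus. exact En. }
    assert (Ed : (J v * d)%C = 0).
    { unfold J. replace ((k v - v * C_derive k v) * d)%C with (k v * d - C_derive k v * d * v)%C by ring.
      rewrite <- Ec, E. ring. }
    assert (d = 0) as ->.
    { replace d with (/ J v * (J v * d))%C by (field; auto). rewrite Ed. ring. }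
    destruct Hcd as [h|h]; [|congruence]. apply h. rewrite Ec. ring.
Qed.

(** The solution v is a holomorphic function of z that maps the disc into itself
    and fixes 0. *)
Lemma contraction_schwarz u t z : omitted u -> 0 < t < 1 -> disc z ->
  exists v, Cmod v <= Cmod z /\ (k v * (RtoC (1 - t) * z))%C = ((k z - RtoC t * u * z) * v)%C.
Proof.
  intros Hu Ht Hz.
  assert (Ht1 : RtoC (1 - t) <> RtoC 0) by (intros E; apply RtoC_inj in E; lra).
  pose (c := fun z => (k z - RtoC t * u * z)%C). pose (d := fun z => (RtoC (1 - t) * z)%C).
  destruct (constructive_indefinite_description
    (fun V : C -> C => forall z, disc z -> disc (V z) /\ (k (V z) * d z)%C = (c z * V z)%C)) as [V HV].
  { exists (fun z => epsilon (inhabits (RtoC 0)) (fun v => disc v /\ (k v * d z)%C = (c z * v)%C)).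
    intros y Hy. apply epsilon_spec. apply contraction_solvable; auto. }
  assert (Hnd : forall y, disc y -> c y <> RtoC 0 \/ d y <> RtoC 0).
  { intros y Hy. destruct (Ceq_dec y 0) as [->|n].
    - left. unfold c. replace (k 0 - RtoC t * u * 0)%C with (k 0) by ring. auto.
    - right. unfold d. apply Cmult_neq_0; auto. }
  assert (Hcd : holo disc c). { intros y Hy. unfold c. apply cdiff_minus. auto. apply cdiff_mult. apply cdiff_const. apply cdiff_id. }
  assert (Hdd : holo disc d). { intros y Hy. unfold d. apply cdiff_mult. apply cdiff_const. apply cdiff_id. }
  assert (HVc : forall y, disc y -> cont_at V y).
  { intros y Hy rho Hrho. destruct (HV y Hy) as [Hv Ev].
    destruct (solve_stable (c y) (d y) (V y) (Hnd y Hy) Hv Ev rho Hrho) as [e [He H]].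
    destruct (cdiff_cont_at _ _ (Hcd y Hy) e He) as [d1 [Hd1 H1]].
    destruct (cdiff_cont_at _ _ (Hdd y Hy) e He) as [d2 [Hd2 H2]].
    destruct (open_disc y Hy) as [d3 [Hd3 H3]].
    exists (Rmin d1 (Rmin d2 d3)). split. repeat apply Rmin_glb_lt; auto.
    intros w Hw.
    assert (Hw1 : Cmod (w - y) < d1) by (eapply Rlt_le_trans; [apply Hw|apply Rmin_l]).
    assert (Hw2 : Cmod (w - y) < d2) by (eapply Rlt_le_trans; [apply Hw|eapply Rle_trans; [apply Rmin_r|apply Rmin_l]]).
    assert (Hw3 : Cmod (w - y) < d3) by (eapply Rlt_le_trans; [apply Hw|eapply Rle_trans; [apply Rmin_r|apply Rmin_r]]).
    destruct (H (c w) (d w) (H1 w Hw1) (H2 w Hw2)) as [v [Hvd [Hvy Ev']]].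
    destruct (HV w (H3 w Hw3)) as [Hvw Evw].
    rewrite (solution_unique (c w) (d w) (V w) v); auto. }
  assert (HVd : holo disc V).
  { intros y Hy. destruct (HV y Hy) as [Hv Ev].
    pose (A := dquot k (V y)).
    (* subtracting the equations at w and at y gives
       (V w - V y) * E w = c w * V y - k (V y) * d w *)
    pose (E := fun w => (A (V w) * d w - c w)%C).
    assert (HAh : holo disc A) by (apply holo_dquot; auto; apply open_disc).
    assert (HE : cont_at E y).
    { unfold E. apply cont_at_minus. apply cont_at_mult. apply cont_at_comp; auto. apply cdiff_cont_at; auto.
      apply cdiff_cont_at; auto. apply cdiff_cont_at; auto. }
    assert (HEn : E y <> RtoC 0).
    { unfold E, A. rewrite dquot_diag. apply solution_nondegenerate; auto. }
    assert (HN : C_differentiable (fun w => c w * V y - k (V y) * d w)%C y).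
    { apply cdiff_minus; apply cdiff_mult; auto using cdiff_const. }
    destruct (cdiff_cder _ _ HN) as [B [HB [_ HBe]]].
    destruct (HE (Cmod (E y))) as [d1 [Hd1 H1]]. apply Cmod_gt_0; auto.
    destruct (open_disc y Hy) as [d3 [Hd3 H3]].
    apply cdiff_iff. eexists.
    apply (cder_ext_loc (fun w => V y + (w - y) * (B w / E w))%C _ _ _ (Rmin d1 d3)).
    - apply Rmin_glb_lt; auto.
    - intros w Hw.
      assert (Hw1 : Cmod (w - y) < d1) by (eapply Rlt_le_trans; [apply Hw|apply Rmin_l]).
      assert (Hw3 : Cmod (w - y) < d3) by (eapply Rlt_le_trans; [apply Hw|apply Rmin_r]).
      assert (HEw : E w <> RtoC 0).
      { intros Z. specialize (H1 w Hw1). rewrite Z in H1. replace (0 - E y)%C with (- E y)%C in H1 by ring.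
        rewrite Cmod_opp in H1. lra. }
      destruct (HV w (H3 w Hw3)) as [Hvw Evw].
      pose proof (HBe w) as Hb. rewrite Ev in Hb at 1.
      replace (c y * V y - c y * V y + (w - y) * B w)%C with ((w - y) * B w)%C in Hb by ring.
      rewrite (dquot_eq k (V y) (V w)) in Evw. fold A in Evw.
      replace ((w - y) * (B w / E w))%C with ((w - y) * B w / E w)%C by (field; auto).
      rewrite <- Hb.
      assert (Hmul : ((V w - V y) * E w)%C = (c w * V y - k (V y) * d w)%C).
      { unfold E. replace ((V w - V y) * (A (V w) * d w - c w))%C
          with ((k (V y) + (V w - V y) * A (V w)) * d w - k (V y) * d w - c w * (V w - V y))%C by ring.
        rewrite Evw. ring. }
      rewrite <- Hmul. field. auto.
    - exists (fun w => B w / E w)%C. split; [|split]. apply cont_at_div; auto. reflexivity. intros w. ring. }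
  assert (HV0 : V 0 = 0).
  { destruct (HV 0 disc_0) as [h1 h2]. unfold c, d in h2.
    replace (V 0) with (/ k 0 * ((k 0 - RtoC t * u * 0) * V 0))%C by (field; auto). rewrite <- h2. ring. }
  exists (V z). split.
  - apply schwarz; auto. intros y Hy. left. apply HV; auto.
  - apply HV; auto.
Qed.

Lemma Re_div_pos_inv (z : C) : z <> 0 -> 0 <= Re z -> 0 <= Re (/ z).
Proof.
  intros Hz H. destruct z as [x y]. simpl in *. apply Rmult_le_pos; auto.
  left. apply Rinv_0_lt_compat.
  destruct (Req_dec x 0) as [->|hx]; [destruct (Req_dec y 0) as [->|hy]|].
  - exfalso. apply Hz. reflexivity.
  - assert (0 < y * y) by (apply Rsqr_pos_lt; auto). lra.
  - assert (0 < x * x) by (apply Rsqr_pos_lt; auto). nra.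
Qed.

(** To first order in t, the solution v of [contraction_schwarz] is z (1 - t X),
    where X is the quotient below; |v| <= |z| forces Re X >= 0. *)
Lemma starlike u z : omitted u -> disc z -> 0 <= Re ((k z - u * z) / J z).
Proof.
  intros Hu Hz. destruct (Ceq_dec z 0) as [->|n].
  { assert (HJ0 : J 0 = k 0) by (unfold J; ring). rewrite HJ0.
    replace ((k 0 - u * 0) / k 0)%C with (RtoC 1) by (field; auto). simpl. lra. }
  apply Rnot_lt_le. intros Hneg.
  pose (X := ((k z - u * z) / J z)%C). fold X in Hneg.
  pose proof (J_ne z Hz) as HJ.
  assert (HJ' : (- J z)%C <> RtoC 0) by (intros E; apply HJ; replace (J z) with (- - J z)%C by ring; rewrite E; ring).
  assert (Hdiv : cont_at (fun w => (k z - u * z) / w)%C (- J z)%C).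
  { apply cont_at_div; auto using cont_at_const, cont_at_id. }
  destruct (Hdiv (- Re X) ltac:(lra)) as [e [He HE]].
  pose (A := dquot k z).
  assert (HA : holo disc A) by (apply holo_dquot; auto; apply open_disc).
  assert (HAc : cont_at (fun w => A w * z - k z)%C z).
  { apply cont_at_minus. apply cont_at_mult. apply cdiff_cont_at; auto. apply cont_at_const. apply cont_at_const. }
  destruct (HAc (e / 2) ltac:(lra)) as [rho [Hrho HR]].
  assert (Hnd : k z <> RtoC 0 \/ z <> RtoC 0) by (right; auto).
  destruct (solve_stable (k z) z z Hnd Hz eq_refl (Rmin rho (1 - Cmod z))) as [d [Hd HS]].
  { apply Rmin_glb_lt; auto. dsc. lra. }
  destruct (attains_max (fun w => Cmod (w - 0) <= Cmod z) (Cmod z) (fun w => Cmod (A w))) as [w1 [_ Hw1]].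
  { apply cclosed_ball. } { intros w Hw. rewrite Cminus_0_r in Hw. auto. }
  { intros w Hw. apply rcont_at_Cmod, cdiff_cont_at, HA. dsc. rewrite Cminus_0_r in Hw. lra. }
  { exists 0. rewrite Cmod_sub_0. apply Cmod_ge_0. }
  pose (M := Cmod (u * z) + Cmod z + Cmod (A w1) * Cmod z + 1).
  assert (HM : 1 <= M). { unfold M. pose proof (Cmod_ge_0 (u * z)). pose proof (Cmod_ge_0 z). pose proof (Cmod_ge_0 (A w1)). nra. }
  pose (t := Rmin (1/2) (Rmin (d / (2 * M)) (e / (4 * M)))).
  assert (Ht0 : 0 < t). { unfold t. repeat apply Rmin_glb_lt; try lra; apply Rdiv_lt_0_compat; lra. }
  assert (Ht1 : t <= 1/2) by apply Rmin_l.
  assert (Ht2 : t * M <= d / 2).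
  { apply Rle_trans with (d / (2 * M) * M). apply Rmult_le_compat_r. lra. eapply Rle_trans. apply Rmin_r. apply Rmin_l. right; field; lra. }
  assert (Ht3 : t * M <= e / 4).
  { apply Rle_trans with (e / (4 * M) * M). apply Rmult_le_compat_r. lra. eapply Rle_trans. apply Rmin_r. apply Rmin_r. right; field; lra. }
  clearbody t.
  destruct (contraction_schwarz u t z Hu ltac:(lra) Hz) as [v [Hvz Ev]].
  assert (Hvd : disc v) by (dsc; lra).
  pose proof (Cmod_ge_0 (u * z)) as P1. pose proof (Cmod_ge_0 z) as P2. pose proof (Cmod_ge_0 (A w1)) as P3.
  assert (P4 : 0 <= Cmod (A w1) * Cmod z) by (apply Rmult_le_pos; auto).
  assert (P5 : t * Cmod (u * z) <= t * M) by (apply Rmult_le_compat_l; unfold M; lra).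
  assert (P6 : t * Cmod z <= t * M) by (apply Rmult_le_compat_l; unfold M; lra).
  assert (Hclose : Cmod (v - z) < rho).
  { destruct (HS (k z - RtoC t * u * z)%C (RtoC (1 - t) * z)%C) as [v' [Hv' [Hv'2 Ev']]].
    - replace (k z - RtoC t * u * z - k z)%C with (- (RtoC t * (u * z)))%C by ring.
      rewrite Cmod_opp, Cmod_mult, Cmod_R, Rabs_pos_eq by lra. lra.
    - replace (RtoC (1 - t) * z - z)%C with (- (RtoC t * z))%C by (rewrite RtoC_minus; ring).
      rewrite Cmod_opp, Cmod_mult, Cmod_R, Rabs_pos_eq by lra. lra.
    - assert (v = v') as ->.
      { apply (solution_unique (k z - RtoC t * u * z)%C (RtoC (1 - t) * z)%C); auto.
        right. apply Cmult_neq_0; auto. intros E; apply RtoC_inj in E; lra. }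
      eapply Rlt_le_trans. apply Hv'2. apply Rmin_l. }
  (* (v - z) E = t z (k z - u z), and E tends to - J z with t *)
  pose (E := (A v * (RtoC (1 - t) * z) - (k z - RtoC t * u * z))%C).
  assert (HEJ : Cmod (E - - J z) < e).
  { specialize (HR v Hclose). unfold A at 2 in HR. rewrite dquot_diag in HR.
    replace (C_derive k z * z - k z)%C with (- J z)%C in HR by (unfold J; ring).
    replace (E - - J z)%C with ((A v * z - k z - - J z) + RtoC t * (u * z - A v * z))%C by (unfold E; rewrite RtoC_minus; ring).
    eapply Rle_lt_trans. apply Cmod_triangle. rewrite Cmod_mult, Cmod_R, Rabs_pos_eq by lra.
    assert (Cmod (u * z - A v * z) <= M).
    { eapply Rle_trans. apply Cmod_sub_le. rewrite (Cmod_mult (A v)).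
      specialize (Hw1 v). rewrite Cminus_0_r in Hw1. specialize (Hw1 Hvz). cbv beta in Hw1.
      unfold M. nra. }
    nra. }
  specialize (HE E HEJ).
  assert (Hmul : ((v - z) * E)%C = (RtoC t * z * (k z - u * z))%C).
  { unfold E. pose proof (dquot_eq k z v) as Q. fold A in Q. rewrite Q in Ev.
    replace ((v - z) * (A v * (RtoC (1 - t) * z) - (k z - RtoC t * u * z)))%C with
     ((k z + (v - z) * A v) * (RtoC (1 - t) * z) - k z * (RtoC (1 - t) * z) - (k z - RtoC t * u * z) * (v - z))%C by ring.
    rewrite Ev, RtoC_minus. ring. }
  assert (HE0 : E <> RtoC 0).
  { intros Z. rewrite Z in Hmul. replace ((v - z) * 0)%C with (RtoC 0) in Hmul by ring.
    symmetry in Hmul. revert Hmul. apply Cmult_neq_0. apply Cmult_neq_0; auto. intros Q; apply RtoC_inj in Q; lra.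
    intros Q. apply Ceq_minus in Q. exact (Hu z Hz Q). }
  pose (Y := ((k z - u * z) / E)%C).
  assert (HY : v = (z * (1 + RtoC t * Y))%C).
  { unfold Y. replace (z * (1 + RtoC t * ((k z - u * z) / E)))%C with (z + (RtoC t * z * (k z - u * z)) / E)%C by (field; auto).
    rewrite <- Hmul. field; auto. }
  assert (HY1 : Cmod (1 + RtoC t * Y) <= 1).
  { rewrite HY, Cmod_mult in Hvz. apply Cmod_gt_0 in n. nra. }
  assert (HY2 : Re Y <= 0).
  { assert (Hsq : Cmod (1 + RtoC t * Y) ^ 2 <= 1). { pose proof (Cmod_ge_0 (1 + RtoC t * Y)). nra. }
    rewrite Cmod2_alt in Hsq. rewrite re_plus, im_plus, re_scal_l, im_scal_l, re_RtoC, im_RtoC in Hsq.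
    pose proof (pow2_ge_0 (0 + t * Im Y)). pose proof (pow2_ge_0 (t * Re Y)). nra. }
  assert (HX : ((k z - u * z) / - J z)%C = (- X)%C) by (unfold X; field; auto).
  fold Y in HE. rewrite HX in HE.
  pose proof (re_le_Cmod (Y - - X)) as Hre. unfold Cminus in Hre at 1. rewrite re_plus, !re_opp in Hre.
  pose proof (Rle_abs (- (Re Y + - - Re X))). rewrite Rabs_Ropp in H. lra.
Qed.

(** * The two-point inequality *)

Lemma radial_limit_Re (g : C -> C) z t0 : t0 < 1 -> cont_at g z ->
  (forall t, t0 < t < 1 -> 0 <= Re (g (RtoC t * z)%C)) -> 0 <= Re (g z).
Proof.
  intros Ht0 Hg H. apply Rnot_lt_le. intros Hn.
  destruct (rcont_at_Re _ _ Hg (- Re (g z)) ltac:(lra)) as [d [Hd Hc]].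
  pose proof (Cmod_ge_0 z) as Hz.
  pose (h := Rmin ((1 - t0) / 2) (d / (2 * (Cmod z + 1)))).
  assert (Hh : 0 < h). { apply Rmin_glb_lt. lra. apply Rdiv_lt_0_compat; lra. }
  assert (Hh1 : h <= (1 - t0) / 2) by apply Rmin_l.
  assert (Hh2 : h * (Cmod z + 1) <= d / 2).
  { apply Rle_trans with (d / (2 * (Cmod z + 1)) * (Cmod z + 1)). apply Rmult_le_compat_r. lra. apply Rmin_r. right; field; lra. }
  specialize (H (1 - h) ltac:(lra)). specialize (Hc (RtoC (1 - h) * z)%C).
  assert (Hd' : Cmod (RtoC (1 - h) * z - z) < d).
  { replace (RtoC (1 - h) * z - z)%C with (- (RtoC h * z))%C by (rewrite RtoC_minus; ring).
    rewrite Cmod_opp, Cmod_mult, Cmod_R, Rabs_pos_eq; nra. }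
  specialize (Hc Hd'). apply Rabs_lt_between in Hc. lra.
Qed.

(** With l = a / z, the quotient is the value at s = z of a function of s that is
    holomorphic in the whole disc, J (l s) being bounded away from 0.  Near the
    boundary k s / s is close to an omitted value, for which [starlike] gives the
    sign. *)
Lemma level_curve_half_plane_lt a z : disc z -> Cmod a < Cmod z ->
  0 <= Re ((z * k a - a * k z) / (z * J a)).
Proof.
  intros Hz Haz. pose proof (Cmod_ge_0 a) as Ha0.
  assert (Hzn : z <> 0) by (apply Cmod_gt_0; lra).
  pose (l := (a / z)%C).
  assert (Hl : Cmod l < 1).
  { unfold l. rewrite Cmod_div by auto. apply Rmult_lt_reg_r with (Cmod z). lra. unfold Rdiv. rewrite Rmult_assoc, Rinv_l; lra. }
  pose proof (Cmod_ge_0 l) as Hl0.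
  assert (Hls : forall s, disc s -> disc (l * s)).
  { intros s Hs. dsc. rewrite Cmod_mult. pose proof (Cmod_ge_0 s). nra. }
  pose (m := fun s => (- ((k (l * s) - l * k s) / J (l * s)))%C).
  destruct (pos_lower_bound (fun w => Cmod (w - 0) <= Cmod l) (Cmod l) (fun w => Cmod (J w))) as [j [Hj HJl]].
  { apply cclosed_ball. } { intros w Hw. rewrite Cminus_0_r in Hw. auto. }
  { intros w Hw. apply rcont_at_Cmod, cdiff_cont_at, holo_J. dsc. rewrite Cminus_0_r in Hw. lra. }
  { intros w Hw. apply Cmod_gt_0, J_ne. dsc. rewrite Cminus_0_r in Hw. lra. }
  assert (Hm : Re (m z) <= 0).
  { apply (max_principle_Re m 0 1 0).
    - intros s Hs. rewrite Cminus_0_r in Hs. unfold m. apply cdiff_opp.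
      assert (Hlsd : C_differentiable (fun s => (l * s)%C) s) by (apply cdiff_mult; auto using cdiff_const, cdiff_id).
      apply cdiff_div. apply J_ne, Hls, Hs.
      + apply cdiff_minus. apply (cdiff_comp k (fun s => l * s)%C). auto. apply Hk, Hls, Hs.
        apply cdiff_mult. apply cdiff_const. auto.
      + apply (cdiff_comp J (fun s => l * s)%C); auto. apply holo_J, Hls, Hs.
    - intros e He. destruct (near_boundary (e * j)) as [r [Hr H]]. apply Rmult_lt_0_compat; auto.
      exists (Rmax r 0). split. apply Rmax_lub_lt; lra.
      intros s Hs. rewrite Cminus_0_r in Hs.
      pose proof (Rmax_l r 0). pose proof (Rmax_r r 0).
      assert (Hsn : s <> 0) by (apply Cmod_gt_0; lra).
      destruct (H s ltac:(dsc; lra) ltac:(lra)) as [u [Hu Hsu]].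
      pose proof (starlike u (l * s)%C Hu (Hls s ltac:(dsc; lra))) as Hst.
      pose proof (J_ne (l * s)%C (Hls s ltac:(dsc; lra))) as HJn.
      replace (m s) with (- ((k (l * s) - u * (l * s)) / J (l * s)) + (l * s * (k s / s - u)) / J (l * s))%C by (unfold m; field; auto).
      rewrite re_plus, re_opp.
      pose proof (re_le_Cmod (l * s * (k s / s - u) / J (l * s))) as Hre.
      pose proof (Rle_abs (Re (l * s * (k s / s - u) / J (l * s)))) as Hab.
      assert (Cmod (l * s * (k s / s - u) / J (l * s)) <= e); [|lra].
      rewrite Cmod_div, !Cmod_mult by auto.
      specialize (HJl (l * s)%C). replace (l * s - 0)%C with (l * s)%C in HJl by ring.
      assert (Hlsm : Cmod (l * s) <= Cmod l) by (rewrite Cmod_mult; nra).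
      specialize (HJl Hlsm). rewrite Cmod_mult in Hlsm.
      apply Rmult_le_reg_r with (Cmod (J (l * s))). lra. unfold Rdiv. rewrite Rmult_assoc, Rinv_l, Rmult_1_r by lra.
      pose proof (Cmod_ge_0 (k s / s - u)).
      apply Rle_trans with (1 * (e * j)). apply Rmult_le_compat; try lra. apply Rmult_le_pos; lra. nra.
    - rewrite Cminus_0_r. exact Hz. }
  assert (Hla : (l * z)%C = a) by (unfold l; field; auto).
  unfold m in Hm. rewrite Hla, re_opp in Hm.
  replace ((z * k a - a * k z) / (z * J a))%C with ((k a - l * k z) / J a)%C; [lra|].
  unfold l. field. split; auto. apply J_ne. dsc. lra.
Qed.

Lemma level_curve_half_plane a z : disc a -> disc z -> z <> 0 -> Cmod a <= Cmod z ->
  0 <= Re ((z * k a - a * k z) / (z * J a)).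
Proof.
  intros Ha Hz Hzn Haz.
  apply (radial_limit_Re (fun a => (z * k a - a * k z) / (z * J a))%C a 0). lra.
  - apply cont_at_div. apply Cmult_neq_0; auto. apply J_ne; auto.
    apply cont_at_minus; apply cont_at_mult; auto using cont_at_const, cont_at_id. apply cdiff_cont_at; auto.
    apply cont_at_mult. apply cont_at_const. apply cdiff_cont_at, holo_J; auto.
  - intros t Ht. apply level_curve_half_plane_lt; auto.
    rewrite Cmod_mult, Cmod_R, Rabs_pos_eq by lra. apply Cmod_gt_0 in Hzn. pose proof (Cmod_ge_0 a). nra.
Qed.

(** The two-point version of J: it equals (z * k a - a * k z) / (z - a) off the
    diagonal and J a on it. *)
Definition J2 (a z : C) : C := (k a - a * dquot k a z)%C.
Definition dquot2 (a z : C) : C := dquot (dquot k a) a z.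

Lemma dquot_sym a z : dquot k a z = dquot k z a.
Proof.
  destruct (Ceq_dec a z) as [->|n]; auto. rewrite !dquot_ne by auto. field.
  split; apply Cminus_eq_contra; auto.
Qed.

Lemma J2_sym a z : J2 a z = J2 z a.
Proof.
  unfold J2. rewrite (dquot_eq k z a), (dquot_sym a z). ring.
Qed.

Lemma J2_eq a z : ((z - a) * J2 a z)%C = (z * k a - a * k z)%C.
Proof. unfold J2. rewrite (dquot_eq k a z). ring. Qed.

Lemma J2_ne a z : disc a -> disc z -> J2 a z <> RtoC 0.
Proof.
  intros Ha Hz. destruct (Ceq_dec z a) as [->|n].
  - unfold J2. rewrite dquot_diag. apply J_ne; auto.
  - intros E. apply n. pose proof (J2_eq a z) as H. rewrite E in H.
    apply Hinj; auto. apply Ceq_minus.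
    replace (a * k z - z * k a)%C with (- (z * k a - a * k z))%C by ring. rewrite <- H. ring.
Qed.

Lemma dquot2_eq a z : J a = (J2 a z + a * (z - a) * dquot2 a z)%C.
Proof.
  unfold J, J2, dquot2. rewrite <- (dquot_diag k a). rewrite (dquot_eq (dquot k a) a z). ring.
Qed.

(** The right-hand side exhibits dquot2 as a holomorphic function of its first
    argument. *)
Lemma dquot2_sym a z : disc a -> disc z -> dquot2 a z = C_derive (dquot k z) a.
Proof.
  intros Ha Hz. unfold dquot2. destruct (Ceq_dec z a) as [->|n].
  - apply dquot_diag.
  - assert (Hn' : (a - z)%C <> RtoC 0) by (apply Cminus_eq_contra; auto).
    assert (Hn'' : (z - a)%C <> RtoC 0) by (apply Cminus_eq_contra; auto).
    symmetry. apply is_C_derive_unique, cder_iff.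
    apply (cder_ext_loc (fun w => (k w - k z) * / (w - z))%C _ _ _ (Cmod (a - z))).
    + apply Cmod_gt_0; auto.
    + intros w Hw. rewrite dquot_ne. reflexivity. intros ->. rewrite Cmod_sub_sym in Hw. lra.
    + eapply cder_eq.
      * apply cder_mult. apply cder_minus. apply cdiff_cder, Hk, Ha. apply cder_const.
        apply cder_inv. auto. apply cder_minus. apply cder_id. apply cder_const.
      * cbv beta. rewrite (dquot_ne _ a z), (dquot_ne k a z), dquot_diag by auto. field. auto.
Qed.

Lemma holo_J2 a : disc a -> holo disc (J2 a).
Proof.
  intros Ha z Hz. unfold J2. apply cdiff_minus. apply cdiff_const. apply cdiff_mult. apply cdiff_const.
  apply (holo_dquot disc); auto. apply open_disc.
Qed.

Lemma holo_J2_l z : disc z -> holo disc (fun a => J2 a z).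
Proof.
  intros Hz a Ha. apply (cdiff_ext_loc (J2 z) _ _ 1). lra. intros; apply J2_sym. apply holo_J2; auto.
Qed.

Lemma holo_dquot2 a : disc a -> holo disc (dquot2 a).
Proof.
  intros Ha. unfold dquot2. apply holo_dquot; auto using open_disc. apply holo_dquot; auto using open_disc.
Qed.

Lemma holo_dquot2_l z : disc z -> holo disc (fun a => dquot2 a z).
Proof.
  intros Hz a Ha. destruct (open_disc a Ha) as [d [Hd H]].
  apply (cdiff_ext_loc (C_derive (dquot k z)) _ _ d); auto.
  - intros w Hw. symmetry. apply dquot2_sym; auto.
  - apply (holo_C_derive disc); auto using open_disc. apply holo_dquot; auto using open_disc.
Qed.

(** With F z = k z / z, one has
    - a F'(a) / (F a - F z) = z / (z - a) + suffridge a z. *)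
Definition suffridge (a z : C) : C := (a * z * dquot2 a z / J2 a z)%C.

Lemma holo_suffridge a : disc a -> holo disc (suffridge a).
Proof.
  intros Ha z Hz. unfold suffridge. apply cdiff_div. apply J2_ne; auto.
  apply cdiff_mult. apply cdiff_mult; auto using cdiff_const, cdiff_id. apply holo_dquot2; auto. apply holo_J2; auto.
Qed.

Lemma holo_suffridge_l z : disc z -> holo disc (fun a => suffridge a z).
Proof.
  intros Hz a Ha. unfold suffridge. apply cdiff_div. apply J2_ne; auto.
  apply cdiff_mult. apply cdiff_mult; auto using cdiff_const, cdiff_id. apply (holo_dquot2_l z); auto. apply (holo_J2_l z); auto.
Qed.

Lemma Re_circle_kernel (a z : C) : Cmod a = Cmod z -> a <> z -> Re (z / (z - a)) = 1 / 2.
Proof.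
  intros H Hn.
  assert (Hd : (z - a)%C <> RtoC 0) by (apply Cminus_eq_contra; auto).
  assert (Hs : Cmod a ^ 2 = Cmod z ^ 2) by congruence. rewrite !Cmod2_alt in Hs.
  destruct a as [a1 a2], z as [z1 z2]. simpl in *.
  assert (Hp : 0 < (z1 + - a1) * (z1 + - a1) + (z2 + - a2) * (z2 + - a2)).
  { apply Cmod_gt_0 in Hd. rewrite <- (Rabs_pos_eq (Cmod _)) in Hd by apply Cmod_ge_0.
    assert (0 < Cmod ((z1, z2) - (a1, a2)) ^ 2) by (apply pow_lt; rewrite Rabs_pos_eq in Hd; auto; apply Cmod_ge_0).
    rewrite Cmod2_alt in H0. simpl in H0. lra. }
  unfold Rdiv. rewrite Rmult_1_l. field_simplify_eq; [nra|]. nra.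
Qed.

(** On the circle |a| = |z| the term z / (z - a) has real part 1/2. *)
Lemma suffridge_level_ne a z : disc a -> disc z -> Cmod a = Cmod z -> a <> z -> - (1 / 2) <= Re (suffridge a z).
Proof.
  intros Ha Hz Haz Hn.
  assert (Hzn : z <> 0).
  { intros ->. apply Hn. apply Cmod_eq_0. rewrite Haz. apply Cmod_0. }
  pose proof (level_curve_half_plane a z Ha Hz Hzn ltac:(lra)) as H.
  assert (Hd : (z - a)%C <> RtoC 0) by (apply Cminus_eq_contra; auto).
  pose proof (J_ne a Ha) as HJ. pose proof (J2_ne a z Ha Hz) as HD.
  rewrite <- J2_eq in H. apply Re_div_pos_inv in H.
  2:{ apply Cmult_neq_0. apply Cmult_neq_0; auto. intros E. apply (Cmult_neq_0 _ _ Hzn HJ).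
      rewrite <- (Cmult_1_r (z * J a)). rewrite <- (Cinv_r (z * J a)) by (apply Cmult_neq_0; auto). rewrite E. ring. }
  replace (/ ((z - a) * J2 a z / (z * J a)))%C with (z / (z - a) + suffridge a z)%C in H.
  - rewrite re_plus, Re_circle_kernel in H by auto. lra.
  - unfold suffridge. replace (/ ((z - a) * J2 a z / (z * J a)))%C with (z * J a / ((z - a) * J2 a z))%C by (field; auto).
    rewrite (dquot2_eq a z) . field. auto.
Qed.

Lemma suffridge_level a z : disc a -> disc z -> Cmod a = Cmod z -> - (1 / 2) <= Re (suffridge a z).
Proof.
  intros Ha Hz Haz. destruct (Ceq_dec a z) as [->|n]; [|apply suffridge_level_ne; auto].
  destruct (Ceq_dec z 0) as [->|nz].
  { unfold suffridge. replace (0 * 0 * dquot2 0 0 / J2 0 0)%C with (RtoC 0) by (field; apply J2_ne; auto). simpl. lra. }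
  apply Rnot_lt_le. intros Hneg.
  destruct (rcont_at_Re _ _ (cdiff_cont_at _ _ (holo_suffridge_l z Hz z Hz)) (- (1/2) - Re (suffridge z z)) ltac:(lra)) as [d [Hd H]].
  (* z is approached along its own circle, at the points expi th * z <> z *)
  pose proof (path_cont_expi 0) as Hc.
  apply (filterlim_locally (F := locally 0)) with (eps := mkposreal (d / 2) ltac:(lra)) in Hc.
  destruct Hc as [e He]. specialize (He (Rmin (e / 2) 1)).
  assert (Hm : 0 < Rmin (e / 2) 1). { apply Rmin_glb_lt. pose proof (cond_pos e). lra. lra. }
  assert (Hb : Rabs (Rmin (e / 2) 1 - 0) < e).
  { rewrite Rminus_0_r, Rabs_pos_eq by lra. eapply Rle_lt_trans. apply Rmin_l. pose proof (cond_pos e). lra. }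
  specialize (He Hb). set (th := Rmin (e / 2) 1) in *.
  assert (Hth : 0 < th <= 1) by (split; auto; apply Rmin_r). clearbody th.
  destruct He as [He1 He2]. simpl in He1, He2.
  assert (Hex : Cmod (expi th - 1) < d).
  { replace d with (2 * (d / 2)) by field. apply Cmod_box; simpl. rewrite <- cos_0. exact He1. rewrite <- sin_0. exact He2. }
  assert (Hmod : Cmod (expi th * z) = Cmod z) by (rewrite Cmod_mult, Cmod_expi; ring).
  assert (Hdz : disc (expi th * z)) by (dsc; lra).
  assert (Hne : (expi th * z)%C <> z).
  { intros E. assert (E1 : expi th = 1). { replace (expi th) with (expi th * z / z)%C by (field; auto). rewrite E. field; auto. }
    apply (f_equal Im) in E1. simpl in E1.
    assert (0 < sin th). { apply sin_gt_0. lra. pose proof PI2_1. pose proof PI_RGT_0. lra. } lra. }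
  pose proof (suffridge_level_ne (expi th * z)%C z Hdz Hz Hmod Hne) as HS.
  assert (Hcl : Cmod (expi th * z - z) < d).
  { replace (expi th * z - z)%C with ((expi th - 1) * z)%C by ring. rewrite Cmod_mult.
    dsc. pose proof (Cmod_ge_0 z). pose proof (Cmod_ge_0 (expi th - 1)). nra. }
  specialize (H _ Hcl). apply Rabs_lt_between in H. cbv beta in H. lra.
Qed.

(** The variable of smaller modulus runs over a disc on whose boundary both moduli
    agree. *)
Lemma suffridge_ge a z : disc a -> disc z -> - (1 / 2) <= Re (suffridge a z).
Proof.
  intros Ha Hz.
  assert (Hopp : Re (- suffridge a z) <= 1 / 2); [|rewrite re_opp in Hopp; lra].
  destruct (Ceq_dec z 0) as [->|nz].
  { unfold suffridge. replace (- (a * 0 * dquot2 a 0 / J2 a 0))%C with (RtoC 0) by (field; apply J2_ne; auto). simpl. lra. }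
  destruct (Ceq_dec a 0) as [->|na].
  { unfold suffridge. replace (- (0 * z * dquot2 0 z / J2 0 z))%C with (RtoC 0) by (field; apply J2_ne; auto). simpl. lra. }
  apply Cmod_gt_0 in nz. apply Cmod_gt_0 in na.
  destruct (Rle_lt_dec (Cmod a) (Cmod z)) as [h|h].
  - apply (max_closed_Re (fun a => - suffridge a z)%C 0 1 (Cmod z) (1/2)).
    + dsc; lra.
    + intros w Hw. rewrite Cminus_0_r in Hw. apply cdiff_opp. apply (holo_suffridge_l z); auto.
    + intros w Hw. rewrite Cminus_0_r in Hw. rewrite re_opp.
      pose proof (suffridge_level w z ltac:(dsc; lra) Hz Hw). lra.
    + rewrite Cminus_0_r. auto.
  - apply (max_closed_Re (fun z => - suffridge a z)%C 0 1 (Cmod a) (1/2)).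
    + dsc; lra.
    + intros w Hw. rewrite Cminus_0_r in Hw. apply cdiff_opp. apply (holo_suffridge a); auto.
    + intros w Hw. rewrite Cminus_0_r in Hw. rewrite re_opp.
      pose proof (suffridge_level a w Ha ltac:(dsc; lra) (eq_sym Hw)). lra.
    + rewrite Cminus_0_r. lra.
Qed.

Lemma denominator_ne a z : disc a -> disc z -> (J2 a z + a * z * dquot2 a z)%C <> RtoC 0.
Proof.
  intros Ha Hz E. pose proof (J2_ne a z Ha Hz) as HD. pose proof (suffridge_ge a z Ha Hz) as HS.
  assert (E' : suffridge a z = (- (1))%C).
  { unfold suffridge. replace (a * z * dquot2 a z)%C with ((J2 a z + a * z * dquot2 a z) - J2 a z)%C by ring. rewrite E. field. auto. }
  rewrite E' in HS. simpl in HS. lra.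
Qed.

(** The product a * z * schur a z is the Cayley transform s / (1 + s) of
    s = suffridge a z. *)
Definition schur (a z : C) : C := (dquot2 a z / (J2 a z + a * z * dquot2 a z))%C.

Lemma holo_schur a : disc a -> holo disc (schur a).
Proof.
  intros Ha z Hz. unfold schur. apply cdiff_div. apply denominator_ne; auto. apply holo_dquot2; auto.
  apply cdiff_plus. apply holo_J2; auto. apply cdiff_mult. apply cdiff_mult; auto using cdiff_const, cdiff_id. apply holo_dquot2; auto.
Qed.

Lemma holo_schur_l z : disc z -> holo disc (fun a => schur a z).
Proof.
  intros Hz a Ha. unfold schur. apply cdiff_div. apply denominator_ne; auto. apply (holo_dquot2_l z); auto.
  apply cdiff_plus. apply (holo_J2_l z); auto. apply cdiff_mult. apply cdiff_mult; auto using cdiff_const, cdiff_id. apply (holo_dquot2_l z); auto.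
Qed.

Lemma Cmod_le_of_Re (s : C) : - (1/2) <= Re s -> Cmod s <= Cmod (1 + s).
Proof.
  intros H. apply Rsqr_incr_0; try apply Cmod_ge_0. unfold Rsqr.
  replace (Cmod s * Cmod s) with (Cmod s ^ 2) by ring.
  replace (Cmod (1 + s) * Cmod (1 + s)) with (Cmod (1 + s) ^ 2) by ring.
  rewrite !Cmod2_alt. destruct s as [x y]. simpl in *. nra.
Qed.

Lemma schur_weak a z : disc a -> disc z -> Cmod (a * z * schur a z) <= 1.
Proof.
  intros Ha Hz. pose proof (J2_ne a z Ha Hz) as HD. pose proof (denominator_ne a z Ha Hz) as HN.
  pose proof (Cmod_le_of_Re _ (suffridge_ge a z Ha Hz)) as H.
  assert (E1 : (1 + suffridge a z)%C = ((J2 a z + a * z * dquot2 a z) / J2 a z)%C) by (unfold suffridge; field; auto).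
  assert (H1 : 0 < Cmod (1 + suffridge a z)).
  { rewrite E1, Cmod_div by auto. apply Rdiv_lt_0_compat; apply Cmod_gt_0; auto. }
  replace (a * z * schur a z)%C with (suffridge a z / (1 + suffridge a z))%C.
  - rewrite Cmod_div by (apply Cmod_gt_0; auto). apply Rmult_le_reg_r with (Cmod (1 + suffridge a z)); auto.
    unfold Rdiv. rewrite Rmult_assoc, Rinv_l; lra.
  - rewrite E1. unfold suffridge, schur. field. split; auto.
Qed.

(** The Cayley transform sends the half-plane of [suffridge_ge] into the unit
    disc; the factors a and z are then divided out one after the other. *)
Theorem schur_bound a z : disc a -> disc z -> Cmod (schur a z) <= 1.
Proof.
  intros Ha Hz. revert z Hz. apply bound_divided_by_id. apply holo_schur; auto.
  intros z Hz. apply (bound_divided_by_id (fun a => z * schur a z)%C); auto.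
  - intros b Hb. apply cdiff_mult. apply cdiff_const. apply (holo_schur_l z); auto.
  - intros b Hb. rewrite Cmult_assoc. apply schur_weak; auto.
Qed.
End Concave.

(** Equivalently, z |-> k z / z is univalent in the disc, has its pole at the
    centre and omits a convex set. *)
Definition centred_concave (k : C -> C) : Prop :=
  holo disc k /\ k 0 <> RtoC 0 /\
  (forall a b, disc a -> disc b -> (b * k a)%C = (a * k b)%C -> a = b) /\
  (forall u v t, 0 <= t <= 1 -> omitted k u -> omitted k v ->
     omitted k (RtoC t * u + RtoC (1 - t) * v)%C).

(** * Real disc automorphisms *)

Definition mob (p : R) (z : C) : C := ((RtoC p - z) / (1 - RtoC p * z))%C.

Section Mobius.
Variable p : R.
Hypothesis hp : 0 < p < 1.

Lemma mob_den_ne z : Cmod z <= 1 -> (1 - RtoC p * z)%C <> RtoC 0.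
Proof.
  intros Hz E. apply Ceq_minus in E. apply (f_equal Cmod) in E.
  rewrite Cmod_1, Cmod_mult, Cmod_R, Rabs_pos_eq in E by lra. nra.
Qed.

Lemma mob_sq z : Cmod (1 - RtoC p * z) ^ 2 - Cmod (RtoC p - z) ^ 2 = (1 - p ^ 2) * (1 - Cmod z ^ 2).
Proof. rewrite !Cmod2_alt. destruct z as [x y]. simpl. ring. Qed.

Lemma mob_le z : Cmod z <= 1 -> Cmod (mob p z) <= 1.
Proof.
  intros Hz. pose proof (mob_den_ne z Hz) as Hn. unfold mob. rewrite Cmod_div by auto.
  apply Cmod_gt_0 in Hn. apply Rmult_le_reg_r with (1 := Hn).
  unfold Rdiv. rewrite Rmult_assoc, Rinv_l, Rmult_1_r, Rmult_1_l by lra.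
  apply Rsqr_incr_0; try apply Cmod_ge_0. pose proof (mob_sq z). pose proof (Cmod_ge_0 z).
  unfold Rsqr. assert (0 <= (1 - p ^ 2) * (1 - Cmod z ^ 2)) by (apply Rmult_le_pos; nra). nra.
Qed.

Lemma mob_disc z : disc z -> disc (mob p z).
Proof.
  unfold disc. intros Hz. pose proof (mob_den_ne z ltac:(lra)) as Hn. unfold mob. rewrite Cmod_div by auto.
  apply Cmod_gt_0 in Hn. apply Rmult_lt_reg_r with (1 := Hn).
  unfold Rdiv. rewrite Rmult_assoc, Rinv_l, Rmult_1_r, Rmult_1_l by lra.
  apply Rsqr_incrst_0; try apply Cmod_ge_0. pose proof (mob_sq z). pose proof (Cmod_ge_0 z).
  unfold Rsqr. assert (0 < (1 - p ^ 2) * (1 - Cmod z ^ 2)) by (apply Rmult_lt_0_compat; nra). nra.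
Qed.

Lemma disc_p : disc (RtoC p).
Proof. unfold disc. rewrite Cmod_R, Rabs_pos_eq; lra. Qed.

Lemma one_sub_sq_ne : (1 - RtoC p * RtoC p)%C <> RtoC 0.
Proof. apply mob_den_ne. pose proof disc_p. unfold disc in *. lra. Qed.

Lemma p_ne : RtoC p <> RtoC 0.
Proof. intros E. apply RtoC_inj in E. lra. Qed.

Lemma one_add_sq_ne : (1 + RtoC p * RtoC p)%C <> RtoC 0.
Proof. rewrite <- RtoC_mult, <- RtoC_plus. intros E. apply RtoC_inj in E. nra. Qed.

Lemma mob_mob z : disc z -> mob p (mob p z) = z.
Proof.
  intros Hz. pose proof (mob_den_ne z ltac:(unfold disc in *; lra)) as H1.
  pose proof (mob_den_ne (mob p z) ltac:(pose proof (mob_disc z Hz); unfold disc in *; lra)) as H2.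
  pose proof one_sub_sq_ne. unfold mob in *.
  assert (H3 : (1 - RtoC p * ((RtoC p - z) / (1 - RtoC p * z)))%C = ((1 - RtoC p * RtoC p) / (1 - RtoC p * z))%C) by (field; auto).
  rewrite H3. field. auto.
Qed.

Lemma mob_sub_p z : disc z -> (mob p z - RtoC p)%C = (- (z * (1 - RtoC p * RtoC p)) / (1 - RtoC p * z))%C.
Proof. intros Hz. unfold mob. field. apply mob_den_ne. unfold disc in *; lra. Qed.

Lemma mob_inj a b : disc a -> disc b -> mob p a = mob p b -> a = b.
Proof. intros Ha Hb E. rewrite <- (mob_mob a Ha), <- (mob_mob b Hb), E. reflexivity. Qed.

Lemma mob_0 : mob p 0 = RtoC p.
Proof. unfold mob. field. Qed.

Lemma mob_p : mob p (RtoC p) = 0.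
Proof. unfold mob. field. apply one_sub_sq_ne. Qed.

Lemma mob_ne_p z : disc z -> z <> RtoC 0 -> mob p z <> RtoC p.
Proof. intros Hz Hn E. apply Hn. apply mob_inj; auto. unfold disc; rewrite Cmod_0; lra. rewrite mob_0. auto. Qed.

Lemma mob_ne_0 z : disc z -> z <> RtoC p -> mob p z <> RtoC 0.
Proof. intros Hz Hn E. apply Hn. apply mob_inj; auto. apply disc_p. rewrite mob_p. auto. Qed.

Lemma holo_mob : holo disc (mob p).
Proof.
  intros z Hz. unfold mob. apply cdiff_div. apply mob_den_ne. unfold disc in *; lra.
  apply cdiff_minus; auto using cdiff_const, cdiff_id. apply cdiff_minus. apply cdiff_const.
  apply cdiff_mult; auto using cdiff_const, cdiff_id.
Qed.

End Mobius.

(** * The representation of functions in Co(p) *)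

Section Representation.
Variable p : R.
Hypothesis hp : 0 < p < 1.

Lemma Some_inj (a b : C) : Some a = Some b -> a = b.
Proof. congruence. Qed.

Lemma simple_pole_numerator f : at_most_simple_pole p f ->
  exists k, holo disc k /\ (forall z, disc z -> z <> RtoC p -> f z = Some (k z / (z - RtoC p))%C) /\
    (k (RtoC p) = 0 \/ (f (RtoC p) = None)) /\ (pole f (RtoC p) 1 -> k (RtoC p) <> RtoC 0).
Proof.
  intros [Hf Hp].
  pose (q := fun (v z : C) => if Ceq_dec z (RtoC p) then v else ((z - RtoC p) * finite_part (f z))%C).
  assert (Hq : forall v z, z <> RtoC p -> q v z = ((z - RtoC p) * finite_part (f z))%C).
  { intros v z Hz. unfold q. destruct (Ceq_dec z (RtoC p)); congruence. }
  assert (Hqp : forall v, q v (RtoC p) = v).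
  { intros v. unfold q. destruct (Ceq_dec (RtoC p) (RtoC p)); congruence. }
  assert (Hqf : forall v z, disc z -> z <> RtoC p -> f z = Some (q v z / (z - RtoC p))%C).
  { intros v z Hz Hn. rewrite Hq by auto. destruct (Hf z Hz Hn) as [g Hg].
    apply locally_C_iff in Hg. destruct Hg as [d [Hd Hg]].
    destruct (Hg z) as [E _]. rewrite Cmod_sub_0; auto. rewrite E. simpl. f_equal. field.
    apply Cminus_eq_contra; auto. }
  assert (Hqd : forall v z, disc z -> z <> RtoC p -> C_differentiable (q v) z).
  { intros v z Hz Hn. destruct (Hf z Hz Hn) as [g Hg].
    apply locally_C_iff in Hg. destruct Hg as [d [Hd Hg]].
    apply (cdiff_ext_loc (fun w => (w - RtoC p) * g w)%C _ _ (Rmin d (Cmod (z - RtoC p)))).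
    - apply Rmin_glb_lt; auto. apply Cmod_sub_pos; auto.
    - intros w Hw. destruct (Hg w) as [E _]. eapply Rlt_le_trans; [apply Hw|apply Rmin_l].
      rewrite Hq, E. reflexivity. intros ->. pose proof (Rmin_r d (Cmod (z - RtoC p))). rewrite Cmod_sub_sym in Hw. lra.
    - apply cdiff_mult. apply cdiff_minus; auto using cdiff_const, cdiff_id. destruct (Hg z); auto. rewrite Cmod_sub_0; auto. }
  assert (Hpole : pole f (RtoC p) 1 -> exists v, v <> RtoC 0 /\ C_differentiable (q v) (RtoC p)).
  { intros [_ [_ [h [Hh0 [Hh1 Hh2]]]]].
    apply locally_C_iff in Hh1. apply locally_C_iff in Hh2.
    destruct Hh1 as [d1 [Hd1 Hh1]]. destruct Hh2 as [d2 [Hd2 Hh2]].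
    exists (h (RtoC p)). split; auto. apply (cdiff_ext_loc h _ _ d2); auto.
    - intros w Hw. destruct (Ceq_dec w (RtoC p)) as [->|n]. rewrite Hqp. auto.
      rewrite Hq, (Hh2 w Hw n) by auto. simpl. field. apply Cminus_eq_contra; auto.
    - apply Hh1. rewrite Cmod_sub_0; auto. }
  destruct (classic (pole f (RtoC p) 1)) as [hp1|hp1].
  - destruct (Hpole hp1) as [v [Hv Hd]]. exists (q v). repeat split; auto.
    + intros z Hz. destruct (Ceq_dec z (RtoC p)) as [->|n]; auto.
    + right. apply hp1.
    + rewrite Hqp. auto.
  - destruct Hp as [Hp|Hp]; [|tauto]. exists (q 0). split; [|split; [|split]]; auto.
    intros z Hz. destruct (Ceq_dec z (RtoC p)) as [->|n]; auto.
    destruct Hp as [g Hg]. apply locally_C_iff in Hg. destruct Hg as [d [Hd Hg]].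
    apply (cdiff_ext_loc (fun w => (w - RtoC p) * g w)%C _ _ d); auto.
    + intros w Hw. destruct (Ceq_dec w (RtoC p)) as [->|n]. rewrite Hqp. ring.
      rewrite Hq by auto. destruct (Hg w Hw) as [-> _]. reflexivity.
    + apply cdiff_mult. apply cdiff_minus; auto using cdiff_const, cdiff_id. destruct (Hg (RtoC p)); auto. rewrite Cmod_sub_0; auto.
Qed.

Lemma Co_simple_pole f : Co p f -> at_most_simple_pole p f.
Proof.
  intros [Hm [Hp [_ [_ [Hi _]]]]]. split; [|auto].
  intros z Hz Hn. destruct (Hm z Hz) as [h|[n h]]; auto.
  exfalso. apply Hn. apply Hi; auto. apply (disc_p p hp). destruct h as [_ [E _]]. destruct Hp as [_ [E' _]]. congruence.
Qed.

(** Composition with the involution mob p moves the pole to 0 and the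
    normalisation to p, where f(0) = 0 and f'(0) = 1 become conditions on k. *)
Lemma Co_centred f : Co p f -> exists k,
  centred_concave k /\ k (RtoC p) = 0 /\ cder k (RtoC p) (- RtoC p / (1 - RtoC p * RtoC p)) /\
  (forall z, disc z -> z <> RtoC 0 -> f (mob p z) = Some (k z / z)%C).
Proof.
  intros Hco. destruct (simple_pole_numerator f (Co_simple_pole f Hco)) as [h [Hh [Hf [_ Hhp]]]].
  destruct Hco as [_ [Hp [Hf0 [Hf1 [Hi [Hcn Hcv]]]]]]. specialize (Hhp Hp).
  destruct Hp as [_ [Hfp _]].
  pose proof (one_sub_sq_ne p hp) as Hs. pose proof (p_ne p hp) as Hpn.
  pose (k := fun z => (- (h (mob p z) * (1 - RtoC p * z)) / (1 - RtoC p * RtoC p))%C).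
  assert (Hden : forall z, disc z -> (1 - RtoC p * z)%C <> RtoC 0) by (intros z Hz; apply (mob_den_ne p hp); unfold disc in *; lra).
  assert (Hfk : forall z, disc z -> z <> RtoC 0 -> f (mob p z) = Some (k z / z)%C).
  { intros z Hz Hn. rewrite Hf by (first [apply (mob_disc p hp); assumption | apply (mob_ne_p p hp); assumption]). f_equal. rewrite (mob_sub_p p hp) by auto. unfold k.
    specialize (Hden z Hz). field. repeat split; auto. }
  assert (Hk0 : k 0 <> RtoC 0).
  { unfold k. rewrite mob_0. intros E. apply Hhp.
    replace (h (RtoC p)) with (- (- (h (RtoC p) * (1 - RtoC p * 0)) / (1 - RtoC p * RtoC p)) * (1 - RtoC p * RtoC p))%C by (field; auto).
    rewrite E. ring. }
  assert (Hkz : forall z, disc z -> h (mob p z) = (- (k z * (1 - RtoC p * RtoC p)) / (1 - RtoC p * z))%C).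
  { intros z Hz. unfold k. field. split; auto. }
  assert (Hcd : forall z, disc z -> C_differentiable k z).
  { intros z Hz. unfold k. apply cdiff_div; auto using cdiff_const. apply cdiff_opp. apply cdiff_mult.
    apply (cdiff_comp h (mob p)). apply (holo_mob p hp); auto. apply Hh, (mob_disc p hp), Hz.
    apply cdiff_minus. apply cdiff_const. apply cdiff_mult; auto using cdiff_const, cdiff_id. }
  assert (Hom : forall u, omitted k u <-> ~ exists z, disc z /\ f z = Some u).
  { intros u. split.
    - intros Hu [z [Hz E]].
      assert (Hzp : z <> RtoC p) by (intros ->; congruence).
      assert (Hmz : mob p z <> RtoC 0) by (apply (mob_ne_0 p hp); auto).
      apply (Hu (mob p z)). apply (mob_disc p hp); auto.
      specialize (Hfk (mob p z) ((mob_disc p hp) z Hz) Hmz). rewrite (mob_mob p hp) in Hfk by auto. rewrite E in Hfk.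
      pose proof (Some_inj _ _ Hfk) as Hu'. rewrite Hu'. field; auto.
    - intros Hu z Hz E. apply Hu. exists (mob p z). split. apply (mob_disc p hp); auto.
      assert (Hzn : z <> RtoC 0) by (intros ->; apply Hk0; rewrite E; ring).
      rewrite Hfk by auto. f_equal. rewrite E. field; auto. }
  assert (Hh0 : h 0 = 0).
  { rewrite Hf in Hf0. pose proof (Some_inj _ _ Hf0) as E. replace (h 0) with (h 0 / (0 - RtoC p) * (0 - RtoC p))%C. rewrite E; ring.
    field. intros Q. apply Hpn. replace (RtoC p) with (- (0 - RtoC p))%C by ring. rewrite Q. ring.
    unfold disc. rewrite Cmod_0; lra. auto. }
  exists k. split; [split; [exact Hcd|split; [exact Hk0|split]]|split; [|split]].
  - intros a b Ha Hb E.
    destruct (Ceq_dec a 0) as [->|na].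
    + destruct (Ceq_dec b 0) as [->|nb]; auto. exfalso. apply (Cmult_neq_0 b (k 0)); auto. rewrite E. ring.
    + destruct (Ceq_dec b 0) as [->|nb]. exfalso. apply (Cmult_neq_0 a (k 0)); auto. rewrite <- E. ring.
      apply (mob_inj p hp); auto. apply Hi; try (apply (mob_disc p hp); assumption). rewrite !Hfk by auto. f_equal.
      replace (k a / a)%C with (b * k a / (a * b))%C by (field; auto). rewrite E. field; auto.
  - intros u v t Ht Hu Hv. apply Hom. apply (Hcv u v t Ht); apply Hom; auto.
  - unfold k. rewrite (mob_p p hp), Hh0. field; auto.
  - destruct Hf1 as [g [Hg1 Hg2]]. apply locally_C_iff in Hg1. destruct Hg1 as [d [Hd Hg1]].
    apply cder_iff in Hg2.
    assert (Hg0 : g 0 = 0). { specialize (Hg1 0). rewrite Cmod_sub_0 in Hg1. rewrite Hf0 in Hg1. symmetry. apply Some_inj, Hg1, Hd. }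
    assert (Hh' : cder h 0 (- RtoC p)).
    { apply (cder_ext_loc (fun w => (w - RtoC p) * g w)%C _ _ _ (Rmin d p)).
      - apply Rmin_glb_lt; lra.
      - intros w Hw. rewrite Cminus_0_r in Hw.
        pose proof (Rmin_l d p). pose proof (Rmin_r d p).
        assert (Hwp : w <> RtoC p). { intros ->. rewrite Cmod_R, Rabs_pos_eq in Hw; lra. }
        specialize (Hg1 w). rewrite Cminus_0_r in Hg1. specialize (Hg1 ltac:(lra)).
        rewrite Hf in Hg1 by (auto; unfold disc; lra). apply Some_inj in Hg1. rewrite <- Hg1. field. apply Cminus_eq_contra; auto.
      - eapply cder_eq. apply cder_mult. apply cder_minus. apply cder_id. apply cder_const. apply Hg2.
        cbv beta. rewrite Hg0. ring. }
    assert (Hmob : cder (mob p) (RtoC p) (- / (1 - RtoC p * RtoC p))).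
    { unfold mob. eapply cder_eq. apply cder_mult. apply cder_minus. apply cder_const. apply cder_id.
      apply cder_inv. auto. apply cder_minus. apply cder_const. apply cder_mult. apply cder_const. apply cder_id.
      cbv beta. field. auto. }
    unfold k. eapply cder_eq. apply cder_mult. apply cder_opp. apply cder_mult.
    apply (cder_comp h (mob p)). apply Hmob. rewrite (mob_p p hp). apply Hh'.
    apply cder_minus. apply cder_const. apply cder_mult. apply cder_const. apply cder_id. apply cder_const.
    cbv beta. rewrite (mob_p p hp), Hh0. field. auto.
  - exact Hfk.
Qed.

(** With slit_coef below, the representation reads
    f z * slit_den z = z - slit_coef * (1 + omega z) * z^2. *)
Definition slit_den (z : C) : C := ((1 - z / RtoC p) * (1 - z * RtoC p))%C.
Definition slit_coef : R := p / (1 + p ^ 2).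

Lemma slit_coef_pos : 0 < slit_coef.
Proof. unfold slit_coef. apply Rdiv_lt_0_compat; nra. Qed.

Lemma RtoC_slit_coef : RtoC slit_coef = (RtoC p / (1 + RtoC p * RtoC p))%C.
Proof. unfold slit_coef. rewrite RtoC_div by nra. rewrite RtoC_plus, RtoC_pow. simpl. f_equal. f_equal. ring. Qed.

(** Here s is schur k p z; since k p and the derivative of k at p are known, its
    definition can be solved for k z. *)
Lemma centred_formula k z :
  centred_concave k -> k (RtoC p) = 0 -> cder k (RtoC p) (- RtoC p / (1 - RtoC p * RtoC p)) ->
  disc z -> exists s, Cmod s <= 1 /\
   (k z * (1 - RtoC p * RtoC p) * (1 - RtoC p * RtoC p * s))%C = (RtoC p * (RtoC p - z) * (1 - RtoC p * s * z))%C.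
Proof.
  intros [Hk [Hk0 [Hi Hcv]]] Hkp Hkd Hz. exists (schur k (RtoC p) z). split.
  { apply schur_bound; auto. apply (disc_p p hp). }
  pose proof (one_sub_sq_ne p hp) as Hs.
  pose proof (denominator_ne k Hk Hk0 Hi Hcv (RtoC p) z (disc_p p hp) Hz) as Hden.
  apply cder_iff, is_C_derive_unique in Hkd.
  pose proof (dquot_eq k (RtoC p) z) as E1. pose proof (dquot_eq (dquot k (RtoC p)) (RtoC p) z) as E2.
  rewrite dquot_diag, Hkd in E2. rewrite Hkp in E1.
  unfold schur, J2, dquot2 in *. rewrite Hkp in *.
  set (A := dquot k (RtoC p) z) in *. set (T := dquot (dquot k (RtoC p)) (RtoC p) z) in *.
  set (P := RtoC p) in *. clearbody A T. rewrite E1.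
  assert (Q : (- P)%C = ((1 - P * P) * (A - (z - P) * T))%C) by (rewrite E2; field; auto).
  set (s := (T / (0 - P * A + P * z * T))%C).
  assert (Es : (s * (P * z * T - P * A))%C = T).
  { unfold s. field. intros Q0. apply Hden. etransitivity; [|exact Q0]; ring. }
  clearbody s.
  replace (P * (P - z) * (1 - P * s * z))%C with (- P * ((z - P) * (1 - P * s * z)))%C by ring.
  rewrite Q at 1.
  (* both sides differ by a multiple of the relation defining s *)
  assert (R1 : ((0 + (z - P) * A) * (1 - P * P) * (1 - P * P * s) - (1 - P * P) * (A - (z - P) * T) * ((z - P) * (1 - P * s * z)))%C
     = ((1 - P * P) * (z - P) * (z - P) * (T - s * (P * z * T - P * A)))%C) by ring.
  rewrite Es in R1. apply Ceq_minus. rewrite R1. ring.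
Qed.

Lemma sq_lt_1 : 0 < p ^ 2 < 1.
Proof. split; nra. Qed.

(** In terms of the s of [centred_formula], omega = (p^2 - s) / (1 - p^2 s) is a
    Moebius image of s in the closed disc.  The inequality is |omega z| <= 1
    multiplied by slit_coef * |z|^2, which makes it a bound on an affine function
    of f z. *)
Lemma Co_pointwise f z : Co p f -> disc z -> z <> RtoC p ->
  Cmod (z - RtoC slit_coef * z ^ 2 - finite_part (f z) * slit_den z) <= slit_coef * Cmod z ^ 2.
Proof.
  intros Hco Hz Hzp. destruct (Co_centred f Hco) as [k [Hk [Hkp [Hkd Hf]]]].
  pose (y := mob p z).
  assert (Hy : disc y) by (apply (mob_disc p hp); auto).
  assert (Hyn : y <> RtoC 0) by (apply (mob_ne_0 p hp); auto).
  assert (Hzy : z = mob p y) by (symmetry; apply (mob_mob p hp); auto).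
  destruct (centred_formula k y Hk Hkp Hkd Hy) as [s [Hs E]].
  pose proof (one_sub_sq_ne p hp) as H1. pose proof (p_ne p hp) as H2. pose proof (one_add_sq_ne p hp) as H3.
  assert (H4 : (1 - RtoC p * y)%C <> RtoC 0) by (apply (mob_den_ne p hp); unfold disc in Hy; lra).
  assert (Hp2 : RtoC (p ^ 2) = (RtoC p * RtoC p)%C) by (rewrite RtoC_pow; simpl; ring).
  assert (H5 : (1 - RtoC p * RtoC p * s)%C <> RtoC 0).
  { rewrite <- Hp2. intros Q. apply Ceq_minus in Q. apply (f_equal Cmod) in Q.
    pose proof sq_lt_1. rewrite Cmod_1, Cmod_mult, Cmod_R, Rabs_pos_eq in Q by lra. nra. }
  assert (Ek : k y = (RtoC p * (RtoC p - y) * (1 - RtoC p * s * y) / ((1 - RtoC p * RtoC p) * (1 - RtoC p * RtoC p * s)))%C).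
  { rewrite <- E. field. auto. }
  rewrite Hzy, Hf by auto. simpl finite_part.
  replace (mob p y - RtoC slit_coef * mob p y ^ 2 - k y / y * slit_den (mob p y))%C
    with (RtoC slit_coef * mob p y ^ 2 * ((RtoC p * RtoC p - s) / (1 - RtoC p * RtoC p * s)))%C.
  - rewrite !Cmod_mult, Cmod_pow, Cmod_R, Rabs_pos_eq by (left; apply slit_coef_pos).
    rewrite <- (Rmult_1_r (slit_coef * Cmod (mob p y) ^ 2)) at 2. apply Rmult_le_compat_l.
    apply Rmult_le_pos. left; apply slit_coef_pos. apply pow2_ge_0.
    rewrite <- Hp2. change ((RtoC (p ^ 2) - s) / (1 - RtoC (p ^ 2) * s))%C with (mob (p ^ 2) s).
    apply mob_le; auto. apply sq_lt_1.
  - rewrite Ek, RtoC_slit_coef. unfold slit_den, mob. simpl Cpow. field. repeat split; auto.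
Qed.
End Representation.

(** * Passage to the closed convex hull *)

Section Hull.
Variable p : R.
Hypothesis hp : 0 < p < 1.

Lemma convex_sum_bound (a e0 e1 e2 e3 : C) (t : nat -> R) (X0 X1 X2 X3 : nat -> C) B n :
  (forall i, (i <= n)%nat -> 0 <= t i /\ Cmod (a + e0 * X0 i + e1 * X1 i + e2 * X2 i + e3 * X3 i) <= B) ->
  sum_n t n = 1 ->
  Cmod (a + e0 * @sum_n C_AbelianMonoid (fun i => RtoC (t i) * X0 i)%C n
     + e1 * @sum_n C_AbelianMonoid (fun i => RtoC (t i) * X1 i)%C n
     + e2 * @sum_n C_AbelianMonoid (fun i => RtoC (t i) * X2 i)%C n
     + e3 * @sum_n C_AbelianMonoid (fun i => RtoC (t i) * X3 i)%C n) <= B.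
Proof.
  intros H Hs.
  assert (G : forall m, (m <= n)%nat ->
    Cmod (RtoC (sum_n t m) * a + e0 * @sum_n C_AbelianMonoid (fun i => RtoC (t i) * X0 i)%C m
     + e1 * @sum_n C_AbelianMonoid (fun i => RtoC (t i) * X1 i)%C m
     + e2 * @sum_n C_AbelianMonoid (fun i => RtoC (t i) * X2 i)%C m
     + e3 * @sum_n C_AbelianMonoid (fun i => RtoC (t i) * X3 i)%C m) <= sum_n t m * B).
  { assert (Hterm : forall i, (i <= n)%nat -> Cmod (RtoC (t i) * (a + e0 * X0 i + e1 * X1 i + e2 * X2 i + e3 * X3 i)) <= t i * B).
    { intros i Hi. destruct (H i Hi) as [h1 h2]. rewrite Cmod_mult, Cmod_R, Rabs_pos_eq by auto. apply Rmult_le_compat_l; auto. }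
    induction m as [|m IH]; intros Hm.
    - rewrite !sum_O. eapply Rle_trans; [|apply Hterm; auto]. right. f_equal. ring.
    - rewrite !sum_Sn. specialize (IH ltac:(lia)). specialize (Hterm (S m) Hm).
      change (@plus R_AbelianMonoid) with Rplus. change (@plus C_AbelianMonoid) with Cplus.
      set (u0 := @sum_n C_AbelianMonoid (fun i => RtoC (t i) * X0 i)%C m) in *. set (u1 := @sum_n C_AbelianMonoid (fun i => RtoC (t i) * X1 i)%C m) in *.
      set (u2 := @sum_n C_AbelianMonoid (fun i => RtoC (t i) * X2 i)%C m) in *. set (u3 := @sum_n C_AbelianMonoid (fun i => RtoC (t i) * X3 i)%C m) in *.
      set (s := @sum_n R_AbelianMonoid t m) in *.
      replace (RtoC (s + t (S m)) * a + e0 * (u0 + RtoC (t (S m)) * X0 (S m)) + e1 * (u1 + RtoC (t (S m)) * X1 (S m))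
        + e2 * (u2 + RtoC (t (S m)) * X2 (S m)) + e3 * (u3 + RtoC (t (S m)) * X3 (S m)))%C with
       ((RtoC s * a + e0 * u0 + e1 * u1 + e2 * u2 + e3 * u3) +
        RtoC (t (S m)) * (a + e0 * X0 (S m) + e1 * X1 (S m) + e2 * X2 (S m) + e3 * X3 (S m)))%C
        by (rewrite RtoC_plus; ring).
      eapply Rle_trans. apply Cmod_triangle. lra. }
  specialize (G n (le_n n)). rewrite Hs in G. rewrite Rmult_1_l in G.
  eapply Rle_trans; [|apply G]. right. f_equal. ring.
Qed.

Lemma compact_finite {T : UniformSpace} (l : list T) : compact_set (fun z => In z l).
Proof.
  intros I U HU Hc. induction l as [|x l IH].
  - exists nil. intros z [].
  - destruct IH as [L HL]. { intros z Hz. apply Hc. right. auto. }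
    destruct (Hc x) as [i Hi]. { left; auto. }
    exists (i :: L). intros z [<-|Hz].
    + exists i. split; auto. left; auto.
    + destruct (HL z Hz) as [j [Hj1 Hj2]]. exists j. split; auto. right; auto.
Qed.

(** Bounds on affine functions of finitely many values pass to convex
    combinations, and to limits because finite sets are compact. *)
Lemma hull_bound (a e0 e1 e2 e3 z0 z1 z2 z3 : C) B f :
  (forall z, In z (z0 :: z1 :: z2 :: z3 :: nil) -> disc z /\ z <> RtoC p) ->
  (forall g, Co p g -> Cmod (a + e0 * finite_part (g z0) + e1 * finite_part (g z1) + e2 * finite_part (g z2) + e3 * finite_part (g z3)) <= B) ->
  closed_convex_hull p (Co p) f ->
  Cmod (a + e0 * finite_part (f z0) + e1 * finite_part (f z1) + e2 * finite_part (f z2) + e3 * finite_part (f z3)) <= B.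
Proof.
  intros Hz HB [_ Hf]. apply le_epsilon. intros e He.
  pose (M := Cmod e0 + Cmod e1 + Cmod e2 + Cmod e3 + 1).
  pose proof (Cmod_ge_0 e0). pose proof (Cmod_ge_0 e1). pose proof (Cmod_ge_0 e2). pose proof (Cmod_ge_0 e3).
  assert (HM : 1 <= M) by (unfold M; lra).
  destruct (Hf (fun z => In z (z0 :: z1 :: z2 :: z3 :: nil)) (e / M)) as [g [[_ [n [t [F [HF [Hs Hg]]]]]] Hfg]].
  - apply (compact_finite (T := C_UniformSpace)).
  - exact Hz.
  - apply Rdiv_lt_0_compat; lra.
  - assert (Hgb : Cmod (a + e0 * finite_part (g z0) + e1 * finite_part (g z1) + e2 * finite_part (g z2) + e3 * finite_part (g z3)) <= B).
    { rewrite !Hg by (apply Hz; simpl; tauto). unfold finite_part at 1 3 5 7.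
      apply (convex_sum_bound a e0 e1 e2 e3 t (fun i => finite_part (F i z0)) (fun i => finite_part (F i z1)) (fun i => finite_part (F i z2)) (fun i => finite_part (F i z3))); auto.
      intros i Hi. destruct (HF i Hi) as [h1 h2]. split; auto. }
    pose proof (Hfg z0 ltac:(simpl; tauto)) as D0. pose proof (Hfg z1 ltac:(simpl; tauto)) as D1.
    pose proof (Hfg z2 ltac:(simpl; tauto)) as D2. pose proof (Hfg z3 ltac:(simpl; tauto)) as D3.
    set (f0 := finite_part (f z0)) in *. set (f1 := finite_part (f z1)) in *. set (f2 := finite_part (f z2)) in *. set (f3 := finite_part (f z3)) in *.
    set (g0 := finite_part (g z0)) in *. set (g1 := finite_part (g z1)) in *. set (g2 := finite_part (g z2)) in *. set (g3 := finite_part (g z3)) in *.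
    replace (a + e0 * f0 + e1 * f1 + e2 * f2 + e3 * f3)%C with
      ((a + e0 * g0 + e1 * g1 + e2 * g2 + e3 * g3) + ((e0 * (f0 - g0) + e1 * (f1 - g1)) + (e2 * (f2 - g2) + e3 * (f3 - g3))))%C by ring.
    eapply Rle_trans. apply Cmod_triangle.
    assert (Cmod ((e0 * (f0 - g0) + e1 * (f1 - g1)) + (e2 * (f2 - g2) + e3 * (f3 - g3))) <= M * (e / M)).
    { eapply Rle_trans. apply Cmod_triangle.
      pose proof (Cmod_triangle (e0 * (f0 - g0)) (e1 * (f1 - g1))).
      pose proof (Cmod_triangle (e2 * (f2 - g2)) (e3 * (f3 - g3))).
      rewrite !Cmod_mult in *.
      assert (0 < e / M) by (apply Rdiv_lt_0_compat; lra).
      unfold M at 1. rewrite !Rmult_plus_distr_r.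
      assert (Cmod e0 * Cmod (f0 - g0) <= Cmod e0 * (e / M)) by (apply Rmult_le_compat_l; lra).
      assert (Cmod e1 * Cmod (f1 - g1) <= Cmod e1 * (e / M)) by (apply Rmult_le_compat_l; lra).
      assert (Cmod e2 * Cmod (f2 - g2) <= Cmod e2 * (e / M)) by (apply Rmult_le_compat_l; lra).
      assert (Cmod e3 * Cmod (f3 - g3) <= Cmod e3 * (e / M)) by (apply Rmult_le_compat_l; lra).
      lra. }
    replace (M * (e / M)) with e in * by (field; lra). lra.
Qed.

Lemma hull_pointwise f z : closed_convex_hull p (Co p) f -> disc z -> z <> RtoC p ->
  Cmod (z - RtoC (slit_coef p) * z ^ 2 - finite_part (f z) * slit_den p z) <= slit_coef p * Cmod z ^ 2.
Proof.
  intros Hf Hz Hzp.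
  pose proof (hull_bound (z - RtoC (slit_coef p) * z ^ 2) (- slit_den p z) 0 0 0 z z z z (slit_coef p * Cmod z ^ 2) f) as H.
  replace (z - RtoC (slit_coef p) * z ^ 2 - finite_part (f z) * slit_den p z)%C with
   (z - RtoC (slit_coef p) * z ^ 2 + - slit_den p z * finite_part (f z) + 0 * finite_part (f z) + 0 * finite_part (f z) + 0 * finite_part (f z))%C by ring.
  apply H; auto.
  - intros w [<-|[<-|[<-|[<-|[]]]]]; auto.
  - intros g Hg.
    replace (z - RtoC (slit_coef p) * z ^ 2 + - slit_den p z * finite_part (g z) + 0 * finite_part (g z) + 0 * finite_part (g z) + 0 * finite_part (g z))%C with
      (z - RtoC (slit_coef p) * z ^ 2 - finite_part (g z) * slit_den p z)%C by ring.
    apply Co_pointwise; auto.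
Qed.

Lemma slit_den_eq z : slit_den p z = (- ((z - RtoC p) * (1 - RtoC p * z)) / RtoC p)%C.
Proof. unfold slit_den. field. apply p_ne, hp. Qed.

Lemma slit_den_ne z : disc z -> z <> RtoC p -> slit_den p z <> RtoC 0.
Proof.
  intros Hz Hn. rewrite slit_den_eq. intros E.
  pose proof (mob_den_ne p hp z ltac:(unfold disc in *; lra)) as H1. pose proof (p_ne p hp) as H2.
  pose proof (Cminus_eq_contra _ _ Hn) as H3.
  apply (Cmult_neq_0 _ _ H3 H1).
  replace ((z - RtoC p) * (1 - RtoC p * z))%C with (- (- ((z - RtoC p) * (1 - RtoC p * z)) / RtoC p) * RtoC p)%C by (field; auto).
  rewrite E. ring.
Qed.

(** The numerator n z = z - f z * slit_den z extends holomorphically to p, and the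
    bound of [hull_pointwise] forces n z = z^2 B z with |B - slit_coef| <= slit_coef,
    so that omega = B / slit_coef - 1.  If f had no pole at p, then B p would be
    1 / p, which exceeds 2 slit_coef. *)
Theorem hull_representable f : closed_convex_hull p (Co p) f -> representable p f.
Proof.
  intros Hf. destruct (simple_pole_numerator p hp f (proj1 Hf)) as [k [Hk [Hfk [Hkp _]]]].
  pose proof (p_ne p hp) as Hpn. pose proof (slit_coef_pos p hp) as Hc.
  pose (c := slit_coef p). fold c in Hc.
  assert (Hcn : RtoC c <> RtoC 0) by (intros E; apply RtoC_inj in E; lra).
  pose (n := fun z => (z + k z * (1 - z * RtoC p) / RtoC p)%C).
  assert (Hn : holo disc n).
  { intros z Hz. unfold n. apply cdiff_plus. apply cdiff_id. apply cdiff_div; auto using cdiff_const.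
    apply cdiff_mult; auto. apply cdiff_minus. apply cdiff_const. apply cdiff_mult; auto using cdiff_const, cdiff_id. }
  assert (Hnb : forall z, disc z -> z <> RtoC p -> Cmod (n z - RtoC c * z ^ 2) <= c * Cmod z ^ 2).
  { intros z Hz Hzp. pose proof (hull_pointwise f z Hf Hz Hzp) as H. rewrite Hfk in H by auto. simpl finite_part in H.
    replace (n z - RtoC c * z ^ 2)%C with (z - RtoC (slit_coef p) * z ^ 2 - k z / (z - RtoC p) * slit_den p z)%C; auto.
    rewrite slit_den_eq. unfold n. fold c. field. split; auto. apply Cminus_eq_contra; auto. }
  assert (D0 : disc 0) by (unfold disc; rewrite Cmod_0; lra).
  assert (Hn0 : n 0 = 0).
  { apply Cmod_eq_0. apply Rle_antisym; [|apply Cmod_ge_0]. specialize (Hnb 0 D0).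
    replace (n 0 - RtoC c * 0 ^ 2)%C with (n 0) in Hnb by (simpl; ring). rewrite Cmod_0 in Hnb.
    simpl in Hnb. rewrite Rmult_0_l, Rmult_0_r in Hnb. apply Hnb. auto. }
  pose (A := dquot n 0). assert (HA : holo disc A) by (apply holo_dquot; auto using open_disc).
  assert (HnA : forall z, n z = (z * A z)%C). { intros z. rewrite (dquot_eq n 0 z), Hn0. unfold A. ring. }
  assert (HAb : forall z, disc z -> z <> RtoC p -> z <> RtoC 0 -> Cmod (A z - RtoC c * z) <= c * Cmod z).
  { intros z Hz Hzp Hz0. specialize (Hnb z Hz Hzp). rewrite HnA in Hnb.
    replace (z * A z - RtoC c * z ^ 2)%C with (z * (A z - RtoC c * z))%C in Hnb by (simpl; ring).
    rewrite Cmod_mult in Hnb. apply Cmod_gt_0 in Hz0. apply Rmult_le_reg_l with (1 := Hz0). nra. }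
  assert (HA0 : A 0 = 0).
  { apply Ceq_eps. intros e He.
    destruct (cdiff_cont_at _ _ (HA 0 D0) (e / 2) ltac:(lra)) as [d [Hd H]].
    pose (h := Rmin (d / 2) (Rmin (p / 2) (e / (8 * c)))).
    assert (Hh : 0 < h). { unfold h. repeat apply Rmin_glb_lt; try lra. apply Rdiv_lt_0_compat; lra. }
    assert (Hh1 : h <= d / 2) by apply Rmin_l.
    assert (Hh2 : h <= p / 2) by (eapply Rle_trans; [apply Rmin_r|apply Rmin_l]).
    assert (Hh3 : h <= e / (8 * c)) by (eapply Rle_trans; [apply Rmin_r|apply Rmin_r]).
    clearbody h.
    assert (Hm : Cmod (RtoC h) = h) by (rewrite Cmod_R, Rabs_pos_eq; lra).
    specialize (H (RtoC h)). replace (RtoC h - 0)%C with (RtoC h) in H by ring. specialize (H ltac:(lra)).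
    specialize (HAb (RtoC h) ltac:(unfold disc; lra) ltac:(intros E; apply RtoC_inj in E; lra) ltac:(intros E; apply RtoC_inj in E; lra)).
    rewrite Hm in HAb.
    replace (A 0 - 0)%C with ((A (RtoC h) - RtoC c * RtoC h) - (A (RtoC h) - A 0) + RtoC c * RtoC h)%C by ring.
    eapply Rle_lt_trans. apply Cmod_triangle.
    pose proof (Cmod_sub_le (A (RtoC h) - RtoC c * RtoC h) (A (RtoC h) - A 0)).
    rewrite Cmod_mult, Hm, Cmod_R, Rabs_pos_eq by lra.
    assert (c * h <= e / 8). { replace (e / 8) with (c * (e / (8 * c))) by (field; lra). apply Rmult_le_compat_l; lra. }
    lra. }
  pose (B := dquot A 0). assert (HB : holo disc B) by (apply holo_dquot; auto using open_disc).
  assert (HAB : forall z, A z = (z * B z)%C). { intros z. rewrite (dquot_eq A 0 z), HA0. unfold B. ring. }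
  assert (HBb : forall z, disc z -> Cmod (B z - RtoC c) <= c).
  { intros z Hz. apply (max_principle (fun z => B z - RtoC c)%C 0 1 c).
    - intros w Hw. rewrite Cminus_0_r in Hw. apply cdiff_minus. apply HB; auto. apply cdiff_const.
    - intros e He. exists p. split. lra. intros w Hw. rewrite Cminus_0_r in Hw.
      assert (Hw0 : w <> RtoC 0) by (apply Cmod_gt_0; lra).
      assert (Hwp : w <> RtoC p). { intros ->. rewrite Cmod_R, Rabs_pos_eq in Hw; lra. }
      specialize (HAb w ltac:(unfold disc; lra) Hwp Hw0). rewrite HAB in HAb.
      replace (w * B w - RtoC c * w)%C with (w * (B w - RtoC c))%C in HAb by ring. rewrite Cmod_mult in HAb.
      assert (Cmod (B w - RtoC c) <= c); [|lra]. apply Rmult_le_reg_l with (Cmod w). lra. nra.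
    - rewrite Cminus_0_r. auto. }
  exists (fun z => B z / RtoC c - 1)%C. split; [|split].
  - intros z Hz. apply cdiff_minus; auto using cdiff_const. apply cdiff_div; auto using cdiff_const.
  - intros z Hz. replace (B z / RtoC c - 1)%C with ((B z - RtoC c) / RtoC c)%C by (field; auto).
    rewrite Cmod_div, Cmod_R, Rabs_pos_eq by (auto; lra). apply Rmult_le_reg_r with c; auto.
    unfold Rdiv. rewrite Rmult_assoc, Rinv_l, Rmult_1_r, Rmult_1_l by lra. auto.
  - intros z Hz. fold (slit_coef p). fold c. fold (slit_den p z).
    replace (z - RtoC c * (1 + (B z / RtoC c - 1)) * z ^ 2)%C with (- (k z * (1 - z * RtoC p)) / RtoC p)%C.
    2:{ transitivity (z - n z)%C. unfold n. field; auto. rewrite HnA, HAB. simpl. field; auto. }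
    unfold sphere_div. destruct (Ceq_dec z (RtoC p)) as [->|nz].
    + destruct (Ceq_dec (slit_den p (RtoC p)) 0) as [_|nd].
      2:{ exfalso. apply nd. unfold slit_den. field; auto. }
      destruct Hkp as [Hkp|Hkp]; auto. exfalso.
      assert (E : B (RtoC p) = RtoC (/ p)).
      { pose proof (HnA (RtoC p)) as H1. rewrite HAB in H1. unfold n in H1. rewrite Hkp in H1.
        rewrite RtoC_inv by lra. replace (B (RtoC p)) with (RtoC p * (RtoC p * B (RtoC p)) / (RtoC p * RtoC p))%C by (field; auto).
        rewrite <- H1. field; auto. }
      specialize (HBb (RtoC p) Hz). rewrite E, <- RtoC_minus, Cmod_R in HBb.
      pose proof (Rle_abs (/ p - c)).
      assert (/ p <= 2 * c) by lra. unfold c, slit_coef in H0.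
      apply Rmult_le_compat_r with (r := p * (1 + p ^ 2)) in H0; [|nra].
      replace (/ p * (p * (1 + p ^ 2))) with (1 + p ^ 2) in H0 by (field; lra).
      replace (2 * (p / (1 + p ^ 2)) * (p * (1 + p ^ 2))) with (2 * p ^ 2) in H0 by (field; nra). nra.
    + pose proof (slit_den_ne z Hz nz) as Hd. destruct (Ceq_dec (slit_den p z) 0) as [|_]; [contradiction|].
      rewrite Hfk by auto. f_equal. rewrite slit_den_eq.
      pose proof (mob_den_ne p hp z ltac:(unfold disc in *; lra)) as H1.
      pose proof (Cminus_eq_contra _ _ nz) as H3.
      field. repeat split; auto.
Qed.
End Hull.

(** * A functional that separates a representable function from the hull *)

Lemma Ci_sq : (Ci * Ci)%C = (- (1))%C.
Proof. unfold Ci, Cmult, Copp, RtoC; simpl; f_equal; ring. Qed.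

Definition quad_sum (r : R) (g : C -> C) : C :=
  (0 + / RtoC r * g (RtoC r) + / (Ci * RtoC r) * g (Ci * RtoC r) +
   / (- RtoC r) * g (- RtoC r) + / (- (Ci * RtoC r)) * g (- (Ci * RtoC r)))%C.

(** The sums of 1 / z and of 1 / z^2 over the four points z = r i^j vanish. *)
Lemma quad_sum_laurent r (g T : C -> C) (a b : C) : 0 < r ->
  (forall z, Cmod z = r -> g z = (a / z + b + z * T z)%C) ->
  quad_sum r g = (T (RtoC r) + T (Ci * RtoC r) + T (- RtoC r) + T (- (Ci * RtoC r)))%C.
Proof.
  intros Hr Hg.
  assert (Hrn : RtoC r <> RtoC 0) by (intros E; apply RtoC_inj in E; lra).
  pose proof Ci_nz as Hi.
  assert (Hm : Cmod (RtoC r) = r) by (rewrite Cmod_R, Rabs_pos_eq; lra).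
  assert (Hm' : Cmod (Ci * RtoC r) = r) by (rewrite Cmod_mult, Cmod_Ci; lra).
  unfold quad_sum. rewrite !Hg by (rewrite ?Cmod_opp; auto).
  set (y0 := T _). set (y1 := T _). set (y2 := T _). set (y3 := T _). clearbody y0 y1 y2 y3.
  set (x := RtoC r) in *.
  transitivity (y0 + y1 + y2 + y3 + 2 * a / (x * x) * (1 + / (Ci * Ci)))%C.
  - field. repeat split; auto; intros E.
  - rewrite Ci_sq. replace (1 + / - (1))%C with (RtoC 0). ring. field.
Qed.

Section Functional.
Variable p : R.
Hypothesis hp : 0 < p < 1.

(** At z = 0, [centred_formula] reads k 0 (1 - p^2) (1 - p^2 s) = p^2. *)
Lemma residue_bound k :
  centred_concave k -> k (RtoC p) = 0 -> cder k (RtoC p) (- RtoC p / (1 - RtoC p * RtoC p)) ->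
  Cmod (k 0) <= p ^ 2 / (1 - p ^ 2) ^ 2.
Proof.
  intros Hk Hkp Hkd.
  destruct (centred_formula p hp k 0 Hk Hkp Hkd disc_0) as [s [Hs E]].
  pose proof (sq_lt_1 p hp) as Hp2.
  assert (H1 : (1 - RtoC p * RtoC p)%C = RtoC (1 - p ^ 2)).
  { rewrite RtoC_minus, RtoC_pow. simpl. ring. }
  assert (H2 : (RtoC p * (RtoC p - 0) * (1 - RtoC p * s * 0))%C = RtoC (p ^ 2)).
  { rewrite RtoC_pow. simpl. ring. }
  rewrite H1, H2 in E. apply (f_equal Cmod) in E. rewrite !Cmod_mult, !Cmod_R, !Rabs_pos_eq in E by lra.
  assert (H3 : 1 - p ^ 2 <= Cmod (1 - RtoC p * RtoC p * s)).
  { pose proof (Cmod_sub_ge 1 (RtoC p * RtoC p * s)) as H. rewrite Cmod_1, !Cmod_mult, !Cmod_R, !Rabs_pos_eq in H by lra. nra. }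
  apply Rmult_le_reg_r with ((1 - p ^ 2) * Cmod (1 - RtoC p * RtoC p * s)). nra.
  rewrite <- Rmult_assoc, E.
  apply Rle_trans with (p ^ 2 / (1 - p ^ 2) ^ 2 * ((1 - p ^ 2) * (1 - p ^ 2))). right; field; lra.
  apply Rmult_le_compat_l. left. apply Rdiv_lt_0_compat; [lra|apply pow_lt; lra]. apply Rmult_le_compat_l; lra.
Qed.

(** Since schur k 0 z = dquot2 k 0 z / k 0, the remainder in the expansion
    k z / z = k 0 / z + C_derive k 0 + z * dquot2 k 0 z is bounded by |k 0| in the
    whole disc; thus the bound has no error term depending on r. *)
Lemma Co_quad f r : Co p f -> 0 < r < 1 ->
  Cmod (quad_sum r (fun z => finite_part (f (mob p z)))) <= 4 * (p ^ 2 / (1 - p ^ 2) ^ 2).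
Proof.
  intros Hco Hr. destruct (Co_centred p hp f Hco) as [k [Hkc [Hkp [Hkd Hf]]]].
  pose proof (residue_bound k Hkc Hkp Hkd) as Hres. destruct Hkc as [Hk [Hk0 [Hi Hcv]]].
  assert (HT : forall z, disc z -> Cmod (dquot2 k 0 z) <= Cmod (k 0)).
  { intros z Hz. pose proof (schur_bound k Hk Hk0 Hi Hcv 0 z disc_0 Hz) as H.
    unfold schur, J2 in H.
    replace (k 0 - 0 * dquot k 0 z + 0 * z * dquot2 k 0 z)%C with (k 0) in H by ring.
    rewrite Cmod_div in H by auto. apply Cmod_gt_0 in Hk0.
    apply Rmult_le_compat_r with (r := Cmod (k 0)) in H; [|lra]. unfold Rdiv in H. rewrite Rmult_assoc, Rinv_l in H; lra. }
  rewrite (quad_sum_laurent r _ (dquot2 k 0) (k 0) (C_derive k 0)).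
  - assert (Hd : disc (RtoC r)) by (unfold disc; rewrite Cmod_R, Rabs_pos_eq; lra).
    assert (Hd' : disc (Ci * RtoC r)) by (unfold disc; rewrite Cmod_mult, Cmod_Ci, Cmod_R, Rabs_pos_eq; lra).
    assert (Hd1 : disc (- RtoC r)) by (unfold disc; rewrite Cmod_opp; auto).
    assert (Hd2 : disc (- (Ci * RtoC r))) by (unfold disc; rewrite Cmod_opp; auto).
    pose proof (HT _ Hd). pose proof (HT _ Hd'). pose proof (HT _ Hd1). pose proof (HT _ Hd2).
    eapply Rle_trans. apply Cmod_triangle.
    pose proof (Cmod_triangle (dquot2 k 0 (RtoC r) + dquot2 k 0 (Ci * RtoC r)) (dquot2 k 0 (- RtoC r))).
    pose proof (Cmod_triangle (dquot2 k 0 (RtoC r)) (dquot2 k 0 (Ci * RtoC r))). lra.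
  - lra.
  - intros z Hz. assert (Hzd : disc z) by (unfold disc; lra).
    assert (Hz0 : z <> RtoC 0) by (apply Cmod_gt_0; lra).
    rewrite Hf by auto. simpl finite_part. unfold dquot2.
    rewrite (dquot_eq k 0 z) at 1. rewrite (dquot_eq (dquot k 0) 0 z), dquot_diag. field. auto.
Qed.

Definition slit_fun (om : C -> C) (z : C) : sphere :=
  sphere_div (z - RtoC (p / (1 + p ^ 2)) * (1 + om z) * z ^ 2) ((1 - z / RtoC p) * (1 - z * RtoC p)).

(** In the coordinate centred at the pole this is the Blaschke factor
    - (b - z) / (1 - b z), a perturbation of the constant -1. *)
Definition blaschke_omega (b : R) (z : C) : C := (- mob b (mob p z))%C.

Lemma blaschke_representable b : 0 < b < 1 -> representable p (slit_fun (blaschke_omega b)).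
Proof.
  intros Hb. exists (blaschke_omega b). split; [|split].
  - intros z Hz. unfold blaschke_omega. apply cdiff_opp. apply (cdiff_comp (mob b) (mob p)).
    apply holo_mob; auto. apply holo_mob; auto. apply mob_disc; auto.
  - intros z Hz. unfold blaschke_omega. rewrite Cmod_opp. left. apply mob_disc; auto. apply mob_disc; auto.
  - intros z _. reflexivity.
Qed.

Definition amp : R := p / ((1 - p ^ 2) ^ 2 * (1 + p ^ 2)).
(** The part of order z in the Laurent expansion, in the coordinate centred at the
    pole, of the function belonging to blaschke_omega b. *)
Definition tail (b : R) (z : C) : C :=
  (RtoC amp * (RtoC p * RtoC p * RtoC p + RtoC p * RtoC b +
    RtoC p * (1 - RtoC b * RtoC b) * (2 * RtoC p - z - RtoC p * RtoC p * RtoC b) / (1 - RtoC b * z)))%C.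

Lemma RtoC_amp : RtoC amp = (RtoC p / ((1 - RtoC p * RtoC p) * (1 - RtoC p * RtoC p) * (1 + RtoC p * RtoC p)))%C.
Proof.
  pose proof (sq_lt_1 p hp).
  unfold amp. rewrite RtoC_div by (apply Rgt_not_eq, Rmult_lt_0_compat; [apply pow_lt|]; lra).
  rewrite !RtoC_mult, RtoC_pow, RtoC_minus, RtoC_plus, RtoC_pow. simpl. f_equal. ring.
Qed.

Lemma blaschke_laurent b : 0 < b < 1 -> exists a0 b0 : C, forall z, disc z -> z <> RtoC 0 ->
  finite_part (slit_fun (blaschke_omega b) (mob p z)) = (a0 / z + b0 + z * tail b z)%C.
Proof.
  intros Hb.
  exists (RtoC amp * (RtoC p + RtoC p * RtoC p * RtoC p * RtoC b))%C.
  exists (RtoC amp * (- (1 + RtoC p * RtoC p * RtoC p * RtoC p) + RtoC p * (- (2 * RtoC p * RtoC b) - (1 - RtoC b * RtoC b) * RtoC p * RtoC p)))%C.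
  intros z Hz Hz0.
  pose proof (one_sub_sq_ne p hp) as H1. pose proof (p_ne p hp) as H2. pose proof (one_add_sq_ne p hp) as H3.
  pose proof (mob_den_ne p hp z ltac:(unfold disc in *; lra)) as H4.
  pose proof (mob_den_ne b Hb z ltac:(unfold disc in *; lra)) as H5.
  unfold slit_fun. fold (slit_coef p). fold (slit_den p (mob p z)). unfold sphere_div.
  destruct (Ceq_dec (slit_den p (mob p z)) 0) as [E|_].
  { exfalso. revert E. apply slit_den_ne; auto. apply mob_disc; auto. apply mob_ne_p; auto. }
  simpl finite_part. unfold blaschke_omega. rewrite mob_mob by auto.
  rewrite (RtoC_slit_coef p), slit_den_eq by auto. rewrite mob_sub_p by auto.
  unfold tail. rewrite RtoC_amp.
  assert (Hden : (1 - RtoC p * mob p z)%C = ((1 - RtoC p * RtoC p) / (1 - RtoC p * z))%C) by (unfold mob; field; auto).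
  rewrite Hden. unfold mob. simpl Cpow. field. repeat split; auto.
Qed.

(** The excess of tail b 0 over the bound is
    amp * p * (1 - b) * ((1 + b) * (2 p - p^2 b) - 1), and for b -> 1 the last
    factor tends to 4 p - 2 p^2 - 1 = 1 - 2 (1 - p)^2, which is positive for
    1 - sqrt 2 / 2 < p < 1. *)
Lemma tail_0_large : 1 - sqrt 2 / 2 < p -> exists b tau, 0 < b < 1 /\ tail b 0 = RtoC tau /\ p ^ 2 / (1 - p ^ 2) ^ 2 < tau.
Proof.
  intros Hp2.
  assert (Hs : sqrt 2 * sqrt 2 = 2) by (apply sqrt_sqrt; lra).
  assert (Hs0 : 0 < sqrt 2) by (apply sqrt_lt_R0; lra).
  assert (Hd : 0 < 4 * p - 2 * p ^ 2 - 1) by nra.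
  (* the choice 1 - b = d makes the excess a multiple of d^2 *)
  pose (d := (4 * p - 2 * p ^ 2 - 1) / 4).
  assert (Hd0 : 0 < d) by (unfold d; lra).
  assert (Hd1 : d <= 1 / 4). { unfold d. nra. }
  assert (Hd4 : 4 * p - 2 * p ^ 2 = 1 + 4 * d) by (unfold d; field). clearbody d.
  exists (1 - d), (amp * (p ^ 3 + p * (1 - d) + p * (1 - (1 - d) ^ 2) * (2 * p - p ^ 2 * (1 - d)))).
  split. lra. split.
  - unfold tail. rewrite !RtoC_mult, !RtoC_plus, !RtoC_mult, !RtoC_minus, !RtoC_mult, !RtoC_pow, !RtoC_minus. simpl Cpow.
    field.
  - assert (Ha : p ^ 2 / (1 - p ^ 2) ^ 2 = amp * (p * (1 + p ^ 2))) by (unfold amp; field; nra).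
    assert (Ha0 : 0 < amp). { unfold amp. apply Rdiv_lt_0_compat. lra. apply Rmult_lt_0_compat. apply pow_lt; nra. nra. }
    rewrite Ha. apply Rmult_lt_compat_l; auto.
    assert (Hkey : 0 < d * (4 - 2 * p + 3 * p ^ 2 - p ^ 2 * d)) by (apply Rmult_lt_0_compat; nra).
    assert (Hid : p ^ 3 + p * (1 - d) + p * (1 - (1 - d) ^ 2) * (2 * p - p ^ 2 * (1 - d)) - p * (1 + p ^ 2)
       = p * d * ((2 - d) * (2 * p - p ^ 2 + p ^ 2 * d) - 1)) by ring.
    assert (Hid2 : (2 - d) * (2 * p - p ^ 2 + p ^ 2 * d) - 1 = d * (4 - 2 * p + 3 * p ^ 2 - p ^ 2 * d)).
    { replace (d * (4 - 2 * p + 3 * p ^ 2 - p ^ 2 * d)) with (4 * d + d * (- 2 * p + 3 * p ^ 2 - p ^ 2 * d)) by ring.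
      replace (4 * d) with (4 * p - 2 * p ^ 2 - 1) by lra. ring. }
    rewrite Hid2 in Hid.
    assert (0 < p * d * (d * (4 - 2 * p + 3 * p ^ 2 - p ^ 2 * d))) by (apply Rmult_lt_0_compat; auto; nra).
    lra.
Qed.

(** For r -> 0 the four-point sum of this function tends to 4 * tail b 0, beyond
    the bound that [Co_quad] gives on the hull. *)
Theorem blaschke_not_in_hull : 1 - sqrt 2 / 2 < p -> exists f, representable p f /\ ~ closed_convex_hull p (Co p) f.
Proof.
  intros Hp2. destruct (tail_0_large Hp2) as [b [tau [Hb [Htau Hlt]]]].
  exists (slit_fun (blaschke_omega b)). split. apply blaschke_representable; auto. intros Hf.
  destruct (blaschke_laurent b Hb) as [a0 [b0 HL]].
  set (Bd := p ^ 2 / (1 - p ^ 2) ^ 2) in *.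
  assert (Hc : cont_at (tail b) 0).
  { unfold tail. apply cont_at_mult. apply cont_at_const. apply cont_at_plus. apply cont_at_const.
    apply cont_at_div. apply mob_den_ne; auto. rewrite Cmod_0; lra.
    apply cont_at_mult. apply cont_at_const. apply cont_at_minus; auto using cont_at_const. apply cont_at_minus; auto using cont_at_const, cont_at_id.
    apply cont_at_minus; auto using cont_at_const. apply cont_at_mult; auto using cont_at_const, cont_at_id. }
  destruct (Hc (tau - Bd) ltac:(lra)) as [d [Hd H]].
  pose (r := Rmin (d / 2) (1 / 2)).
  assert (Hr : 0 < r) by (apply Rmin_glb_lt; lra).
  assert (Hr1 : r <= d / 2) by apply Rmin_l. assert (Hr2 : r <= 1 / 2) by apply Rmin_r. clearbody r.
  assert (Hpt : forall z, Cmod z = r -> disc z /\ z <> RtoC 0 /\ Cmod (tail b z - RtoC tau) < tau - Bd).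
  { intros z Hz. split. unfold disc; lra. split. apply Cmod_gt_0; lra.
    rewrite <- Htau. apply H. rewrite Cminus_0_r. lra. }
  assert (M0 : Cmod (RtoC r) = r) by (rewrite Cmod_R, Rabs_pos_eq; lra).
  assert (M1 : Cmod (Ci * RtoC r) = r) by (rewrite Cmod_mult, Cmod_Ci; lra).
  assert (M2 : Cmod (- RtoC r) = r) by (rewrite Cmod_opp; auto).
  assert (M3 : Cmod (- (Ci * RtoC r)) = r) by (rewrite Cmod_opp; auto).
  assert (Hq : Cmod (quad_sum r (fun z => finite_part (slit_fun (blaschke_omega b) (mob p z)))) <= 4 * Bd).
  { unfold quad_sum. apply (hull_bound p); auto.
    - intros z Hz.
      assert (Hz' : exists y, Cmod y = r /\ z = mob p y).
      { destruct Hz as [<-|[<-|[<-|[<-|[]]]]]; eexists; split; try reflexivity; auto. }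
      destruct Hz' as [y [Hy ->]]. destruct (Hpt y Hy) as [h1 [h2 _]]. split. apply mob_disc; auto. apply mob_ne_p; auto.
    - intros g Hg. apply (Co_quad g r Hg). lra. }
  rewrite (quad_sum_laurent r _ (tail b) a0 b0) in Hq; [|lra|].
  2:{ intros z Hz. destruct (Hpt z Hz) as [h1 [h2 _]]. apply HL; auto. }
  destruct (Hpt _ M0) as [_ [_ Q0]]. destruct (Hpt _ M1) as [_ [_ Q1]]. destruct (Hpt _ M2) as [_ [_ Q2]]. destruct (Hpt _ M3) as [_ [_ Q3]].
  assert (Q : forall x, Cmod (x - RtoC tau) < tau - Bd -> Bd < Re x).
  { intros x Hx. pose proof (re_le_Cmod (x - RtoC tau)) as Hre. unfold Cminus in Hre at 1. rewrite re_plus, re_opp, re_RtoC in Hre.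
    pose proof (Rle_abs (- (Re x + - tau))) as Ha. rewrite Rabs_Ropp in Ha. lra. }
  apply Q in Q0. apply Q in Q1. apply Q in Q2. apply Q in Q3.
  pose proof (re_le_Cmod (tail b (RtoC r) + tail b (Ci * RtoC r) + tail b (- RtoC r) + tail b (- (Ci * RtoC r)))) as Hre.
  rewrite !re_plus in Hre.
  pose proof (Rle_abs (Re (tail b (RtoC r)) + Re (tail b (Ci * RtoC r)) + Re (tail b (- RtoC r)) + Re (tail b (- (Ci * RtoC r))))). lra.
Qed.
End Functional.

Theorem theorem5 (p : R) (hp : 1 - sqrt 2 / 2 < p < 1) :
  (forall f : C -> sphere,
     closed_convex_hull p (Co p) f -> representable p f) /\
  (exists f : C -> sphere,
     representable p f /\ ~ closed_convex_hull p (Co p) f).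
Proof.
  assert (hp0 : 0 < p < 1).
  { assert (sqrt 2 < 2). { rewrite <- (sqrt_square 2) at 2 by lra. apply sqrt_lt_1; lra. } lra. }
  split.
  - apply hull_representable; auto.
  - apply blaschke_not_in_hull; auto. lra.
Qed.
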